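(* Let $X\subset\mathbb{P}^N$ be a non-degenerate scroll of dimension $n$ over a surface, let $SX\subset\mathbb{P}^N$ be its secant variety, and let $\delta(X):=2n+1-\dim SX$ be its secant defect. If $\delta(X)=2$ and $SX\neq\mathbb{P}^N$, then $X$ is (an isomorphic projection of) the Segre embedding $\mathbb{P}^2\times\mathbb{P}^{n-2}\subset\mathbb{P}^{3n-4}$.
   Context: We work over the complex numbers. A manifold means an irreducible non-singular projective variety; $X\subset\mathbb{P}^N$ is non-degenerate if it is not contained in any hyperplane of $\mathbb{P}^N$. A manifold $X\subset\mathbb{P}^N$ is a scroll over a manifold $W$ if there is a vector bundle $\mathcal{E}$ over $W$ such that $X\cong\mathbb{P}_W(\mathcal{E})$ and the fibres of the resulting projection $\pi:X\to W$ are linearly embedded in $\mathbb{P}^N$ (that is, they are linear subspaces of $\mathbb{P}^N$); it is a scroll over a surface if $\dim W=2$. The secant variety $SX\subset\mathbb{P}^N$ is the closure of the union of all lines $\langle x,x'\rangle$ with $x,x'\in X$, $x\neq x'$. ''(An isomorphic projection of) the Segre embedding'' means that $X\subset\mathbb{P}^N$ is, up to projective equivalence, either the Segre variety $\mathbb{P}^2\times\mathbb{P}^{n-2}\subset\mathbb{P}^{3n-4}$ itself (so $N=3n-4$), or its image in $\mathbb{P}^N$ under a linear projection $\mathbb{P}^{3n-4}\dashrightarrow\mathbb{P}^N$ that maps the Segre variety isomorphically onto its image. *)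

(* Defs.v *)
From HB Require Import structures.
From mathcomp Require Import all_boot all_order all_algebra.
From mathcomp Require Import boolp classical_sets reals.
From mathcomp Require Import complex mpoly.

Set Implicit Arguments.
Unset Strict Implicit.
Unset Printing Implicit Defensive.

Import GRing.Theory.

Local Open Scope classical_set_scope.
Local Open Scope ring_scope.

(* [Proj F d] is the space P(F^d) of lines through the origin of F^d, so that *)
(* P^N is [Proj F N.+1].  A point is the line itself, hence Leibniz equality  *)
(* is equality of points.                                                     *)
Definition Proj (F : closedFieldType) (d : nat) : Type :=
  {L : {vspace 'rV[F]_d} | \dim L == 1%N}.

Section ProjectiveGeometry.
Variable F : closedFieldType.

(* v is a vector of homogeneous coordinates of p; [\dim (val p) == 1] forces  *)
(* v != 0.                                                                    *)
Definition coords d (v : 'rV[F]_d) (p : Proj F d) : Prop := val p = <[v]>%VS.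

Definition zclosed d (A : set (Proj F d)) : Prop :=
  exists S : set {mpoly F[d]},
    (forall f, S f -> exists k, f \is k.-homog) /\
    A = [set p | forall f v, S f -> coords v p -> f.@[v 0] = 0].

Definition zopen d (U : set (Proj F d)) : Prop := zclosed (~` U).

Definition zclosure d (A : set (Proj F d)) : set (Proj F d) :=
  [set p | forall Z, zclosed Z -> A `<=` Z -> Z p].

(* Intended for closed A. *)
Definition irreducible d (A : set (Proj F d)) : Prop :=
  A !=set0 /\
  forall Z1 Z2, zclosed Z1 -> zclosed Z2 -> A = Z1 `|` Z2 -> A = Z1 \/ A = Z2.

Definition has_chain d (A : set (Proj F d)) (k : nat) : Prop :=
  exists Z : nat -> set (Proj F d),
    (forall i, (i <= k)%N -> [/\ zclosed (Z i), irreducible (Z i) & Z i `<=` A])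
    /\ (forall i, (i < k)%N -> Z i `<` Z i.+1).

(* Krull dimension of a nonempty closed set: the maximal length of a chain of *)
(* irreducible closed subsets.                                                *)
Definition krull_dim d (A : set (Proj F d)) : nat :=
  xget 0%N [set k | has_chain A k /\ forall l, has_chain A l -> (l <= k)%N].

(* Jacobian criterion, for the homogeneous ideal of A: the common kernel of   *)
(* the differentials at a vector v of coordinates of p is the affine cone     *)
(* over the embedded projective tangent space of A at p.                      *)
Definition nonsingular d (A : set (Proj F d)) : Prop :=
  forall p v, A p -> coords v p ->
    exists T : {vspace 'rV[F]_d},
      \dim T = (krull_dim A).+1 /\
      forall u, u \in T <->
        forall f k, f \is k.-homog ->
          (forall q w, A q -> coords w q -> f.@[w 0] = 0) ->
          \sum_(i < d) (f^`M(i)).@[v 0] * u 0 i = 0.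

Definition manifold d (A : set (Proj F d)) : Prop :=
  [/\ zclosed A, irreducible A & nonsingular A].

Definition non_degenerate d (A : set (Proj F d)) : Prop :=
  ~ exists l : 'cV[F]_d,
      l != 0 /\ forall p v, A p -> coords v p -> v *m l = 0.

(* A is locally closed in what follows; values outside A are irrelevant. *)
Definition regular_map d e (A : set (Proj F d)) (B : set (Proj F e))
    (f : Proj F d -> Proj F e) : Prop :=
  (forall p, A p -> B (f p)) /\
  forall p, A p ->
    exists (U : set (Proj F d)) (k : nat) (Q : 'I_e -> {mpoly F[d]}),
      [/\ zopen U, U p, forall j, Q j \is k.-homog
        & forall q v, A q -> U q -> coords v q ->
            coords (\row_j (Q j).@[v 0]) (f q)].

Definition regular_fun d (A : set (Proj F d)) (f : Proj F d -> F) : Prop :=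
  forall p, A p ->
    exists (U : set (Proj F d)) (k : nat) (Q1 Q2 : {mpoly F[d]}),
      [/\ zopen U, U p, Q1 \is k.-homog, Q2 \is k.-homog
        & forall q v, A q -> U q -> coords v q ->
            Q2.@[v 0] != 0 /\ f q = Q1.@[v 0] / Q2.@[v 0]].

Definition isomorphism d e (A : set (Proj F d)) (B : set (Proj F e))
    (f : Proj F d -> Proj F e) : Prop :=
  regular_map A B f /\
  exists g : Proj F e -> Proj F d,
    [/\ regular_map B A g, forall p, A p -> g (f p) = p
      & forall q, B q -> f (g q) = q].

Lemma coords_neq0 d (v : 'rV[F]_d) (p : Proj F d) : coords v p -> v != 0.
Proof.
case: p => L /= Ldim; rewrite /coords /= => LE.
by move: Ldim; rewrite LE dim_vline; case: (v != 0).
Qed.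

Lemma vpick_coords d (p : Proj F d) : coords (vpick (val p)) p.
Proof.
case: p => L /= Ldim; rewrite /coords /=; apply/esym/eqP.
have L0 : vpick L != 0 by rewrite vpick0 -dimv_eq0 (eqP Ldim).
by rewrite eqEdim dim_vline L0 (eqP Ldim) andbT -memvE memv_pick.
Qed.

Lemma segre_neq0 d e (u : 'rV[F]_d) (v : 'rV[F]_e) :
  u != 0 -> v != 0 -> mxvec (u^T *m v) != 0.
Proof.
move=> /rV0Pn[i ui] /rV0Pn[j vj]; rewrite mxvec_eq0; apply/eqP => /matrixP/(_ i j).
rewrite !mxE big_ord1 !mxE => /eqP; rewrite mulf_eq0 => /orP[] /eqP h0.
- by rewrite h0 eqxx in ui.
- by rewrite h0 eqxx in vj.
Qed.

Lemma segre_dim d e (p : Proj F d) (q : Proj F e) :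
  \dim <[mxvec ((vpick (val p))^T *m vpick (val q))]>%VS == 1%N.
Proof.
by rewrite dim_vline segre_neq0 // (coords_neq0 (vpick_coords _)).
Qed.

(* ([u], [v]) |-> [u_i v_j]_(i,j), a map P^a x P^b -> P^((a+1)(b+1)-1). *)
Definition segre d e (p : Proj F d) (q : Proj F e) : Proj F (d * e) :=
  exist (fun L : {vspace 'rV[F]_(d * e)} => \dim L == 1%N) _ (segre_dim p q).

Lemma segreP d e (p : Proj F d) (q : Proj F e) u v :
  coords u p -> coords v q -> coords (mxvec (u^T *m v)) (segre p q).
Proof.
move=> pu qv; rewrite /coords /=.
have := coords_neq0 (vpick_coords p); have := coords_neq0 (vpick_coords q).
have /vlineP[a ->] : vpick (val p) \in <[u]>%VS by rewrite -pu memv_pick.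
have /vlineP[b ->] : vpick (val q) \in <[v]>%VS by rewrite -qv memv_pick.
rewrite [(a *: u)^T]linearZ /= -scalemxAl -scalemxAr !linearZ /= scalerA.
move=> bv0 au0; apply/eqP; rewrite eqEdim -memvE memvZ ?memv_line //.
have [a0 u0] : a != 0 /\ u != 0 by apply/andP; rewrite -negb_or -scaler_eq0.
have [b0 v0] : b != 0 /\ v != 0 by apply/andP; rewrite -negb_or -scaler_eq0.
by rewrite !dim_vline scaler_eq0 !mulf_eq0 !(negPf a0) !(negPf b0) /=; case: eqP.
Qed.

(* The product of two locally closed sets is realised by its Segre image. *)
Definition prod_set d e (A : set (Proj F d)) (B : set (Proj F e)) :
    set (Proj F (d * e)) :=
  [set z | exists p q, [/\ A p, B q & z = segre p q]].

(* A vector bundle of rank r over W, given by a trivialising cover and its    *)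
(* transition matrices.  Matrices act on row vectors: v over the chart i is   *)
(* glued with v *m vb_trans i j over the chart j.                             *)
Record vector_bundle d (W : set (Proj F d)) (r : nat) := VectorBundle {
  vb_index : Type;
  vb_chart : vb_index -> set (Proj F d);
  vb_trans : vb_index -> vb_index -> Proj F d -> 'M[F]_r;
  vb_open : forall i, zopen (vb_chart i);
  vb_cover : W `<=` \bigcup_i vb_chart i;
  vb_regular : forall i j a b,
    regular_fun (W `&` vb_chart i `&` vb_chart j)
      (fun w => vb_trans i j w a b);
  vb_unit : forall i j w, W w -> vb_chart i w -> vb_chart j w ->
    vb_trans i j w \in unitmx;
  vb_cocycle : forall i j k w,
    W w -> vb_chart i w -> vb_chart j w -> vb_chart k w ->
    vb_trans i j w *m vb_trans j k w = vb_trans i k w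
}.

(* [pi] is the projection X -> W of an isomorphism X ~ P_W(E): P_W(E) is the  *)
(* gluing of the (W `&` U_i) x P^(r-1) along the transition matrices, so such *)
(* an isomorphism amounts to isomorphisms (pi, psi i) of X over each U_i onto *)
(* (W `&` U_i) x P^(r-1) that match on the overlaps.                          *)
Definition projective_bundle d e (X : set (Proj F d)) (W : set (Proj F e)) r
    (E : vector_bundle W r) (pi : Proj F d -> Proj F e) : Prop :=
  regular_map X W pi /\
  exists psi : vb_index E -> Proj F d -> Proj F r,
    (forall i, isomorphism (X `&` pi @^-1` vb_chart i)
                 (prod_set (W `&` vb_chart i) setT)
                 (fun x => segre (pi x) (psi i x))) /\
    (forall i j x v, X x -> vb_chart i (pi x) -> vb_chart j (pi x) ->
       coords v (psi i x) -> coords (v *m vb_trans i j (pi x)) (psi j x)).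

Definition linear_subspace d (A : set (Proj F d)) : Prop :=
  exists L : {vspace 'rV[F]_d}, A = [set p | (val p <= L)%VS].

Definition scroll_over d e (X : set (Proj F d)) (W : set (Proj F e)) : Prop :=
  exists (r : nat) (E : vector_bundle W r) (pi : Proj F d -> Proj F e),
    projective_bundle X E pi /\
    forall w, W w -> linear_subspace (X `&` pi @^-1` [set w]).

Definition scroll_over_surface d (X : set (Proj F d)) : Prop :=
  exists (m : nat) (W : set (Proj F m.+1)),
    [/\ manifold W, krull_dim W = 2%N & scroll_over X W].

Definition secant_variety d (X : set (Proj F d)) : set (Proj F d) :=
  zclosure [set q | exists x y,
    [/\ X x, X y, x <> y & (val q <= val x + val y)%VS]].

Definition secant_defect d (X : set (Proj F d)) : int :=
  (2 * krull_dim X + 1)%N%:Z - (krull_dim (secant_variety X))%:Z.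

(* The linear map [v] |-> [v A] is defined at p, with value q. *)
Definition linear_map_at d e (A : 'M[F]_(d, e)) (p : Proj F d) (q : Proj F e) :
    Prop :=
  forall v, coords v p -> coords (v *m A) q.

Definition projectively_equivalent d e (Y : set (Proj F d))
    (X : set (Proj F e)) : Prop :=
  exists A : 'M[F]_(d, e),
    [/\ row_free A, row_full A
      & X = [set q | exists2 p, Y p & linear_map_at A p q]].

(* [row_full A]: the linear map is onto, i.e. its coordinate forms are        *)
(* linearly independent.  This also covers the choice of coordinates on the   *)
(* target.                                                                    *)
Definition isomorphic_projection d e (Y : set (Proj F d))
    (X : set (Proj F e)) : Prop :=
  exists (A : 'M[F]_(d, e)) (f : Proj F d -> Proj F e),
    [/\ row_full A, forall p, Y p -> linear_map_at A p (f p)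
      & isomorphism Y X f].

Definition segre_variety (a b : nat) : set (Proj F (a.+1 * b.+1)) :=
  prod_set setT setT.

End ProjectiveGeometry.

Arguments segre_variety : clear implicits.

(* Main.v *)
(* Project [X] to the base [W] and differentiate: for [w] in [W] with fibre [A_w], a local frame    *)
(* [E] of the fibres and its derivatives [D1], [D2] give [T_x X = A_w + c D1 + c D2] at [x = c E].  *)
(* Terracini's lemma turns the hypotheses into [dim (T_x X + T_x' X) <= 2 n] for all [x], [x'] and  *)
(* [dim V >= 2 n + 1] for the ambient vector space [V].  Linear algebra then leaves two cases for   *)
(* a pair of fibres; in one of them the projection of [X] from an osculating space                  *)
(* [A_w + D1 + D2] would have zero differential, hence for general [w0] one gets                    *)
(* [A_w0 + A_w = A_w0 + (b1 D1 + b2 D2)] for all [w <> w0], with [b] a regular map to [P^1].        *)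
(* Two general base points thus produce two frames of [A_w]; the matrix comparing them is constant  *)
(* up to scalars, because it is so along the complete curves [{w | A_w <= A_w3 + (b1 D1 + b2 D2)}]. *)
(* Therefore all fibres are the images of a three-dimensional space of maps [k^(n-1) -> V], which   *)
(* gives an injective regular map [W -> P^2], onto since a regular map from a projective curve to   *)
(* an affine line is constant; so [X] is the image of [P^2 x P^(n-2)] under a linear map.           *)

(* Write n = m + 2. The fibres A_w of X over W are linear spaces of vector dimension m + 1. A bound
   on the tangent space sums then becomes a statement about the matrices A, D1, D2 of a local frame
   and its two derivatives.

   In the Segre model the fibre over w is the set of all w ⊗ c, so it has a frame c -> w ⊗ c that is
   linear in w. The aim is to find such frames on a scroll known only by its tangent spaces. The
   tangent space bound is [sum_tangent_bound]. With defect 2 it says that T_x + T_x' never has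
   dimension above 2n, and SX being a proper subset gives dim V > 2n. Modulo A_w + A_w' at most two
   dimensions are left for the four vectors c D1, c D2, c' D1', c' D2', and [pair_cases] lists the
   ways in which this can happen. Only the first, that a member of the pencil b1 D1 + b2 D2 has its
   image in A_w + A_w', can persist when the osculating spaces A + D1 + D2 fill V. They do so at a
   general point by [full_osculation], since otherwise projecting from one of them gives a
   nonconstant rational function with zero differential. This is impossible in characteristic zero.

   Hence a general w0 gives every other fibre a frame congruent to a member of the pencil of w0
   modulo A_w0, unique up to a scalar and regular in w ([pencil_at]). The frames from two general
   base points differ by a matrix that is constant up to a scalar ([gauge_const]). Both pencil
   conditions together are linear in the frame and have a three-dimensional space of solutions
   ([fibre_family]). So W maps to a plane, bijectively by [plane_map], and x = c T_a has a regular
   inverse x -> a ⊗ c ([segre_projection]).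

   The geometry is carried by vanishing ideals of affine cones. Dimension is measured by
   algebraically independent linear forms: they produce chains by [chain_of_algind], and chains are
   bounded by [prime_chain_bound]. The Nullstellensatz and the cutting of curves out of fibres of
   rational functions rest on [uncountable_dependence]. Completeness enters only as the constancy of
   regular functions ([regular_const]). *)
Require Import Defs.
From mathcomp Require Import all_boot all_order all_algebra.
From mathcomp Require Import boolp classical_sets reals.
From mathcomp Require Import complex mpoly zify ring lra.

Set Implicit Arguments.
Unset Strict Implicit.
Unset Printing Implicit Defensive.

Import Order.TTheory GRing.Theory Num.Theory.

Local Open Scope classical_set_scope.
Local Open Scope ring_scope.

(* This is how the uncountability of the base field is used. *)
Definition has_large_fibres (T : eqType) := forall phi : T -> nat, exists n, forall q,
  exists s : seq T, [/\ uniq s, size s = q & forall x, x \in s -> phi x = n].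

(** * Uncountability of the complex numbers *)

Section Pigeonhole.
Variable R : realType.

Lemma avoid_seq (s : seq R) (a b : R) : a < b ->
  exists a' b', [/\ a <= a', a' < b', b' <= b & forall x, x \in s -> ~ (a' <= x <= b')].
Proof.
elim: s a b => [|y s IHs] a b ab; first by exists a, b; split.
pose p := a + (b - a) / 3; pose q := a + (b - a) / 3 *+ 2.
have [ap pq qb] : [/\ a < p, p < q & q < b] by rewrite /p /q; split; lra.
have [yp|yp] := leP y p.
- have [a' [b' [h1 h2 h3 h4]]] := IHs q b qb.
  exists a', b'; split=> //; first lra.
  by move=> x; rewrite inE => /orP[/eqP->|/h4//]; lra.
- have [a' [b' [h1 h2 h3 h4]]] := IHs a p ap.
  exists a', b'; split=> //; first lra.
  by move=> x; rewrite inE => /orP[/eqP->|/h4//]; lra.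
Qed.

(** Nested intervals: step [n] shrinks the current interval to one that misses [S n], and the
    supremum of the left ends lies in all of them. *)
Lemma cover_seq_false (S : nat -> seq R) : ~ forall x, exists n, x \in S n.
Proof.
move=> cov.
have /choice[f fP] (n : nat) : exists f : R * R -> R * R, forall ab, ab.1 < ab.2 ->
    [/\ ab.1 <= (f ab).1, (f ab).1 < (f ab).2, (f ab).2 <= ab.2 &
        forall x, x \in S n -> ~ ((f ab).1 <= x <= (f ab).2)].
  suff /choice[g gP] (ab : R * R) : exists g : R * R, ab.1 < ab.2 ->
      [/\ ab.1 <= g.1, g.1 < g.2, g.2 <= ab.2 &
          forall x, x \in S n -> ~ (g.1 <= x <= g.2)] by exists g.
  have [/(avoid_seq (S n))[a' [b' h]]|ab_ge] := pselect (ab.1 < ab.2); first by exists (a', b').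
  by exists ab.
pose I := fix I n : R * R := if n is k.+1 then f k (I k) else (0, 1).
have Ilt n : (I n).1 < (I n).2.
  by elim: n => [|n IHn] /=; [exact: ltr01 | case: (fP n _ IHn)].
have Imono n k : (I n).1 <= (I (n + k)%N).1 /\ (I (n + k)%N).2 <= (I n).2.
  elim: k => [|k [h1 h2]]; first by rewrite addn0.
  rewrite addnS /=; have [g1 _ g2 _] := fP (n + k)%N _ (Ilt (n + k)%N).
  by split; [exact: le_trans g1 | exact: le_trans h2].
have Icross n k : (I n).1 <= (I k).2.
  have [_ h1] := Imono k n; have [h2 _] := Imono n k.
  by rewrite addnC in h1; apply: le_trans h2 (le_trans (ltW (Ilt _)) h1).
pose E := [set x | exists n, x = (I n).1].
have Esup : has_sup E.
  by split; [exists (I 0%N).1; exists 0%N | exists (I 0%N).2 => x [n ->]].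
have [n nP] := cov (sup E).
have [_ _ _ /(_ _ nP)] := fP n _ (Ilt n); apply; apply/andP; split.
  by apply: sup_upper_bound => //; exists n.+1.
by apply: sup_le_ub => [|x [k ->]]; [case: Esup | exact: (Icross k n.+1)].
Qed.

(** If every fibre of [phi] were finite, its real points would make the real line a countable union
    of finite sets. *)
Lemma pigeonhole : has_large_fibres R[i].
Proof.
move=> phi; apply: contrapT => /forallNP h.
have /choice[q qP] (n : nat) : exists q, ~ exists s : seq R[i],
    [/\ uniq s, size s = q & forall x, x \in s -> phi x = n].
  by apply/existsNP; apply: h.
suff /choice[S SP] : forall n, exists S : seq R, forall x : R, phi (x%:C)%C = n -> x \in S.
  by apply: (@cover_seq_false S) => x; exists (phi (x%:C)%C); exact: SP.
move=> n; apply: contrapT => /forallNP noS; apply: (qP n).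
suff [s [us ss sP]] : exists s : seq R,
    [/\ uniq s, size s = q n & forall x, x \in s -> phi (x%:C)%C = n].
  exists [seq (x%:C)%C | x <- s]; split; last by move=> _ /mapP[x xs ->]; exact: sP.
    by rewrite map_inj_uniq // => x y [].
  by rewrite size_map.
elim: (q n) => [|k [s [us ss sP]]]; first by exists [::].
have /existsNP[x /not_implyP[xn xs]] := noS s.
exists (x :: s); split; rewrite /= ?ss ?us ?andbT //; first exact/negP.
by move=> y; rewrite inE => /orP[/eqP->|/sP].
Qed.

End Pigeonhole.

(** * Polynomial maps and their differentials *)

Section PolynomialMaps.
Variable F : closedFieldType.
Hypothesis charF : [pchar F] =i pred0.

Lemma mpoly_ring_ind d (P : {mpoly F[d]} -> Prop) :
  (forall c, P c%:MP) -> (forall i, P 'X_i) ->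
  (forall p q, P p -> P q -> P (p + q)) -> (forall p q, P p -> P q -> P (p * q)) ->
  forall p, P p.
Proof.
move=> PC PX PD PM; elim/mpolyind => [|c m p _ _ IHp]; first by rewrite -mpolyC0.
apply: (PD) => //; rewrite -mul_mpolyC; apply: (PM) => //.
rewrite mpolyXE_id; elim/big_ind: _ => [|x y|i _]; [by rewrite -mpolyC1 | exact: PM |].
by elim: (m i) => [|k IHk]; rewrite ?expr0 -?mpolyC1 // exprS; exact: PM.
Qed.

(** The differential of [f] at [v] along [u], in the form in which it appears in [nonsingular]. *)
Definition dif d (f : {mpoly F[d]}) (v u : 'rV[F]_d) : F :=
  \sum_(i < d) (f^`M(i)).@[v 0] * u 0 i.

Lemma difC d c (v u : 'rV[F]_d) : dif c%:MP v u = 0.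
Proof. by rewrite /dif big1 // => i _; rewrite mderivC meval0 mul0r. Qed.

Lemma difX d i (v u : 'rV[F]_d) : dif 'X_i v u = u 0 i.
Proof.
rewrite /dif (bigD1 i) //= big1 => [|j ji].
  by rewrite mderivX mevalZ mevalX mnm1E eqxx big1 ?mul1r ?addr0 ?mulr1 // => k _; rewrite mnmBE mnm1E subnn expr0.
by rewrite mderivX mnm1E eq_sym (negPf ji) scale0r meval0 mul0r.
Qed.

Lemma difD d f g (v u : 'rV[F]_d) : dif (f + g) v u = dif f v u + dif g v u.
Proof. by rewrite /dif -big_split; apply: eq_bigr => i _; rewrite mderivD mevalD mulrDl. Qed.

Lemma difN d f (v u : 'rV[F]_d) : dif (- f) v u = - dif f v u.
Proof. by rewrite /dif -sumrN; apply: eq_bigr => i _; rewrite mderivN mevalN mulNr. Qed.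

Lemma difB d f g (v u : 'rV[F]_d) : dif (f - g) v u = dif f v u - dif g v u.
Proof. by rewrite difD difN. Qed.

Lemma difM d f g (v u : 'rV[F]_d) :
  dif (f * g) v u = dif f v u * g.@[v 0] + f.@[v 0] * dif g v u.
Proof.
rewrite /dif mulr_suml mulr_sumr -big_split; apply: eq_bigr => i _ /=.
by rewrite mderivM mevalD !mevalM mulrDl mulrAC mulrA.
Qed.

Lemma dif_sum d I (r : seq I) (P : pred I) (f : I -> {mpoly F[d]}) v u :
  dif (\sum_(i <- r | P i) f i) v u = \sum_(i <- r | P i) dif (f i) v u.
Proof.
elim/big_rec2: _ => [|i y1 y2 _ <-]; last by rewrite difD.
by rewrite -mpolyC0 difC.
Qed.

Lemma difDr d f (v u u' : 'rV[F]_d) : dif f v (u + u') = dif f v u + dif f v u'.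
Proof. by rewrite /dif -big_split; apply: eq_bigr => i _ /=; rewrite mxE mulrDr. Qed.

Lemma difZr d f (v u : 'rV[F]_d) a : dif f v (a *: u) = a * dif f v u.
Proof. by rewrite /dif mulr_sumr; apply: eq_bigr => i _; rewrite mxE mulrCA. Qed.

Lemma dif_delta d f (v : 'rV[F]_d) i : dif f v (delta_mx 0 i) = f^`M(i).@[v 0].
Proof.
rewrite /dif (bigD1 i) //= big1 ?mxE ?eqxx ?mulr1 ?addr0 // => j ji.
by rewrite mxE (negPf ji) andbF mulr0.
Qed.

Definition ev d a b (v : 'rV[F]_d) (A : 'M[{mpoly F[d]}]_(a, b)) : 'M[F]_(a, b) :=
  map_mx (meval (v 0)) A.

Lemma ev_const d a b (v : 'rV[F]_d) (A : 'M[F]_(a, b)) :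
  ev v (map_mx (@mpolyC d F) A) = A.
Proof. by apply/matrixP => i j; rewrite !mxE mevalC. Qed.

Lemma evM d a b c (v : 'rV[F]_d) (A : 'M_(a, b)) (B : 'M_(b, c)) :
  ev v (A *m B) = ev v A *m ev v B.
Proof. exact: map_mxM. Qed.

Lemma evD d a b (v : 'rV[F]_d) (A B : 'M_(a, b)) : ev v (A + B) = ev v A + ev v B.
Proof. exact: map_mxD. Qed.

Lemma evB d a b (v : 'rV[F]_d) (A B : 'M_(a, b)) : ev v (A - B) = ev v A - ev v B.
Proof. exact: map_mxB. Qed.

Lemma evZ d a b (v : 'rV[F]_d) p (A : 'M_(a, b)) : ev v (p *: A) = p.@[v 0] *: ev v A.
Proof. exact: map_mxZ. Qed.

Lemma ev_det d a (v : 'rV[F]_d) (A : 'M_a) : (\det A).@[v 0] = \det (ev v A).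
Proof. by rewrite det_map_mx. Qed.

Lemma ev_adj d a (v : 'rV[F]_d) (A : 'M_a) : ev v (\adj A) = \adj (ev v A).
Proof. by rewrite /ev map_mx_adj. Qed.

Lemma ev_row_mx d a b c (v : 'rV[F]_d) (A : 'M_(a, b)) (B : 'M_(a, c)) :
  ev v (row_mx A B) = row_mx (ev v A) (ev v B).
Proof. exact: map_row_mx. Qed.

Lemma ev_col_mx d a b c (v : 'rV[F]_d) (A : 'M_(a, c)) (B : 'M_(b, c)) :
  ev v (col_mx A B) = col_mx (ev v A) (ev v B).
Proof. exact: map_col_mx. Qed.

Lemma evE d a b (v : 'rV[F]_d) (A : 'M_(a, b)) i j : ev v A i j = (A i j).@[v 0].
Proof. by rewrite mxE. Qed.

Definition varmx d : 'rV[{mpoly F[d]}]_d := \row_i 'X_i.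

Lemma ev_varmx d (v : 'rV[F]_d) : ev v (varmx d) = v.
Proof. by apply/rowP => i; rewrite !mxE mevalXU. Qed.

Definition dmx d a b (v u : 'rV[F]_d) (A : 'M[{mpoly F[d]}]_(a, b)) : 'M[F]_(a, b) :=
  map_mx (fun f => dif f v u) A.

Lemma dmxM d a b c (v u : 'rV[F]_d) (A : 'M_(a, b)) (B : 'M_(b, c)) :
  dmx v u (A *m B) = dmx v u A *m ev v B + ev v A *m dmx v u B.
Proof.
apply/matrixP => i j; rewrite !mxE dif_sum -big_split; apply: eq_bigr => k _.
by rewrite !mxE difM.
Qed.

Lemma dmx_const d a b (v u : 'rV[F]_d) (A : 'M[F]_(a, b)) :
  dmx v u (map_mx (@mpolyC d F) A) = 0.
Proof. by apply/matrixP => i j; rewrite !mxE difC. Qed.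

Lemma dmx_varmx d (v u : 'rV[F]_d) : dmx v u (varmx d) = u.
Proof. by apply/rowP => i; rewrite !mxE difX. Qed.

Definition cmp d e (Q : 'rV[{mpoly F[d]}]_e) (f : {mpoly F[e]}) : {mpoly F[d]} :=
  f \mPo [tuple Q 0 i | i < e].

Lemma ev_cmp d e (Q : 'rV[{mpoly F[d]}]_e) f (v : 'rV[F]_d) : (cmp Q f).@[v 0] = f.@[(ev v Q) 0].
Proof. by rewrite comp_mpoly_meval; apply: meval_eq => i; rewrite tnth_mktuple evE. Qed.

Lemma cmpC d e (Q : 'rV[{mpoly F[d]}]_e) c : cmp Q c%:MP = c%:MP.
Proof. exact: comp_mpolyC. Qed.

Lemma cmpX d e (Q : 'rV[{mpoly F[d]}]_e) i : cmp Q 'X_i = Q 0 i.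
Proof. by rewrite /cmp comp_mpolyXU -tnth_nth tnth_mktuple. Qed.

Lemma dif_cmp d e (Q : 'rV[{mpoly F[d]}]_e) f (v u : 'rV[F]_d) :
  dif (cmp Q f) v u = dif f (ev v Q) (dmx v u Q).
Proof.
elim/mpoly_ring_ind: f => [c|i|p q|p q].
- by rewrite cmpC !difC.
- by rewrite cmpX difX mxE.
- by move=> hp hq; rewrite /cmp comp_mpolyD !difD hp hq.
- by move=> hp hq; rewrite /cmp rmorphM /= !difM hp hq -!/(cmp _ _) !ev_cmp.
Qed.

Definition cmpmx d e a b (Q : 'rV[{mpoly F[d]}]_e) (A : 'M[{mpoly F[e]}]_(a, b)) :
  'M[{mpoly F[d]}]_(a, b) := map_mx (cmp Q) A.

Lemma ev_cmpmx d e a b (Q : 'rV[{mpoly F[d]}]_e) (A : 'M_(a, b)) (v : 'rV[F]_d) :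
  ev v (cmpmx Q A) = ev (ev v Q) A.
Proof. by apply/matrixP => i j; rewrite !mxE ev_cmp. Qed.

Lemma dmx_cmpmx d e a b (Q : 'rV[{mpoly F[d]}]_e) (A : 'M_(a, b)) (v u : 'rV[F]_d) :
  dmx v u (cmpmx Q A) = dmx (ev v Q) (dmx v u Q) A.
Proof. by apply/matrixP => i j; rewrite !mxE dif_cmp. Qed.

Lemma line_poly d (f : {mpoly F[d]}) (v u : 'rV[F]_d) :
  exists q : {poly F}, forall s,
    q.[s] = f.@[(v + s *: u) 0] /\ q^`().[s] = dif f (v + s *: u) u.
Proof.
elim/mpoly_ring_ind: f => [c|i|p q|p q].
- by exists c%:P => s; rewrite derivC !hornerE difC mevalC.
- exists ((v 0 i)%:P + u 0 i *: 'X) => s; split; first by rewrite mevalXU !mxE !hornerE mulrC.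
  by rewrite difX derivD derivC derivZ derivX !hornerE.
- move=> [a ha] [b hb]; exists (a + b) => s; have [a1 a2] := ha s; have [b1 b2] := hb s.
  by rewrite hornerD a1 b1 mevalD derivD hornerD a2 b2 difD.
- move=> [a ha] [b hb]; exists (a * b) => s; have [a1 a2] := ha s; have [b1 b2] := hb s.
  by rewrite hornerM a1 b1 mevalM derivM hornerD !hornerM a2 b2 difM a1 b1.
Qed.

Lemma fresh_elt (s : seq F) : exists x, x \notin s.
Proof.
pose q : {poly F} := (\prod_(z <- s) ('X - z%:P)) * 'X.
have sq : size q = (size s).+2.
  have q0 : \prod_(z <- s) ('X - z%:P) != 0 :> {poly F}.
    by rewrite -size_poly_eq0 size_prod_XsubC.
  by rewrite /q size_mulX // size_prod_XsubC.
have : size (q + 1) != 1%N by rewrite size_polyDl ?size_poly1 sq.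
move=> /closed_rootP[x xr]; exists x; apply/negP => xs.
move: xr; rewrite rootE /q !hornerE horner_prod (big_rem x) //= !hornerE subrr.
by rewrite !mul0r add0r oner_eq0.
Qed.

Lemma fresh_seq (s : seq F) q : exists t, [/\ uniq t, size t = q & forall x, x \in t -> x \notin s].
Proof.
elim: q => [|q [t [ut st tP]]]; first by exists [::].
have [x] := fresh_elt (s ++ t); rewrite mem_cat negb_or => /andP[xs xt].
exists (x :: t); split; rewrite /= ?xt ?st //.
by move=> y; rewrite inE => /orP[/eqP->|/tP].
Qed.

Lemma poly_eq0_cofinite (q : {poly F}) (s : seq F) : (forall x, x \notin s -> q.[x] = 0) -> q = 0.
Proof.
move=> h; have [t [ut st tP]] := fresh_seq s (size q).
apply: (@roots_geq_poly_eq0 _ q t) => //; last by rewrite st.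
by apply/allP => x /tP/h/eqP.
Qed.

Lemma poly_neq0_cofinite (q : {poly F}) (s : seq F) : q != 0 -> exists2 x, x \notin s & q.[x] != 0.
Proof.
move=> q0; apply: contrapT => h; case/eqP: q0; apply: (@poly_eq0_cofinite _ s) => x xs.
by apply/eqP/negP => /negP qx; apply: h; exists x.
Qed.

(** The restriction of [f] to the line is a polynomial in one variable, so finitely many exceptional
    parameters do no harm; this lets later arguments skip the points where a vector is zero. *)
Lemma dif_along_line d (f : {mpoly F[d]}) (v u : 'rV[F]_d) (s : seq F) :
  (forall x, x \notin s -> f.@[(v + x *: u) 0] = 0) -> dif f v u = 0.
Proof.
move=> h; have [q qP] := line_poly f v u.
have q0 : q = 0 by apply: (@poly_eq0_cofinite q s) => x /h; rewrite (qP x).1.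
by have [_] := qP 0; rewrite q0 deriv0 horner0 scale0r addr0.
Qed.

Lemma charF0 n : (n.+1)%:R != 0 :> F.
Proof. by move/pcharf0P: charF => ->. Qed.

Lemma poly_deriv0 (q : {poly F}) : q^`() = 0 -> q = (q.[0])%:P.
Proof.
move=> q0; apply/polyP => -[|k]; rewrite coefC /= -?horner_coef0 //.
have /polyP/(_ k) := q0; rewrite coef_deriv coef0 => /eqP.
by rewrite -mulr_natr mulf_eq0 (negPf (charF0 _)) orbF => /eqP.
Qed.

Lemma msize_mderiv d (f : {mpoly F[d]}) i : f != 0 -> (msize f^`M(i) < msize f)%N.
Proof.
move=> f0; have [->|d0] := eqVneq f^`M(i) 0.
  by rewrite msize0 lt0n msize_poly_eq0.
rewrite -(mlead_deg d0); set m := mlead _.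
have : f^`M(i)@_m != 0 by rewrite mleadc_eq0.
rewrite mcoeff_deriv => h; have : (m + U_(i))%MM \in msupp f.
  by rewrite mcoeff_msupp; apply: contra h => /eqP->; rewrite mul0rn.
by move/msize_mdeg_lt; rewrite mdegD mdeg1 addn1.
Qed.

Lemma mderiv_all0 d (f : {mpoly F[d]}) : (forall i, f^`M(i) = 0) -> f = (f@_0%MM)%:MP.
Proof.
move=> h; apply/mpolyP => m; rewrite mcoeffC.
have [->|m0] := eqVneq m 0%MM; first by rewrite mulr1.
rewrite mulr0; have [i mi] : exists i, m i != 0%N.
  by apply: contrapT => /forallNP mi; case/eqP: m0; apply/mnmP => i; rewrite mnm0E; apply/eqP/negPn/negP.
have := h i => /mpolyP/(_ (m - U_(i))%MM); rewrite mcoeff_deriv mcoeff0 submK ?lep1mP //.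
by move/eqP; rewrite -mulr_natr mulf_eq0 (negPf (charF0 _)) orbF => /eqP.
Qed.

(** Induction on the degree: the partial derivatives vanish as functions, hence as polynomials, and
    in characteristic zero [f] is then constant. *)
Lemma mpoly_fun_eq0 d (f : {mpoly F[d]}) : (forall v : 'rV[F]_d, f.@[v 0] = 0) -> f = 0.
Proof.
have [k] := ubnP (msize f); elim: k f => // k IHk f fk fv.
have [->//|f0] := eqVneq f 0.
have df i : f^`M(i) = 0.
  apply: IHk => [|v]; first exact: leq_trans (msize_mderiv i f0) _.
  rewrite -dif_delta.
  by apply: (@dif_along_line _ _ _ _ [::]) => x _; rewrite fv.
by have := fv 0; rewrite (mderiv_all0 df) mevalC => ->; rewrite mpolyC0.
Qed.

(** Each monomial of degree [k] acquires the factor [s ^+ k]. *)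
Lemma homog_scale d k (f : {mpoly F[d]}) s (v : 'rV[F]_d) : f \is k.-homog ->
  f.@[(s *: v) 0] = s ^+ k * f.@[v 0].
Proof.
move=> /dhomogP fh; rewrite !mevalE mulr_sumr !big_seq; apply: eq_bigr => m mf.
rewrite mulrCA; congr (_ * _); have <- : mdeg m = k := fh _ mf; rewrite mdegE.
rewrite expr_sum -big_split /=; apply: eq_bigr => i _.
by rewrite mxE exprMn.
Qed.

Definition hc d k (f : {mpoly F[d]}) : {mpoly F[d]} := pihomog mdeg k f.

Lemma hc_homog d k (f : {mpoly F[d]}) : hc k f \is k.-homog.
Proof. exact: pihomogP. Qed.

Lemma hc_sum d (f : {mpoly F[d]}) : f = \sum_(k < msize f) hc k f.
Proof. exact: pihomog_partitionE. Qed.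

Lemma scale_poly d (f : {mpoly F[d]}) (v : 'rV[F]_d) s :
  f.@[(s *: v) 0] = (\poly_(k < msize f) (hc k f).@[v 0]).[s].
Proof.
rewrite horner_poly [in LHS](hc_sum f) raddf_sum /=; apply: eq_bigr => k _.
by rewrite (homog_scale _ _ (hc_homog k f)) mulrC.
Qed.

Lemma hc_msize d (f : {mpoly F[d]}) k : (msize f <= k)%N -> hc k f = 0.
Proof.
move=> fk; rewrite /hc pihomogE big_seq_cond big1 // => m /andP[/msize_mdeg_lt mf /eqP mk].
by move: mf; rewrite mk ltnNge fk.
Qed.

(** The values of the homogeneous components at [v] are the coefficients of [f] restricted to the
    line through [0] and [v]. *)
Lemma hc_vanish d (f : {mpoly F[d]}) (v : 'rV[F]_d) (s : seq F) :
  (forall x, x \notin s -> f.@[(x *: v) 0] = 0) -> forall k, (hc k f).@[v 0] = 0.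
Proof.
move=> h k; have [kf|/hc_msize->] := ltnP k (msize f); last by rewrite meval0.
have /polyP/(_ k) : \poly_(k < msize f) (hc k f).@[v 0] = 0.
  by apply: (@poly_eq0_cofinite _ s) => x /h; rewrite scale_poly.
by rewrite coef_poly kf coef0.
Qed.

Lemma hc_nonvanish d (f : {mpoly F[d]}) (v : 'rV[F]_d) : f.@[v 0] != 0 -> exists k, (hc k f).@[v 0] != 0.
Proof.
move=> fv; apply: contrapT => /forallNP h; case/eqP: fv.
by rewrite (hc_sum f) raddf_sum big1 // => k _; apply/eqP/negP/negP; apply/negPn/negP; exact: h.
Qed.

End PolynomialMaps.

(** * Prime ideals and zeros over an uncountable field *)

Section Ideals.
Variable F : closedFieldType.
Hypothesis pigeonF : has_large_fibres F.

Definition is_ideal d (I : set {mpoly F[d]}) :=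
  [/\ I 0, forall f g, I f -> I g -> I (f + g) & forall a f, I f -> I (a * f)].

Definition mulset d (S : set {mpoly F[d]}) :=
  S 1 /\ forall f g, S f -> S g -> S (f * g).

Definition is_prime d (Q : set {mpoly F[d]}) :=
  [/\ is_ideal Q, ~ Q 1 & forall f g, Q (f * g) -> Q f \/ Q g].

Lemma ideal_sum d (I : set {mpoly F[d]}) J (r : seq J) (P : pred J) (f : J -> {mpoly F[d]}) :
  is_ideal I -> (forall j, P j -> I (f j)) -> I (\sum_(j <- r | P j) f j).
Proof. by move=> [I0 ID _] h; elim/big_ind: _. Qed.

Lemma ideal_sub d (I : set {mpoly F[d]}) f g : is_ideal I -> I f -> I g -> I (f - g).
Proof. by move=> [I0 ID IM] If Ig; apply: ID => //; rewrite -mulN1r; exact: IM. Qed.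

(** An ideal maximal among those avoiding a multiplicative set is prime. The last conclusion keeps
    the maximality: an element outside [Q] divides an element of [S] modulo [Q]. *)
Lemma zorn_ideal d (I S : set {mpoly F[d]}) :
  is_ideal I -> mulset S -> (forall f, I f -> ~ S f) ->
  exists Q, [/\ is_prime Q, I `<=` Q, forall f, Q f -> ~ S f
    & forall a, ~ Q a -> exists s h, S s /\ Q (s - a * h)].
Proof.
move=> idI [S1 SM] IS.
pose P (J : set {mpoly F[d]}) := J = set0 \/
  [/\ is_ideal J, I `<=` J & forall f, J f -> ~ S f].
have [I0 ID IM] := idI.
have [Q [PQ Qmax]] : exists A, P A /\ forall B, A `<` B -> ~ P B.
  apply: Zorn_bigcup => /= G GP Gtot.
  have [[J [GJ J0]]|noJ] := pselect (exists J, G J /\ J !=set0); last first.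
    left; apply/seteqP; split=> // x [J GJ Jx]; apply: noJ.
    by exists J; split=> //; exists x.
  have good K : G K -> K !=set0 -> [/\ is_ideal K, I `<=` K & forall f, K f -> ~ S f].
    by move=> /GP[->|//] [].
  have [[J00 _ _] IJ _] := good J GJ J0.
  right; split=> [|x Ix|f [K GK Kf]].
  - split=> [|f g [K GK Kf] [L GL Lg]|a f [K GK Kf]].
    + by exists J.
    + have [[_ KD _] _ _] := good K GK (ex_intro _ f Kf).
      have [[_ LD _] _ _] := good L GL (ex_intro _ g Lg).
      have [KL|LK] := Gtot K L GK GL.
        by exists L => //; apply: LD => //; exact: KL.
      by exists K => //; apply: KD => //; exact: LK.
    + by have [[_ _ KM] _ _] := good K GK (ex_intro _ f Kf); exists K => //; exact: KM.
  - by exists J => //; exact: IJ.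
  - by have [_ _] := good K GK (ex_intro _ f Kf); apply.
have [idQ IQ QS] : [/\ is_ideal Q, I `<=` Q & forall f, Q f -> ~ S f].
  case: PQ => // Q0; exfalso; apply: (Qmax I); last by right; split=> // f.
  by rewrite Q0; split=> [f []|/(_ 0 I0)].
have [Q0 QD QM] := idQ.
have Qm a : ~ Q a -> exists s h, S s /\ Q (s - a * h).
  move=> Qa; pose B := [set f | exists g h, Q g /\ f = g + a * h].
  apply: contrapT => noS; apply: (Qmax B).
    split=> [f Qf|BQ]; first by exists f, 0; rewrite mulr0 addr0.
    by apply: Qa; apply: BQ; exists 0, 1; rewrite mulr1 add0r.
  right; split=> [|f If|f [g [h [Qg fE]]] Sf].
  - split=> [|f f' [g [h [Qg ->]]] [g' [h' [Qg' ->]]]|b f [g [h [Qg ->]]]].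
    + by exists 0, 0; rewrite mulr0 addr0.
    + by exists (g + g'), (h + h'); split; [exact: QD | rewrite mulrDr addrACA].
    + by exists (b * g), (b * h); split; [exact: QM | rewrite mulrDr mulrCA].
  - by exists f, 0; rewrite mulr0 addr0; split=> //; exact: IQ.
  - by apply: noS; exists f, h; split=> //; rewrite fE addrK.
exists Q; split=> //; split=> [//|Q1|f g Qfg]; first exact: QS Q1 S1.
apply: contrapT => /not_orP[/Qm[s [h [Ss sh]]] /Qm[s' [h' [Ss' sh']]]].
apply: (QS (s * s')); last exact: SM.
have -> : s * s' = s' * (s - f * h) + (f * h) * (s' - g * h') + (h * h') * (f * g) by ring.
by apply: (QD); [apply: (QD); exact: QM | exact: QM].
Qed.

(** Polynomials of bounded degree form a finite-dimensional space, and the pigeonhole applied to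
    degree and exponent puts arbitrarily many of the [h x] into one such space. *)
Lemma uncountable_dependence d (h : F -> {mpoly F[d]}) (e : F -> nat) (bad : seq F) :
  exists e0 q (l c : 'I_q -> F), [/\ injective l, forall i, l i \notin bad /\ e (l i) = e0,
    exists i, c i != 0 & \sum_i (c i)%:MP * h (l i) = 0].
Proof.
have [n nP] := pigeonF (fun x => pickle (msize (h x), e x)).
have [s1 [_ ss1 s1P]] := nP 1%N; case: s1 ss1 s1P => // x0 s1 _ /(_ x0 (mem_head _ _)) x0P.
pose D := msize (h x0); pose T : finType := 'X_{1..d < D}.
have [s [us ss sb sP]] : exists s, [/\ uniq s, size s = #|T|.+1, forall x, x \in s -> x \notin bad
    & forall x, x \in s -> pickle (msize (h x), e x) = n].
  (* The surplus of [size bad] elements makes up for those discarded. *)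
  have [s [us ss sP]] := nP (#|T|.+1 + size bad)%N.
  pose r := [seq x <- s | x \notin bad].
  have rs : (#|T|.+1 <= size r)%N.
    rewrite -(leq_add2r (size bad)) -ss -(count_predC [pred x | x \notin bad] s) size_filter leq_add2l.
    rewrite -size_filter; apply: uniq_leq_size; first exact: filter_uniq.
    by move=> x; rewrite mem_filter /= negbK => /andP[].
  exists (take #|T|.+1 r); split; [exact/take_uniq/filter_uniq | exact: size_takel | |].
    by move=> x /mem_take; rewrite mem_filter => /andP[].
  by move=> x /mem_take; rewrite mem_filter => /andP[_ /sP].
have sP' x : x \in s -> msize (h x) = D /\ e x = e x0.
  by move/sP; rewrite -x0P => /(pcan_inj (@pickleK _))[-> ->].
pose l (i : 'I_#|T|.+1) := s`_i.
have ls i : l i \in s by rewrite mem_nth ?ss.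
pose M : 'M[F]_(#|T|.+1, #|T|) := \matrix_(i, j) (h (l i))@_(val (enum_val j)).
have /rowV0Pn[c /sub_kermxP cM c0] : kermx M != 0.
  by rewrite -mxrank_eq0 mxrank_ker subn_eq0 -ltnNge ltnS rank_leq_col.
exists (e x0), #|T|.+1, l, (c 0); split=> [i j /eqP|i||].
- by rewrite nth_uniq ?ss // => /eqP/val_inj.
- by split; [exact: sb | have [] := sP' _ (ls i)].
- by move/rV0Pn: c0.
- apply/mpolyP => m; rewrite mcoeff0 raddf_sum /=.
  have [mD|mD] := ltnP (mdeg m) D; last first.
    rewrite big1 // => i _; rewrite mcoeffCM (memN_msupp_eq0 (msize_mdeg_ge _)) ?mulr0 //.
    by have [-> _] := sP' _ (ls i).
  move/matrixP: cM => /(_ 0 (enum_rank (BMultinom mD))); rewrite !mxE => cm; apply: etrans cm.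
  by apply: eq_bigr => i _; rewrite mcoeffCM !mxE enum_rankK.
Qed.

Lemma prime_exp d (Q : set {mpoly F[d]}) f n : is_prime Q -> Q (f ^+ n) -> Q f.
Proof.
move=> [_ Q1 QM]; elim: n => [|n IHn]; first by rewrite expr0.
by rewrite exprS => /QM[].
Qed.

Lemma prime_root d (Q : set {mpoly F[d]}) (f : {mpoly F[d]}) (p : {poly F}) :
  is_prime Q -> p != 0 -> Q (map_poly (@mpolyC d F) p).[f] -> exists l, Q (f - l%:MP).
Proof.
move=> [[Q0 QD QM] Q1 Qpr] p0; have [r ->] := closed_field_poly_normal p.
rewrite linearZ /= hornerZ rmorph_prod horner_prod /=.
case/Qpr => [Qc|].
  case: Q1; have -> : 1 = (lead_coef p)^-1%:MP * (lead_coef p)%:MP_[d].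
    by rewrite -mpolyCM mulVf ?mpolyC1 ?lead_coef_eq0.
  exact: QM.
elim: r => [|z r IHr]; first by rewrite big_nil.
rewrite big_cons => /Qpr[|//]; rewrite rmorphB /= map_polyX map_polyC /= !hornerE.
by exists z.
Qed.

(** At [l i] every term except the one of index [i] vanishes. *)
Lemma lagrange_sum q (l c : 'I_q -> F) : injective l -> (exists i, c i != 0) ->
  \sum_i c i *: \prod_(k < q | k != i) ('X - (l k)%:P) != 0.
Proof.
move=> linj [i ci]; apply/eqP => /(congr1 (fun p => p.[l i])) /eqP.
rewrite horner0 horner_sum (bigD1 i) //= [X in _ + X]big1 => [|j ji]; last first.
  rewrite hornerZ horner_prod (bigD1 i) 1?eq_sym //= hornerD hornerX hornerN hornerC.
  by rewrite subrr mul0r mulr0.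
rewrite addr0 hornerZ horner_prod mulf_eq0 (negPf ci) orFb; apply/negP.
by apply/prodf_neq0 => k ki; rewrite hornerD hornerX hornerN hornerC subr_eq0 inj_eq // eq_sym.
Qed.

(** Let [Q] contain [I] and be maximal among ideals avoiding the powers of [g]. Each variable is
    constant modulo [Q]: otherwise every X_j - l divides a power of [g], and a linear dependence
    among the uncountably many cofactors puts p(X_j) g^e into [Q] for some nonzero p, which has a
    root. These constants are the coordinates of the zero. *)
Theorem nullstellensatz d (I : set {mpoly F[d]}) g : is_ideal I -> (forall n, ~ I (g ^+ n)) ->
  exists2 z : 'rV[F]_d, (forall f, I f -> f.@[z 0] = 0) & g.@[z 0] != 0.
Proof.
move=> idI Ig; pose S := [set f | exists n, f = g ^+ n].
have [||Q [prQ IQ QS Qm]] := @zorn_ideal d I S idI.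
- by split=> [|f f' [n ->] [n' ->]]; [exists 0%N | exists (n + n')%N; rewrite exprD].
- by move=> f If [n fE]; apply: (Ig n); rewrite -fE.
have [idQ Q1 Qpr] := prQ; have [Q0 QD QM] := idQ.
have Qg : ~ Q g by move/QS; apply; exists 1%N.
have /choice[z zP] (j : 'I_d) : exists l, Q ('X_j - l%:MP).
  apply: contrapT => /forallNP nol.
  have /choice[eh ehP] l : exists eh : nat * {mpoly F[d]}, Q (g ^+ eh.1 - ('X_j - l%:MP) * eh.2).
    by have [_ [h [[e ->] ?]]] := Qm _ (nol l); exists (e, h).
  have [e0 [q [l [c [linj le cn0 ch]]]]] :=
    uncountable_dependence (fun x => (eh x).2) (fun x => (eh x).1) [::].
  pose p := \sum_i c i *: \prod_(k < q | k != i) ('X - (l k)%:P).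
  have p0 : p != 0 by exact: lagrange_sum.
  suff [x] : exists x, Q ('X_j - x%:MP) by exact: nol.
  apply: (prime_root prQ p0).
  suff : Q ((map_poly (@mpolyC d F) p).['X_j] * g ^+ e0).
    by case/Qpr => // /(prime_exp prQ).
  pose P := \prod_k ('X_j - (l k)%:MP_[d]).
  have -> : (map_poly (@mpolyC d F) p).['X_j] * g ^+ e0 =
     \sum_i ((c i)%:MP * \prod_(k < q | k != i) ('X_j - (l k)%:MP)) * (g ^+ e0 - ('X_j - (l i)%:MP) * (eh (l i)).2).
    have <- : (map_poly (@mpolyC d F) p).['X_j] * g ^+ e0 - P * (\sum_i (c i)%:MP * (eh (l i)).2) =
       (map_poly (@mpolyC d F) p).['X_j] * g ^+ e0 by rewrite ch mulr0 subr0.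
    rewrite rmorph_sum horner_sum mulr_suml mulr_sumr -sumrB; apply: eq_bigr => i _.
    rewrite /= map_polyZ hornerZ rmorph_prod horner_prod.
    rewrite (eq_bigr (fun k => 'X_j - (l k)%:MP)) => [|k _]; last first.
      by rewrite rmorphB /= map_polyX map_polyC /= !hornerE.
    have -> : P = ('X_j - (l i)%:MP) * \prod_(k < q | k != i) ('X_j - (l k)%:MP).
      by rewrite /P (bigD1 i).
    rewrite /=; move: (\prod_(k < q | k != i) ('X_j - (l k)%:MP_[d])) => A.
    move: ('X_j - (l i)%:MP_[d]) ((c i)%:MP_[d]) (g ^+ e0) => B C G.
    by ring.
  by apply: ideal_sum => // i _; apply: QM; rewrite -(le i).2.
have Qz f : Q (f - f.@[(\row_j z j) 0]%:MP).
  elim/mpoly_ring_ind: f => [c|i|p q hp hq|p q hp hq].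
  - by rewrite mevalC subrr.
  - by rewrite mevalXU mxE.
  - by rewrite mevalD mpolyCD opprD addrACA; exact: QD.
  - rewrite mevalM mpolyCM; set a := p.@[_]%:MP in hp *; set b := q.@[_]%:MP in hq *.
    have -> : p * q - a * b = q * (p - a) + a * (q - b) by ring.
    by apply: QD; exact: QM.
exists (\row_j z j) => [f /IQ Qf|]; last first.
  by apply/eqP => gz; apply: Qg; have := Qz g; rewrite gz mpolyC0 subr0.
apply/eqP/negPn/negP => fz; apply: Q1.
have -> : 1 = (f.@[(\row_j z j) 0])^-1%:MP * (f - (f - f.@[(\row_j z j) 0]%:MP)).
  by rewrite subKr -mpolyCM mulVf ?mpolyC1.
by apply: QM; apply: ideal_sub.
Qed.

End Ideals.

(** * Finiteness of the values of a regular function *)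

Section FiniteValues.
Variable F : closedFieldType.
Hypothesis pigeonF : has_large_fibres F.

(* Multiplication by [g] stabilises the forms of some large degree on the cone, so the values of *)
(* [g] are eigenvalues of one matrix.                                                            *)
Lemma regular_finite_values d (C : set 'rV[F]_d) (g : 'rV[F]_d -> F) :
  (forall v : 'rV[F]_d, v != 0 -> (forall f : {mpoly F[d]}, (forall w, C w -> f.@[w 0] = 0) -> f.@[v 0] = 0) -> C v) ->
  (forall v, C v -> v != 0) ->
  (forall v (s : F), C v -> s != 0 -> C (s *: v) /\ g (s *: v) = g v) ->
  (forall v, C v -> exists a b : {mpoly F[d]}, b.@[v 0] != 0 /\ forall w, C w -> a.@[w 0] = g w * b.@[w 0]) ->
  exists s : seq F, forall v, C v -> g v \in s.
Proof.
move=> Ccl C0 Cs greg.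
(* The ideal of denominators of [g] has no zero outside the origin, hence contains a power of every
   variable. *)
pose J := [set b : {mpoly F[d]} | exists a : {mpoly F[d]}, forall w, C w -> a.@[w 0] = g w * b.@[w 0]].
have idJ : is_ideal J.
  split=> [|f f' [a ha] [a' ha']|f f' [a ha]].
  - by exists 0 => w _; rewrite !meval0 mulr0.
  - by exists (a + a') => w Cw; rewrite !mevalD mulrDr ha ?ha'.
  - by exists (f * a) => w Cw; rewrite !mevalM ha // mulrCA.
have /choice[e eP] (j : 'I_d) : exists e, J ('X_j ^+ e).
  apply: contrapT => /forallNP /(nullstellensatz pigeonF idJ)[z zJ]; rewrite mevalXU => zj.
  have z0 : z != 0 by apply: contra zj => /eqP->; rewrite mxE.
  have [|a [b [bz ab]]] := greg z.
    by apply: Ccl => // f fC; apply: zJ; exists 0 => w Cw; rewrite meval0 fC ?mulr0.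
  by case/eqP: bz; apply: zJ; exists a.
pose E := \max_j e j.
have /choice[a aP] (j : 'I_d) : exists a : {mpoly F[d]}, a \is E.-homog /\
    forall w, C w -> a.@[w 0] = g w * w 0 j ^+ E.
  have [_ _ JM] := idJ.
  have [a aP] : J ('X_j ^+ E) by rewrite -(subnK (leq_bigmax j : (e j <= E)%N)) exprD; exact: JM.
  exists (hc E a); split=> [|w Cw]; first exact: hc_homog.
  (* Comparing coefficients along the line of [w] shows that the component of degree [E] is again a
     numerator. *)
  pose q := \poly_(k < msize a) (hc k a).@[w 0] - (g w * w 0 j ^+ E) *: 'X^E.
  have /polyP/(_ E) : q = 0.
    apply: (@poly_eq0_cofinite _ q [:: 0]) => x; rewrite inE => x0.
    have [Cx gx] := Cs w x Cw x0.
    rewrite hornerD hornerN hornerZ hornerXn -scale_poly aP // gx rmorphXn /= mevalXU mxE.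
    by rewrite exprMn; ring.
  rewrite coefB coefZ coefXn eqxx mulr1 coef0 coef_poly.
  have [_ /eqP|/hc_msize-> ] := ltnP E (msize a); first by rewrite subr_eq0 => /eqP.
  by rewrite meval0 sub0r => /eqP; rewrite oppr_eq0 => /eqP ->.
(* A monomial of degree above [d * E] is divisible by the [E]-th power of some variable, so [g]
   times it agrees on [C] with a form of degree [D]. *)
pose D := (d * E).+1; pose T : finType := {m : 'X_{1..d < D.+1} | mdeg m == D}.
pose mon (t : T) : 'X_{1..d} := val (val t).
have monD t : mdeg (mon t) = D by exact/eqP/(valP t).
have /choice[j jP] (t : T) : exists j, (E <= mon t j)%N.
  apply: contrapT => /forallNP nj; have := monD t; rewrite mdegE => /eqP; rewrite eqn_leq => /andP[_].
  apply/negP; rewrite -ltnNge /D ltnS -[d in (d * E)%N](card_ord d) -sum_nat_const.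
  by apply: leq_sum => k _; rewrite leqNgt; apply/negP => /ltnW/nj.
pose P (t : T) : {mpoly F[d]} := a (j t) * 'X_[mon t - U_(j t) *+ E].
have sK t : ((mon t - U_(j t) *+ E) + U_(j t) *+ E)%MM = mon t.
  apply: submK; apply/mnm_lepP => k; rewrite mulmnE mnm1E.
  by case: eqVneq => [<-|_]; rewrite ?mul1n ?mul0n.
have PD t : P t \is D.-homog.
  have DE : D = (E + mdeg (mon t - U_(j t) *+ E)%MM)%N.
    by have := congr1 mdeg (sK t); rewrite mdegD mdegMn mdeg1 mul1n monD addnC => ->.
  by rewrite DE; apply: dhomogM; [case: (aP (j t)) | rewrite dhomogX].
have PE t w : C w -> (P t).@[w 0] = g w * ('X_[mon t] : {mpoly F[d]}).@[w 0].
  move=> Cw; rewrite mevalM (aP _).2 // -mulrA; congr (_ * _).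
  rewrite -[in RHS]sK mpolyXD mevalM mulrC -mpolyXn; congr (_ * _).
  by rewrite rmorphXn /= mevalXU.
pose A : 'M[F]_#|T| := \matrix_(i, k) (P (enum_val k))@_(mon (enum_val i)).
pose nu (w : 'rV[F]_d) : 'rV[F]_#|T| := \row_i ('X_[mon (enum_val i)] : {mpoly F[d]}).@[w 0].
have [r rE] := closed_field_poly_normal (char_poly A).
exists r => w Cw.
have : eigenvalue A (g w).
  apply/eigenvalueP; exists (nu w).
    apply/rowP => k; rewrite !mxE -PE //.
    have -> : P (enum_val k) = \sum_(t : T) (P (enum_val k))@_(mon t) *: 'X_[mon t].
      apply/mpolyP => m; rewrite raddf_sum /=.
      have [mD|mD] := eqVneq (mdeg m) D; last first.
        rewrite (dhomog_nemf_coeff (PD _) mD) big1 // => t _.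
        rewrite mcoeffZ mcoeffX; case: eqVneq => [tm|]; last by rewrite mulr0.
        by case/eqP: mD; rewrite -tm.
      have mD' : (mdeg m < D.+1)%N by rewrite mD.
      have mD2 : mdeg (BMultinom mD') == D by rewrite /= mD.
      rewrite (bigD1 (exist _ (BMultinom mD') mD2)) //= mcoeffZ mcoeffX eqxx mulr1.
      rewrite big1 ?addr0 // => t /negP tm; rewrite mcoeffZ mcoeffX.
      by case: eqVneq => [tm'|]; [case: tm; apply/eqP; do 2 apply: val_inj | rewrite mulr0].
    rewrite raddf_sum (reindex_onto (@enum_val T predT) enum_rank) /=; last by move=> ? _; rewrite enum_rankK.
    apply: eq_big => [i|i _]; first by rewrite enum_valK eqxx.
    by rewrite mevalZ !mxE mulrC.
  have /rV0Pn[i wi] := C0 w Cw.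
  have tD : mdeg (U_(i) *+ D)%MM == D by rewrite mdegMn mdeg1 mul1n.
  have tD' : (mdeg (U_(i) *+ D)%MM < D.+1)%N by rewrite (eqP tD).
  apply/rV0Pn; exists (enum_rank (exist _ (BMultinom tD') tD : T)).
  by rewrite mxE enum_rankK /= -mpolyXn rmorphXn /= mevalXU expf_neq0.
rewrite eigenvalue_root_char rE (monicP (char_poly_monic A)) scale1r.
by rewrite root_prod_XsubC.
Qed.

End FiniteValues.

(** * Irreducible sets and algebraically independent linear forms *)

Section IrreducibleSets.
Variable F : closedFieldType.
Hypothesis pigeonF : has_large_fibres F.

Definition vanish d (C : set 'rV[F]_d) : set {mpoly F[d]} :=
  [set f | forall v, C v -> f.@[v 0] = 0].

Definition irr d (C : set 'rV[F]_d) := is_prime (vanish C).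

Lemma not_vanishP d (C : set 'rV[F]_d) (f : {mpoly F[d]}) :
  ~ vanish C f <-> exists2 v, C v & f.@[v 0] != 0.
Proof.
split=> [/existsNP[v /not_implyP[Cv fv]]|[v Cv fv] /(_ v Cv) f0]; last by rewrite f0 eqxx in fv.
by exists v => //; exact/eqP.
Qed.

Lemma irr_nonvanish d (C : set 'rV[F]_d) (f g : {mpoly F[d]}) : irr C -> ~ vanish C f -> ~ vanish C g ->
  exists2 v, C v & f.@[v 0] != 0 /\ g.@[v 0] != 0.
Proof.
move=> [_ _ Cpr] fC gC; have /not_vanishP[v Cv] : ~ vanish C (f * g) by case/Cpr.
by rewrite mevalM mulf_eq0 negb_or => /andP[? ?]; exists v.
Qed.

Lemma prime_prod d (Q : set {mpoly F[d]}) I (r : seq I) (f : I -> {mpoly F[d]}) (P : pred I) :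
  is_prime Q -> (forall i, P i -> ~ Q (f i)) -> ~ Q (\prod_(i <- r | P i) f i).
Proof.
move=> [_ Q1 Qpr] h; elim/big_ind: _ => // x y hx hy /Qpr[]; [exact: hx | exact: hy].
Qed.

Definition linmap d t (Y : 'M[F]_(d, t)) : 'rV[{mpoly F[d]}]_t :=
  varmx F d *m map_mx (@mpolyC d F) Y.

Lemma ev_linmap d t (Y : 'M[F]_(d, t)) v : ev v (linmap Y) = v *m Y.
Proof. by rewrite evM ev_varmx ev_const. Qed.

Lemma dmx_linmap d t (Y : 'M[F]_(d, t)) v u : dmx v u (linmap Y) = u *m Y.
Proof. by rewrite dmxM dmx_varmx ev_const dmx_const mulmx0 addr0. Qed.

(** The columns of [Y] are linear forms, algebraically independent as functions on [C]; their number
    measures the dimension of the closure of [C]. *)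
Definition algind d t (C : set 'rV[F]_d) (Y : 'M[F]_(d, t)) :=
  forall G : {mpoly F[t]}, (forall v, C v -> G.@[(v *m Y) 0] = 0) -> G = 0.

Lemma zero_locus_prime d (Q : set {mpoly F[d]}) : is_prime Q ->
  exists C, irr C /\ vanish C = Q.
Proof.
move=> prQ; have [idQ Q1 _] := prQ.
pose C := [set v : 'rV[F]_d | forall f, Q f -> f.@[v 0] = 0].
suff CQ : vanish C = Q by exists C; split=> //; rewrite /irr CQ.
apply/seteqP; split=> [f fC|f Qf v]; last exact.
apply: contrapT => Qf; have [n Qn|z zQ] := nullstellensatz pigeonF idQ (g := f).
  by apply: Qf; exact: prime_exp Qn.
by rewrite fC ?eqxx.
Qed.

(* The set [C'] is a piece of the fibre of [p / q] over [lam]. *)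
Lemma irr_cut d t (C : set 'rV[F]_d) (p q f : {mpoly F[d]}) (Y : 'M[F]_(d, t)) (bad : seq F) :
  irr C -> ~ vanish C f ->
  (forall n (l : 'I_n -> F) (G : 'I_n -> {mpoly F[t]}), injective l ->
     (forall v, C v -> \sum_i (G i).@[(v *m Y) 0] * \prod_(k < n | k != i) (p.@[v 0] - l k * q.@[v 0]) = 0) ->
     forall i, G i = 0) ->
  exists lam C', [/\ lam \notin bad, irr C', vanish C `<=` vanish C',
    forall v, C' v -> p.@[v 0] = lam * q.@[v 0] & ~ vanish C' f /\ algind C' Y].
Proof.
move=> irC fC indep; have [[I0 ID IM] I1 Ipr] := irC.
(* On the zeros of a prime that avoids these products, [f] is not identically zero and the forms [Y]
   stay independent. *)
pose S := [set g | exists (G : {mpoly F[t]}) e, G != 0 /\ g = cmp (linmap Y) G * f ^+ e].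
have mS : mulset S.
  split=> [|_ _ [G [e [G0 ->]]] [G' [e' [G0' ->]]]].
    by exists 1, 0%N; rewrite oner_neq0 /cmp rmorph1 mulr1.
  exists (G * G'), (e + e')%N; rewrite mulf_neq0 //; split=> //.
  by rewrite /cmp rmorphM exprD /=; ring.
pose J l := [set g | exists h, vanish C (g - (p - l%:MP * q) * h)].
have idJ l : is_ideal (J l).
  split=> [|g g' [h hC] [h' hC']|a g [h hC]].
  - by exists 0; rewrite mulr0 subr0.
  - exists (h + h'); have -> : g + g' - (p - l%:MP * q) * (h + h') =
      (g - (p - l%:MP * q) * h) + (g' - (p - l%:MP * q) * h') by ring.
    exact: ID.
  - exists (a * h); have -> : a * g - (p - l%:MP * q) * (a * h) = a * (g - (p - l%:MP * q) * h) by ring.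
    exact: IM.
have [[lam [lbad lamJ]]|noJ] := pselect (exists l, l \notin bad /\ forall g, J l g -> ~ S g).
  have [Q [prQ JQ QS _]] := zorn_ideal (idJ lam) mS lamJ.
  have [C' [irC' CQ]] := zero_locus_prime prQ.
  exists lam, C'; split=> //.
  - by move=> g gC; rewrite CQ; apply: JQ; exists 0; rewrite mulr0 subr0.
  - move=> v C'v; have : vanish C' (p - lam%:MP * q).
      by rewrite CQ; apply: JQ; exists 1; rewrite mulr1 subrr.
    by move/(_ v C'v); rewrite mevalB mevalM mevalC => /eqP; rewrite subr_eq0 => /eqP.
  - split; rewrite ?CQ.
      by move=> /QS; apply; exists 1, 1%N; rewrite oner_neq0 /cmp rmorph1 mul1r expr1.
    move=> G GC; apply/eqP/negPn/negP => G0.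
    have : Q (cmp (linmap Y) G) by rewrite -CQ => v /GC; rewrite ev_cmp ev_linmap.
    by move/QS; apply; exists G, 0%N; rewrite expr0 mulr1.
(* Otherwise p - l q divides such a product for each admissible [l], modulo the ideal of [C]. A
   linear dependence among the cofactors becomes a relation excluded by [indep]. *)
have /choice[w wP] l : exists w : {mpoly F[t]} * nat * {mpoly F[d]}, l \notin bad -> w.1.1 != 0 /\
    vanish C (cmp (linmap Y) w.1.1 * f ^+ w.1.2 - (p - l%:MP * q) * w.2).
  have [lb|lb] := boolP (l \in bad); first by exists (0, 0%N, 0).
  apply: contrapT => now; apply: noJ; exists l; split=> // g [h hC] [G [e [G0 gE]]].
  by apply: now; exists (G, e, h) => _; split=> //; rewrite -gE.
have [e0 [n [l [c [linj lP [i ci] ch]]]]] :=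
  uncountable_dependence pigeonF (fun x => (w x).2) (fun x => (w x).1.2) bad.
have := indep n l (fun i => c i *: (w (l i)).1.1) linj.
suff h : forall v, C v -> \sum_i (c i *: (w (l i)).1.1).@[(v *m Y) 0] *
      \prod_(k < n | k != i) (p.@[v 0] - l k * q.@[v 0]) = 0.
  move=> /(_ h i) /eqP; rewrite -mul_mpolyC mulf_eq0 mpolyC_eq0 (negPf ci) /= => /eqP w0.
  by have [/eqP] := wP (l i) (lP i).1.
pose g := \sum_i ((c i)%:MP * cmp (linmap Y) (w (l i)).1.1 * \prod_(k < n | k != i) (p - (l k)%:MP * q)).
have gE (v : 'rV[F]_d) : g.@[v 0] = \sum_i (c i *: (w (l i)).1.1).@[(v *m Y) 0] *
      \prod_(k < n | k != i) (p.@[v 0] - l k * q.@[v 0]).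
  rewrite raddf_sum; apply: eq_bigr => j _ /=; rewrite !mevalM mevalC ev_cmp ev_linmap mevalZ rmorph_prod.
  by congr (_ * _); apply: eq_bigr => k _; rewrite /= mevalB mevalM mevalC.
suff gC : vanish C g by move=> v Cv; rewrite -gE gC.
have [//|/(prime_exp irC)//] : vanish C g \/ vanish C (f ^+ e0).
apply: Ipr.
have -> : g * f ^+ e0 = \sum_i ((c i)%:MP * \prod_(k < n | k != i) (p - (l k)%:MP * q)) *
    (cmp (linmap Y) (w (l i)).1.1 * f ^+ (w (l i)).1.2 - (p - (l i)%:MP * q) * (w (l i)).2).
  have {1}-> : g = g - 0 by rewrite subr0.
  rewrite mulrBl; have -> : 0 * f ^+ e0 = (\prod_k (p - (l k)%:MP * q)) * (\sum_i (c i)%:MP * (w (l i)).2).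
    by rewrite ch mulr0 mul0r.
  rewrite mulr_suml mulr_sumr -sumrB; apply: eq_bigr => j _; rewrite (lP j).2.
  have -> : \prod_k (p - (l k)%:MP * q) = (p - (l j)%:MP * q) * \prod_(k < n | k != j) (p - (l k)%:MP * q).
    by rewrite (bigD1 j).
  move: (\prod_(k < n | k != j) _) (p - (l j)%:MP * q) (cmp _ _) (f ^+ e0) => A B D E.
  by ring.
apply: ideal_sum => // j _; apply: (IM); exact: (wP (l j) (lP j).1).2.
Qed.

End IrreducibleSets.

(** * Closed sets and chains *)

Section ClosedSets.
Variable F : closedFieldType.
Hypothesis charF : [pchar F] =i pred0.
Hypothesis pigeonF : has_large_fibres F.

Definition cone d (A : set (Proj F d)) : set 'rV[F]_d :=
  [set v | exists2 p, A p & coords v p].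

Lemma coords_ex d (v : 'rV[F]_d) : v != 0 -> exists p : Proj F d, coords v p.
Proof.
move=> v0; have h : \dim <[v]>%VS == 1%N by rewrite dim_vline v0.
by exists (exist (fun L : {vspace 'rV[F]_d} => \dim L == 1%N) _ h).
Qed.

Lemma coords_inj d (v : 'rV[F]_d) p q : coords v p -> coords v q -> p = q.
Proof. by move=> pv qv; apply: val_inj; rewrite /coords in pv qv; rewrite pv qv. Qed.

Lemma coords_scale d (v : 'rV[F]_d) p s : coords v p -> s != 0 -> coords (s *: v) p.
Proof.
rewrite /coords => -> s0; apply/eqP; rewrite eqEdim !dim_vline scaler_eq0 (negPf s0) leqnn andbT.
by apply/vlineP; exists s^-1; rewrite scalerA mulVf ?scale1r.
Qed.

Lemma coords_prop d (v w : 'rV[F]_d) p : coords v p -> coords w p -> exists2 s, s != 0 & w = s *: v.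
Proof.
move=> pv pw; have w0 := coords_neq0 pw.
have /vlineP[s ws] : w \in <[v]>%VS by rewrite -pv pw memv_line.
by exists s => //; apply: contra w0 => /eqP s0; rewrite ws s0 scale0r.
Qed.

Lemma cone_coords d (A : set (Proj F d)) v p : coords v p -> cone A v <-> A p.
Proof. by move=> vp; split=> [[q Aq /(coords_inj vp)->]|Ap]; [|exists p]. Qed.

Lemma cone_neq0 d (A : set (Proj F d)) v : cone A v -> v != 0.
Proof. by case=> p _; exact: coords_neq0. Qed.

Lemma cone_scale d (A : set (Proj F d)) v s : cone A v -> s != 0 -> cone A (s *: v).
Proof. by case=> p Ap vp s0; exists p => //; exact: coords_scale. Qed.

Lemma homog_coords d k (f : {mpoly F[d]}) (v w : 'rV[F]_d) p : f \is k.-homog ->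
  coords v p -> coords w p -> f.@[v 0] = 0 -> f.@[w 0] = 0.
Proof. by move=> fk pv /(coords_prop pv)[s s0 ->] fv; rewrite (homog_scale _ _ fk) fv mulr0. Qed.

Lemma vanish_hc d (A : set (Proj F d)) (f : {mpoly F[d]}) k :
  vanish (cone A) f -> vanish (cone A) (hc k f).
Proof.
move=> fA v Av; apply: (@hc_vanish _ _ f v [:: 0]) => x; rewrite inE => x0.
by apply: fA; exact: cone_scale.
Qed.

(** Homogeneous components of a polynomial vanishing on a cone vanish there too, so arbitrary
    polynomials may be used to separate points from a closed set. *)
Lemma zclosedP d (A : set (Proj F d)) : zclosed A <->
  forall p v, ~ A p -> coords v p -> exists2 h : {mpoly F[d]}, vanish (cone A) h & h.@[v 0] != 0.
Proof.
split=> [[S [Sh ->]] p v /existsNP[f /existsNP[w /not_implyP[Sf /not_implyP[pw fw]]]] pv|h].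
  exists f => [u [q qS qu]|]; first exact: qS.
  by apply/eqP => fv; apply: fw; have [k fk] := Sh _ Sf; exact: homog_coords fk pv pw fv.
exists [set f | (exists k, f \is k.-homog) /\ vanish (cone A) f]; split; first by move=> f [].
apply/seteqP; split=> [p Ap f v [_ fA] pv|p Ap]; first by apply: fA; exists p.
apply: contrapT => nAp; have [f fA fv] := h p _ nAp (vpick_coords p).
have [k fk] := hc_nonvanish fv; case/eqP: fk; apply: Ap (vpick_coords p).
by split; [exists k; exact: hc_homog | exact: vanish_hc].
Qed.

Lemma cone_closed d (A : set (Proj F d)) (v : 'rV[F]_d) : zclosed A -> v != 0 ->
  (forall f : {mpoly F[d]}, vanish (cone A) f -> f.@[v 0] = 0) -> cone A v.
Proof.
move=> /zclosedP Acl /coords_ex[p vp] h; exists p => //.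
by apply: contrapT => nAp; have [f /h->] := Acl p v nAp vp; rewrite eqxx.
Qed.

Lemma zclosedI d (A B : set (Proj F d)) : zclosed A -> zclosed B -> zclosed (A `&` B).
Proof.
move=> /zclosedP hA /zclosedP hB; apply/zclosedP => p v /not_andP[Ap|Bp] pv.
  by have [h hv h0] := hA p v Ap pv; exists h => // w [q [Aq _] qw]; apply: hv; exists q.
by have [h hv h0] := hB p v Bp pv; exists h => // w [q [_ Bq] qw]; apply: hv; exists q.
Qed.

Lemma zclosed_zeros d (C : set 'rV[F]_d) : zclosed [set p | forall f k (v : 'rV[F]_d),
  f \is k.-homog -> vanish C f -> coords v p -> f.@[v 0] = 0].
Proof.
exists [set f | (exists k, f \is k.-homog) /\ vanish C f]; split; first by move=> f [].
apply/seteqP; split=> [p h f v [[k fk] fC]|p h f k v fk fC]; first exact: h fk fC.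
by apply: h; split=> //; exists k.
Qed.

Lemma zclosed_homog d k (f : {mpoly F[d]}) : f \is k.-homog ->
  zclosed [set p | forall v : 'rV[F]_d, coords v p -> f.@[v 0] = 0].
Proof.
move=> fk; exists [set f]; split=> [_ ->|]; first by exists k.
by apply/seteqP; split=> [p h _ v -> //|p h v]; [exact: h | exact: (h f)].
Qed.

(** If [f] and [g] do not vanish on the cone, the zero sets of suitable homogeneous components do
    not cover [A]. On the line over a point outside both, f g restricts to a nonzero polynomial. *)
Lemma irr_cone d (A : set (Proj F d)) : zclosed A -> irreducible A -> irr (cone A).
Proof.
move=> Acl [[p0 Ap0] Airr]; split=> [|/(_ _ (ex_intro2 _ _ p0 Ap0 (vpick_coords p0)))|f g fgA].
- split=> [v _|f g fA gA v Av|a f fA v Av]; rewrite ?meval0 ?mevalD ?mevalM ?fA ?gA ?addr0 ?mulr0 //.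
- by rewrite meval1 => /eqP; rewrite oner_eq0.
apply: contrapT => /not_orP[/not_vanishP[v [p Ap pv] fv] /not_vanishP[w [q Aq qw] gw]].
have [k fk] := hc_nonvanish fv; have [l gl] := hc_nonvanish gw.
pose Z (h : {mpoly F[d]}) := A `&` [set p | forall v : 'rV[F]_d, coords v p -> h.@[v 0] = 0].
have Zcl h e : h \is e.-homog -> zclosed (Z h) by move=> /zclosed_homog; exact: zclosedI.
have AZ h e p' (u : 'rV[F]_d) : A p' -> coords u p' -> h.@[u 0] != 0 -> h \is e.-homog -> A <> Z h.
  by move=> Ap' pu hu he AZ; move: Ap'; rewrite AZ => -[_ /(_ u pu)/eqP]; rewrite (negPf hu).
have [r [Ar nr]] : exists r, A r /\ ~ (Z (hc k f) `|` Z (hc l g)) r.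
  apply: contrapT => /forallNP h.
  have AE : A = Z (hc k f) `|` Z (hc l g).
    apply/seteqP; split=> [r Ar|r [[]|[]] //]; apply: contrapT => nr; exact: (h r).
  case: (Airr _ _ (Zcl _ _ (hc_homog k f)) (Zcl _ _ (hc_homog l g)) AE).
    exact: AZ Ap pv fk (hc_homog k f).
  exact: AZ Aq qw gl (hc_homog l g).
have [u ru] : exists u : 'rV[F]_d, coords u r by exists (vpick (val r)); exact: vpick_coords.
have nz h e : h \is e.-homog -> ~ Z h r -> h.@[u 0] != 0.
  move=> he nZ; apply/eqP => hu; apply: nZ; split=> // u' ru'; exact: homog_coords he ru ru' hu.
have [fu gu] : (hc k f).@[u 0] != 0 /\ (hc l g).@[u 0] != 0.
  by split; apply: nz (hc_homog _ _) _ => Zr; apply: nr; [left|right].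
pose pf h := \poly_(e < msize h) (hc e h).@[u 0].
have pf0 (h : {mpoly F[d]}) e : (hc e h).@[u 0] != 0 -> pf h != 0.
  move=> he; have eh : (e < msize h)%N by rewrite ltnNge; apply: contra he => /hc_msize->; rewrite meval0.
  by apply: contra he => /eqP/polyP/(_ e); rewrite coef_poly eh coef0 => ->.
have [s] := poly_neq0_cofinite [:: 0] (mulf_neq0 (pf0 _ _ fu) (pf0 _ _ gu)).
rewrite inE hornerM -!scale_poly -mevalM => s0 /eqP; apply.
by apply: fgA; apply: cone_scale => //; exists r.
Qed.

(** The projective closure of [C], which need not be a cone. *)
Definition zero_set d (C : set 'rV[F]_d) : set (Proj F d) :=
  [set p | forall f k (v : 'rV[F]_d), f \is k.-homog -> vanish C f -> coords v p -> f.@[v 0] = 0].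

Lemma zero_set_cone d (C : set 'rV[F]_d) v p : C v -> coords v p -> zero_set C p.
Proof. by move=> Cv vp f k w fk fC wp; apply: homog_coords fk vp wp (fC v Cv). Qed.

Lemma algind_nonvanish d t (C : set 'rV[F]_d) (Y : 'M[F]_(d, t)) i :
  algind C Y -> ~ vanish C (linmap Y 0 i).
Proof.
move=> ind h; have : ('X_i : {mpoly F[t]}) = 0.
  by apply: ind => v Cv; rewrite mevalXU -ev_linmap evE h.
by move/eqP; rewrite -msize_poly_eq0 msizeX.
Qed.

(** The first form of [Y] does not vanish identically on [C]; multiplying by it discards the origin,
    which has no image in projective space. *)
Lemma zero_set_irreducible d t (C : set 'rV[F]_d) (Y : 'M[F]_(d, t.+1)) :
  irr C -> algind C Y -> irreducible (zero_set C).
Proof.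
move=> irC indY; have Y0 := algind_nonvanish (i := ord0) indY.
have Yv (v : 'rV[F]_d) : (linmap Y 0 0).@[v 0] != 0 -> v != 0.
  by apply: contra => /eqP->; rewrite -evE ev_linmap mul0mx mxE.
have [_ _ Cpr] := irC; split.
  have [v Cv /Yv/coords_ex[p vp]] := (not_vanishP _ _).1 Y0.
  by exists p; exact: zero_set_cone vp.
move=> Z1 Z2 [S1 [S1h ->]] [S2 [S2h ->]] ZE; apply: contrapT => /not_orP[n1 n2].
have bad (S : set {mpoly F[d]}) : (forall f, S f -> exists k, f \is k.-homog) ->
    [set p | forall f (v : 'rV[F]_d), S f -> coords v p -> f.@[v 0] = 0] `<=` zero_set C ->
    zero_set C <> [set p | forall f (v : 'rV[F]_d), S f -> coords v p -> f.@[v 0] = 0] ->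
    exists2 f, S f & ~ vanish C f.
  move=> Sh sub neq; apply: contrapT => h; apply: neq; apply/seteqP; split=> // p pC f v Sf vp.
  have [k fk] := Sh f Sf; apply: pC fk _ vp; apply: contrapT => fC; apply: h.
  by exists f.
have [f1 S1f f1C] := bad S1 S1h ltac:(by rewrite ZE; left) n1.
have [f2 S2f f2C] := bad S2 S2h ltac:(by rewrite ZE; right) n2.
have : vanish C (f1 * f2 * linmap Y 0 0).
  move=> v Cv; rewrite !mevalM; have [->|/Yv v0] := eqVneq (linmap Y 0 0).@[v 0] 0; first by rewrite mulr0.
  have [p vp] := coords_ex v0; have := zero_set_cone Cv vp; rewrite ZE.
  by case=> h; [rewrite (h f1 v) ?mul0r | rewrite (h f2 v) ?mulr0 ?mul0r].
by case/Cpr => [/Cpr[]|].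
Qed.

Lemma has_chain_extend d (A B : set (Proj F d)) k :
  has_chain B k -> B `<` A -> zclosed A -> irreducible A -> has_chain A k.+1.
Proof.
move=> [Z [Z1 Z2]] BA Acl Airr; exists (fun i => if (i <= k)%N then Z i else A); split=> i ik.
  have [ik'|ik'] := leqP i k; last by split.
  have [? ? ZB] := Z1 i ik'; split=> //; exact: subset_trans ZB (properW BA).
rewrite (ik : (i <= k)%N); have [ik'|ki] := ltnP i k; first exact: Z2.
have -> : i = k by apply/eqP; rewrite eqn_leq ki andbT.
have [_ _ ZB] := Z1 k (leqnn k).
have [BA1 BA2] := BA; split; first exact: subset_trans ZB BA1.
by move=> AZ; apply: BA2; exact: subset_trans AZ ZB.
Qed.

(** Induction on the number of forms: [irr_cut] along y_1 = lam y_2 keeps all forms but the first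
    independent, and the closure shrinks strictly because y_1 - lam y_2 does not vanish on [C]. *)
Lemma chain_of_algind t d (C : set 'rV[F]_d) (Y : 'M[F]_(d, t.+1)) :
  irr C -> algind C Y -> has_chain (zero_set C) t.
Proof.
elim: t C Y => [|t IHt] C Y irC indY.
  exists (fun=> zero_set C); split=> // i _; split=> //; first exact: zclosed_zeros.
  exact: zero_set_irreducible indY.
pose y1 : 'cV[F]_d := lsubmx (Y : 'M_(d, 1 + t.+1)).
pose Y' : 'M[F]_(d, t.+1) := rsubmx (Y : 'M_(d, 1 + t.+1)).
have YE (v : 'rV[F]_d) : v *m Y = row_mx (v *m y1) (v *m Y') by rewrite -mul_mx_row hsubmxK.
have row0 (z1 : 'rV[F]_1) (z2 : 'rV[F]_t.+1) : (row_mx z1 z2 : 'rV_(t.+2)) 0 ord0 = z1 0 0.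
  by rewrite mxE; case: splitP => [j _|j //]; rewrite ord1.
have indY' : algind C Y'.
  move=> G GC; pose sub : 'rV[{mpoly F[t.+2]}]_t.+1 := \row_j 'X_(rshift 1 j).
  have subE (z1 : 'rV[F]_1) (z2 : 'rV[F]_t.+1) : ev (row_mx z1 z2) sub = z2.
    by apply/rowP => j; rewrite !mxE mevalXU row_mxEr.
  have sub0 : cmp sub G = 0.
    by apply: indY => v Cv; rewrite ev_cmp YE subE GC.
  by apply: (mpoly_fun_eq0 charF) => z; rewrite -(subE 0 z) -ev_cmp sub0 meval0.
pose p := linmap y1 0 0; pose q := linmap Y' 0 0.
have pE (v : 'rV[F]_d) : p.@[v 0] = (v *m Y) 0 ord0.
  by rewrite /p -evE ev_linmap YE row0.
have [lam [C' [_ irC' CC' pq [_ indC']]]] : exists lam C', [/\ lam \notin [::], irr C', vanish C `<=` vanish C',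
    forall v, C' v -> p.@[v 0] = lam * q.@[v 0] & ~ vanish C' 1 /\ algind C' Y'].
  have C1 : ~ vanish C 1 by case: irC.
  apply: irr_cut => // n l G linj rel.
  pose sub : 'rV[{mpoly F[t.+2]}]_t.+1 := \row_j 'X_(rshift 1 j).
  have subE (z1 : 'rV[F]_1) (z2 : 'rV[F]_t.+1) : ev (row_mx z1 z2) sub = z2.
    by apply/rowP => j; rewrite !mxE mevalXU row_mxEr.
  pose H := \sum_i cmp sub (G i) * \prod_(k < n | k != i) ('X_ord0 - (l k)%:MP * sub 0 0).
  have HE (z1 : 'rV[F]_1) (z2 : 'rV[F]_t.+1) : H.@[(row_mx z1 z2) 0] =
      \sum_i (G i).@[z2 0] * \prod_(k < n | k != i) (z1 0 0 - l k * z2 0 0).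
    rewrite raddf_sum; apply: eq_bigr => i _ /=; rewrite mevalM ev_cmp subE rmorph_prod.
    congr (_ * _); apply: eq_bigr => k _; rewrite /= mevalB mevalM mevalC -evE subE.
    by rewrite mevalXU row0.
  have H0 : H = 0.
    apply: indY => v Cv; rewrite YE HE -[RHS](rel v Cv); apply: eq_bigr => i _.
    by congr (_ * _); apply: eq_bigr => k _; rewrite /p /q -!evE !ev_linmap.
  move=> i; have : G i * \prod_(k < n | k != i) ((l i - l k)%:MP * 'X_ord0) = 0.
    (* Where y_1 = l_i y_2 only the term of index [i] survives. *)
    apply: (mpoly_fun_eq0 charF) => z; have := HE (l i * z 0 ord0)%:M z; rewrite H0 meval0.
    rewrite (bigD1 i) //= [X in _ + X]big1 => [|j ji]; last first.
      by rewrite (bigD1 i) 1?eq_sym //= mxE eqxx mulr1n subrr mul0r mulr0.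
    rewrite addr0 => ->; rewrite mevalM rmorph_prod; congr (_ * _); apply: eq_bigr => k _.
    by rewrite /= mevalM mevalC mevalXU mxE eqxx mulr1n mulrBl.
  move/eqP; rewrite mulf_eq0 => /orP[/eqP//|/prodf_eq0[k ki]].
  rewrite mulf_eq0 mpolyC_eq0 subr_eq0 inj_eq // eq_sym (negPf ki) /=.
  by rewrite -msize_poly_eq0 msizeX.
apply: (has_chain_extend (IHt _ _ irC' indC')); last 2 first.
- exact: zclosed_zeros.
- exact: zero_set_irreducible indY.
split=> [r h f k v fk fC rv|sub]; first by apply: h fk (CC' f fC) rv.
pose f := p - lam%:MP * q.
have f1 : f \is 1.-homog.
  have lin (y : 'M[F]_(d, _)) i : linmap y 0 i \is 1.-homog; last first.
    by apply: rpredB; [exact: lin | rewrite mul_mpolyC; apply: dhomogZ; exact: lin].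
  rewrite mxE; apply: rpred_sum => k _; rewrite !mxE mulrC mul_mpolyC; apply: dhomogZ.
  by rewrite dhomogX /= mdeg1.
have f0 : ~ vanish C f.
  move=> fC; pose G : {mpoly F[t.+2]} := 'X_ord0 - lam%:MP * 'X_(rshift 1 0).
  have : G = 0.
    apply: indY => v Cv; rewrite mevalB mevalM mevalC !mevalXU -pE.
    have := fC v Cv; rewrite mevalB mevalM mevalC => <-; congr (_ - _ * _).
    by rewrite /q -evE ev_linmap YE; exact: row_mxEr.
  move/(congr1 (mcoeff U_(ord0))) => /eqP; rewrite mcoeff0 mcoeffB mcoeffX eqxx mcoeffCM mcoeffX.
  by rewrite eq_mnm1 (_ : rshift 1 0 == ord0 = false) // mulr0 subr0 oner_eq0.
have [v Cv fv] := (not_vanishP _ _).1 f0.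
have v0 : v != 0 by apply: contra fv => /eqP->; rewrite -(scale0r 0) (homog_scale _ _ f1) expr1 mul0r.
have [r vr] := coords_ex v0.
case/eqP: fv; apply: (sub r (zero_set_cone Cv vr) f 1%N v f1 _ vr) => w /pq.
by rewrite mevalB mevalM mevalC => ->; rewrite subrr.
Qed.

End ClosedSets.

(** * Counting monomials to bound chains of irreducible sets *)

Section DimensionBound.
Variable F : closedFieldType.
Variable d : nat.
Implicit Types (f : nat -> {mpoly F[d]}) (B : nat).

(** Kept as a recursive product so that [vec_mx] splits a coefficient vector according to the power
    of the last polynomial. *)
Fixpoint boxdim B n : nat := if n is k.+1 then (B * boxdim B k)%N else 1%N.

Lemma boxdimE B n : boxdim B n = (B ^ n)%N.
Proof. by elim: n => //= n ->; rewrite expnS. Qed.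

(* The polynomials in f 0, .., f n.-1 of degree < B in each of them. *)
Fixpoint boxpoly B f n : 'rV[F]_(boxdim B n) -> {mpoly F[d]} :=
  if n is k.+1 return 'rV[F]_(boxdim B n) -> {mpoly F[d]} then
    fun v => \sum_(i < B) boxpoly f (row i (vec_mx v)) * f k ^+ i
  else fun v => (v 0 0)%:MP.

Lemma boxpolyD B f n (u v : 'rV[F]_(boxdim B n)) : boxpoly f (u + v) = boxpoly f u + boxpoly f v.
Proof.
elim: n u v => [|n IHn] u v /=; first by rewrite mxE mpolyCD.
by rewrite -big_split; apply: eq_bigr => i _ /=; rewrite !linearD /= IHn mulrDl.
Qed.

Lemma boxpolyZ B f n c (v : 'rV[F]_(boxdim B n)) : boxpoly f (c *: v) = c%:MP * boxpoly f v.
Proof.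
elim: n v => [|n IHn] v /=; first by rewrite mxE mpolyCM.
by rewrite mulr_sumr; apply: eq_bigr => i _ /=; rewrite !linearZ /= IHn mulrA.
Qed.

Lemma boxpoly_row B f n (v : 'rV[F]_(boxdim B n)) :
  boxpoly f v = \sum_i (v 0 i)%:MP * boxpoly f (delta_mx 0 i).
Proof.
rewrite [in LHS](row_sum_delta v); elim/big_rec2: _ => [|i x y _ <-]; last by rewrite boxpolyD boxpolyZ.
by rewrite -(scale0r 0) boxpolyZ mpolyC0 mul0r.
Qed.

Lemma msize_mul_le (p q : {mpoly F[d]}) a b :
  (msize p <= a.+1)%N -> (msize q <= b.+1)%N -> (msize (p * q) <= (a + b).+1)%N.
Proof.
move=> pa qb; have [->|p0] := eqVneq p 0; first by rewrite mul0r msize0.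
have [->|q0] := eqVneq q 0; first by rewrite mulr0 msize0.
rewrite msizeM //; move: pa qb; move: (msize p) (msize q) => x y; lia.
Qed.

Lemma boxpoly_msize B f D n (v : 'rV[F]_(boxdim B n)) :
  (forall i, (i < n)%N -> (msize (f i) <= D.+1)%N) -> (msize (boxpoly f v) <= (n * (B * D)).+1)%N.
Proof.
elim: n v => [|n IHn] v fD /=; first by rewrite msizeC; case: (_ != 0).
apply: leq_trans (msize_sum _ _ _) _; apply/bigmax_leqP => i _.
rewrite mulSn addnC; apply: msize_mul_le; first by apply: IHn => j jn; apply: fD; exact: ltnW.
have : (msize (f n ^+ i) <= (i * D).+1)%N.
  elim: (nat_of_ord i) => [|k IHk]; first by rewrite expr0 msize1.
  by rewrite exprS mulSn; apply: msize_mul_le IHk; exact: fD.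
by move/leq_trans; apply; rewrite ltnS leq_mul2r ltnW ?orbT.
Qed.

(** The polynomials [f i] separating consecutive members are algebraically independent. So the B^k
    products with exponents below [B] are linearly independent, while their degrees grow linearly in
    [B] and leave room for O(B^d) of them only. *)
Lemma prime_chain_bound k (C : nat -> set 'rV[F]_d) f :
  C 0%N !=set0 ->
  (forall i, (i < k)%N -> [/\ irr (C i.+1), vanish (C i.+1) `<=` vanish (C i),
     vanish (C i) (f i) & ~ vanish (C i.+1) (f i)]) -> (k <= d)%N.
Proof.
move=> [u0 C0] H.
have indep B j (v : 'rV[F]_(boxdim B j)) : (j <= k)%N -> vanish (C j) (boxpoly f v) -> v = 0.
  elim: j v => [|j IHj] v jk /=.
    by move=> /(_ u0 C0); rewrite mevalC => v0; apply/rowP => i; rewrite mxE -v0 ord1.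
  have [irC sub fj fj'] := H j jk; have [[_ _ IM] _ Ipr] := irC.
  (* Restriction to [C j], where [f j] vanishes, kills the constant coefficient. Then [f j] cancels,
     as it is not in the prime ideal of [C j.+1]. *)
  have shift (a : nat -> 'rV[F]_(boxdim B j)) n :
      vanish (C j.+1) (\sum_(i < n) boxpoly f (a i) * f j ^+ i) -> forall i, (i < n)%N -> a i = 0.
    elim: n a => // n IHn a; rewrite big_ord_recl /= expr0 mulr1.
    have -> : \sum_(i < n) boxpoly f (a (bump 0 i)) * f j ^+ bump 0 i =
        f j * \sum_(i < n) boxpoly f (a i.+1) * f j ^+ i.
      by rewrite mulr_sumr; apply: eq_bigr => i _; rewrite /bump /= add1n exprS mulrCA.
    move=> h; have a0 : a 0%N = 0.
      apply: IHj; first exact: ltnW.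
      by move=> w Cw; have := sub _ h w Cw; rewrite mevalD mevalM fj // mul0r addr0.
    have {}h : vanish (C j.+1) (\sum_(i < n) boxpoly f (a i.+1) * f j ^+ i).
      suff : vanish (C j.+1) (f j * \sum_(i < n) boxpoly f (a i.+1) * f j ^+ i) by case/Ipr.
      have E : boxpoly f (a 0%N) = 0 by rewrite a0 -(scale0r 0) boxpolyZ mpolyC0 mul0r.
      by rewrite E add0r in h.
    by case=> [//|i]; rewrite ltnS; exact: (IHn (fun i => a i.+1)).
  move=> h; rewrite -[v]vec_mxK; apply/eqP; rewrite mxvec_eq0; apply/eqP/row_matrixP => i.
  rewrite row0; pose a n := row (insubd i n) (vec_mx v) : 'rV[F]_(boxdim B j).
  have aE (l : 'I_B) : row l (vec_mx v) = a l by rewrite /a valKd.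
  rewrite aE; apply: (shift a B) => //.
  have <- // : boxpoly f v = \sum_(l < B) boxpoly f (a l) * f j ^+ l.
  by apply: eq_bigr => l _; rewrite aE.
rewrite leqNgt; apply/negP => dk.
pose D := \max_(i < k) msize (f i); pose K := (k * D).+1.
(* Chosen so that M^d <= K^d B^d < B^(d+1) <= B^k. *)
pose B := (K ^ d).+1; pose M := (k * (B * D)).+1.
have MKB : (M <= K * B)%N by rewrite /M /K; nia.
pose T : finType := 'X_{1..d < M}.
have cardT : (#|T| <= M ^ d)%N.
  rewrite -[M]card_ord -[d in (_ ^ d)%N]card_ord -card_ffun.
  apply: (@leq_card _ _ (fun m : T => [ffun i : 'I_d => inord (val m i) : 'I_M])).
  move=> m m' /ffunP mm'; apply/val_inj/mnmP => i; have := mm' i; rewrite !ffunE.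
  have lt (n : T) : (val n i < M)%N.
    by apply: leq_ltn_trans (bmdeg n); rewrite mdegE (bigD1 i) //= leq_addr.
  by move=> /(congr1 val) /=; rewrite !inordK; [|exact: lt|exact: lt].
have small : (#|T| < boxdim B k)%N.
  rewrite boxdimE; apply: leq_ltn_trans cardT _.
  have : (M ^ d <= (K * B) ^ d)%N by case: (d) => [|e]; [rewrite !expn0 | rewrite leq_exp2r].
  move/leq_ltn_trans; apply; rewrite expnMn.
  apply: (@leq_trans (B ^ d.+1)); last exact: leq_pexp2l.
  by rewrite expnS ltn_pmul2r ?expn_gt0.
pose A : 'M[F]_(boxdim B k, #|T|) := \matrix_(i, j) (boxpoly f (delta_mx 0 i))@_(val (enum_val j)).
have /rowV0Pn[v /sub_kermxP vA v0] : kermx A != 0.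
  by rewrite -mxrank_eq0 mxrank_ker subn_eq0 -ltnNge (leq_ltn_trans (rank_leq_col _)).
case/eqP: v0; apply: (indep B k) => //; suff -> : boxpoly f v = 0 by move=> u _; rewrite meval0.
apply/mpolyP => m; rewrite mcoeff0; have [mM|mM] := ltnP (mdeg m) M; last first.
  apply: memN_msupp_eq0; apply: msize_mdeg_ge; apply: leq_trans mM; apply: boxpoly_msize => i ik.
  by apply: leqW; exact: (leq_bigmax (Ordinal ik)).
rewrite boxpoly_row raddf_sum; move/matrixP: vA => /(_ 0 (enum_rank (BMultinom mM))).
rewrite !mxE => vA; apply: etrans vA; apply: eq_bigr => i _.
by rewrite /= mcoeffCM !mxE enum_rankK.
Qed.

End DimensionBound.

(** * Krull dimension and generic tangent spaces *)

Section Dimension.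
Variable F : closedFieldType.
Hypothesis charF : [pchar F] =i pred0.

(** The cones over the chain, preceded by the origin, form an affine chain with one more step. *)
Lemma chain_length_bound d (A : set (Proj F d)) k : has_chain A k -> (k < d)%N.
Proof.
move=> [Z [Z1 Z2]]; pose C i := if i is j.+1 then cone (Z j) else [set 0 : 'rV[F]_d].
have irrC i : (i <= k)%N -> irr (cone (Z i)).
  by move=> /Z1[? ? _]; exact: irr_cone.
have /choice[f fP] i : exists f, (i < k.+1)%N -> vanish (C i) f /\ ~ vanish (C i.+1) f.
  case: i => [|i].
    have [_ [[p Zp] _] _] := Z1 0%N (leq0n k).
    have /rV0Pn[j pj] := coords_neq0 (vpick_coords p).
    exists 'X_j => _; split=> [_ ->|]; first by rewrite mevalXU mxE.
    apply/not_vanishP; exists (vpick (val p)); last by rewrite mevalXU.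
    by exists p => //; exact: vpick_coords.
  have [ik|ik] := ltnP i k; last by exists 0; rewrite ltnS ltnNge ik.
  have [_ /existsNP[p /not_implyP[Zp nZp]]] := Z2 i ik.
  have [/zclosedP cl _ _] := Z1 i (ltnW ik).
  have [h hZ hp] := cl p _ nZp (vpick_coords p).
  exists h => _; split=> //; apply/not_vanishP; exists (vpick (val p)) => //.
  by exists p => //; exact: vpick_coords.
apply: (@prime_chain_bound F d k.+1 C f); first by exists 0.
move=> i ik; have [fi fi'] := fP i ik; split=> //; first exact: irrC.
case: i ik {fi fi'} => [|i] ik g gC v.
  move=> /= ->; have [_ [[p Zp] _] _] := Z1 0%N (leq0n k).
  have [q qP] := line_poly g 0 (vpick (val p)).
  have q0 : q = 0.
    apply: (@poly_eq0_cofinite _ q [:: 0]) => s; rewrite inE => s0; rewrite (qP s).1 add0r.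
    by apply: gC; apply: cone_scale s0; exists p => //; exact: vpick_coords.
  by have := (qP 0).1; rewrite q0 horner0 scale0r addr0.
move=> [p Zp pv]; apply: gC; exists p => //.
have [sub _] := Z2 i ik; exact: sub.
Qed.

(** Lengths of chains are bounded, so [xget] returns a true maximum and not its default value. *)
Lemma krull_dim_max d (A : set (Proj F d)) k : has_chain A k ->
  has_chain A (krull_dim A) /\ forall l, has_chain A l -> (l <= krull_dim A)%N.
Proof.
move=> Ak; apply: (@xgetPex _ 0%N [set k | has_chain A k /\ forall l, has_chain A l -> (l <= k)%N]).
have ex : exists l, `[< has_chain A l >] by exists k; exact/asboolP.
have ub l : `[< has_chain A l >] -> (l <= d)%N by move=> /asboolP/chain_length_bound/ltnW.
by have [l /asboolP Al lmax] := ex_maxnP ex ub; exists l; split=> // j /asboolP/lmax.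
Qed.

Lemma algind_free d t (C : set 'rV[F]_d) (Y : 'M[F]_(d, t)) (c : 'cV[F]_t) :
  algind C Y -> Y *m c = 0 -> c = 0.
Proof.
move=> indY Yc; pose G := \sum_i c i 0 *: ('X_i : {mpoly F[t]}).
have G0 : G = 0.
  apply: indY => v Cv; transitivity ((v *m Y *m c) 0 0); last by rewrite -mulmxA Yc mulmx0 mxE.
  rewrite raddf_sum mxE /=.
  by apply: eq_bigr => i _; rewrite mevalZ mevalXU mulrC.
apply/colP => i; have /mpolyP/(_ U_(i)%MM) := G0; rewrite raddf_sum /= mcoeff0 (bigD1 i) //=.
rewrite mcoeffZ mcoeffX eqxx mulr1 big1 ?addr0 => [->|j ji]; first by rewrite mxE.
by rewrite mcoeffZ mcoeffX eq_mnm1 (negPf ji) mulr0.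
Qed.

Lemma algind_size d t (C : set 'rV[F]_d) (Y : 'M[F]_(d, t)) : algind C Y -> (t <= d)%N.
Proof.
move=> indY; have : row_free Y^T.
  rewrite -kermx_eq0; apply/negPn/negP => /rowV0Pn[v /sub_kermxP vY v0].
  case/eqP: v0; apply: trmx_inj; rewrite trmx0; apply: algind_free indY _.
  by rewrite -[Y]trmxK -trmx_mul vY trmx0.
by move=> /eqP <-; exact: rank_leq_col.
Qed.

(** Testing the coordinates alone suffices: it makes each of them algebraic over [Y]. *)
Definition algmax d t (C : set 'rV[F]_d) (Y : 'M[F]_(d, t)) :=
  forall j, ~ algind C (row_mx (delta_mx j 0 : 'cV_d) Y).

Lemma algind_extend d t (C : set 'rV[F]_d) (Y : 'M[F]_(d, t)) : algind C Y ->
  exists t' (Y' : 'M[F]_(d, t')) (B : 'M[F]_(t', t)), [/\ algind C Y', algmax C Y' & Y = Y' *m B].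
Proof.
have [k] := ubnP (d - t); elim: k t Y => // k IHk t Y dt indY.
have [Ymax|/existsNP[j /contrapT indj]] := pselect (algmax C Y).
  by exists t, Y, 1%:M; rewrite mulmx1.
have td := algind_size indj.
have [|t' [Y' [B [indY' maxY' jE]]]] := IHk _ _ _ indj; first by lia.
exists t', Y', (rsubmx B); split=> //.
by move: jE; rewrite -{1}[B]hsubmxK mul_mx_row => /eq_row_mx[].
Qed.

Lemma mderiv_indep d (G : {mpoly F[d]}) (z z' : 'rV[F]_d) :
  (forall i, G^`M(i) = 0 \/ z 0 i = z' 0 i) -> G.@[z 0] = G.@[z' 0].
Proof.
move=> h; have [q qP] := line_poly G z (z' - z).
have q'0 : q^`() = 0.
  apply: (@poly_eq0_cofinite _ _ [::]) => x _; rewrite (qP x).2 /dif big1 // => i _.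
  by case: (h i) => [->|zi]; rewrite ?meval0 ?mul0r // !mxE zi subrr mulr0.
have := (qP 0).1; rewrite scale0r addr0 => <-; have := (qP 1).1; rewrite scale1r addrC subrK => <-.
by rewrite (poly_deriv0 charF q'0) !hornerC.
Qed.

Lemma first_var_const t (G : {mpoly F[1 + t]}) (a : 'rV[F]_1) z : G^`M(lshift t 0) = 0 ->
  G.@[(row_mx a z) 0] = (cmp (row_mx 0 (varmx F t)) G).@[z 0].
Proof.
move=> G0; rewrite ev_cmp ev_row_mx ev_varmx; apply: mderiv_indep => i.
have [k ->|k ->] := split_ordP i; first by left; rewrite ord1.
by right; rewrite !row_mxEr.
Qed.

Lemma min_msize d (P : {mpoly F[d]} -> Prop) : (exists2 G, G != 0 & P G) ->
  exists G, [/\ G != 0, P G & forall i, P G^`M(i) -> G^`M(i) = 0].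
Proof.
move=> [G0 G00 PG0].
have ex : exists k, `[< exists G, [/\ G != 0, P G & msize G = k] >].
  by exists (msize G0); apply/asboolP; exists G0.
have [k /asboolP[G [G1 PG Gk]] kmin] := ex_minnP ex.
exists G; split=> // i PGi; apply/eqP/negPn/negP => Gi.
have /kmin : `[< exists H, [/\ H != 0, P H & msize H = msize G^`M(i)] >].
  by apply/asboolP; exists G^`M(i).
by rewrite leqNgt -Gk msize_mderiv.
Qed.

Lemma row_mx_first t (a : 'rV[F]_1) :
  row_mx a (0 : 'rV[F]_t) = a 0 0 *: delta_mx 0 (lshift t 0).
Proof.
apply/rowP => k; have [l ->|l ->] := split_ordP k; rewrite ?row_mxEl ?row_mxEr !mxE eqxx.
  by rewrite ord1 eqxx mulr1.
by rewrite (_ : _ == _ = false) ?mulr0.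
Qed.

(** Each coordinate z_j satisfies a relation G_j(z_j, z Y) = 0 of least degree, whose derivative in
    z_j is therefore not identically zero on [C]. Where no such derivative vanishes, differentiating
    along a tangent [u] with u Y = 0 gives u_j = 0. *)
Lemma generic_tangent d t (C : set 'rV[F]_d) (Y : 'M[F]_(d, t)) : irr C -> algind C Y -> algmax C Y ->
  exists2 D : {mpoly F[d]}, ~ vanish C D & forall z u : 'rV[F]_d, D.@[z 0] != 0 ->
    (forall f : {mpoly F[d]}, vanish C f -> dif f z u = 0) -> u *m Y = 0 -> u = 0.
Proof.
move=> irC indY maxY; pose i0 : 'I_(1 + t) := lshift t 0.
pose Yj j : 'M[F]_(d, 1 + t) := row_mx (delta_mx j 0 : 'cV_d) Y.
have Yj0 (v : 'rV[F]_d) j : v *m (delta_mx j 0 : 'cV_d) = (v 0 j)%:M.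
  by apply/matrixP => a b; rewrite -colE !ord1 !mxE mulr1n.
have /choice[G GP] j : exists G : {mpoly F[1 + t]}, vanish C (cmp (linmap (Yj j)) G) /\
    ~ vanish C (cmp (linmap (Yj j)) G^`M(i0)).
  have [|G [G0 GC Gmin]] := @min_msize (1 + t) (fun G => vanish C (cmp (linmap (Yj j)) G)).
    have /existsNP[G /not_implyP[GC /eqP G0]] := maxY j; exists G => // v Cv.
    by rewrite ev_cmp ev_linmap GC.
  exists G; split=> // /Gmin Gi; case/eqP: G0; apply: (mpoly_fun_eq0 charF) => z.
  have -> : z = row_mx (lsubmx z) (rsubmx z) by rewrite hsubmxK.
  rewrite (first_var_const _ _ Gi); set H := cmp _ G; suff -> : H = 0 by rewrite meval0.
  apply: indY => v Cv; rewrite -(first_var_const (v 0 j)%:M _ Gi) -Yj0 -mul_mx_row.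
  by have := GC v Cv; rewrite ev_cmp ev_linmap.
exists (\prod_j cmp (linmap (Yj j)) (G j)^`M(i0)).
  by apply: prime_prod => // j _; case: (GP j).
move=> z u; rewrite rmorph_prod => /prodf_neq0 Dz tang uY; apply/rowP => j; rewrite mxE.
have := tang _ (GP j).1; rewrite dif_cmp ev_linmap dmx_linmap (mul_mx_row u) uY Yj0.
rewrite row_mx_first mxE eqxx mulr1n difZr dif_delta => /eqP; rewrite mulf_eq0 => /orP[/eqP//|].
by have := Dz j isT; rewrite /= ev_cmp ev_linmap => /negPf ->.
Qed.

End Dimension.

(** * Rational functions on cones and curves in their fibres *)

Section FibreCurves.
Variable F : closedFieldType.
Hypothesis charF : [pchar F] =i pred0.
Hypothesis pigeonF : has_large_fibres F.

Definition tang d (C : set 'rV[F]_d) (z u : 'rV[F]_d) :=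
  forall f : {mpoly F[d]}, vanish C f -> dif f z u = 0.

Definition tframe d n (C : set 'rV[F]_d) (z : 'rV[F]_d) (U : 'M[F]_(n, d)) :=
  row_free U /\ forall a : 'rV[F]_n, tang C z (a *m U).

Lemma row_free_ker n d (U : 'M[F]_(n, d)) :
  (forall a : 'rV[F]_n, a *m U = 0 -> a = 0) -> row_free U.
Proof.
move=> h; rewrite -kermx_eq0; apply/negPn/negP => /rowV0Pn[a /sub_kermxP/h->].
by rewrite eqxx.
Qed.

Lemma algmax_exists d (C : set 'rV[F]_d) : irr C ->
  exists t (Y : 'M[F]_(d, t)), algind C Y /\ algmax C Y.
Proof.
move=> [_ C1 _]; have [v Cv _] := (not_vanishP _ _).1 C1.
have ind0 : algind C (0 : 'M[F]_(d, 0)).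
  move=> G GC; apply: (mpoly_fun_eq0 charF) => z.
  by rewrite (_ : z = v *m (0 : 'M_(d, 0))) ?GC //; apply/rowP => -[].
by have [t [Y [B [indY maxY _]]]] := algind_extend ind0; exists t, Y.
Qed.

Lemma tframe_free d n t (C : set 'rV[F]_d) (z : 'rV[F]_d) (U : 'M[F]_(n, d)) (Y : 'M[F]_(d, t)) :
  tframe C z U -> (forall u, tang C z u -> u *m Y = 0 -> u = 0) -> row_free (U *m Y).
Proof.
move=> [Ufree Ut] h; apply: row_free_ker => a; rewrite mulmxA => /(h _ (Ut a))/eqP.
by rewrite mulmx_free_eq0 // => /eqP.
Qed.

Lemma tangent_dim_le d n (C : set 'rV[F]_d) : irr C ->
  (forall t (Y : 'M[F]_(d, t)), algind C Y -> (t <= n)%N) ->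
  exists2 D : {mpoly F[d]}, ~ vanish C D & forall (z : 'rV[F]_d) m (U : 'M[F]_(m, d)),
    D.@[z 0] != 0 -> tframe C z U -> (m <= n)%N.
Proof.
move=> irC bound; have [t [Y [indY maxY]]] := algmax_exists irC.
have [D DC DP] := generic_tangent charF irC indY maxY.
exists D => // z m U Dz zU; apply: leq_trans (bound _ _ indY).
by rewrite -(eqP (tframe_free zU (DP z ^~ Dz))) rank_leq_col.
Qed.

(** It is killed by [z *m Y], so [u *m Y *m ratio_kernel Y z] is, up to the square of the
    denominator, the differential along [u] of the quotient of the two forms. *)
Definition ratio_kernel d (Y : 'M[F]_(d, 2)) (z : 'rV[F]_d) : 'cV[F]_2 :=
  \col_i (if i == 0 then (z *m Y) 0 1 else - (z *m Y) 0 0).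

(** Extend the pair to a maximal family Y' with Y = Y' B. At a general point an [n]-frame makes U Y'
    invertible, so a stationary quotient would force a linear relation between the two forms. *)
Lemma ratio_not_stationary d n (C : set 'rV[F]_d) (Y : 'M[F]_(d, 2)) (g : {mpoly F[d]}) : irr C ->
  (forall t (Y : 'M[F]_(d, t)), algind C Y -> (t <= n)%N) -> algind C Y -> ~ vanish C g ->
  exists z : 'rV[F]_d, [/\ C z, g.@[z 0] != 0 & forall U : 'M[F]_(n, d), tframe C z U ->
    U *m Y *m ratio_kernel Y z != 0].
Proof.
move=> irC bound indY gC; have [t [Y' [B [indY' maxY' YE]]]] := algind_extend indY.
have [D DC DP] := generic_tangent charF irC indY' maxY'.
have lC := algind_nonvanish (i := 0) indY.
have [z Cz [Dz]] : exists2 z, C z & D.@[z 0] != 0 /\ (g * linmap Y 0 0).@[z 0] != 0.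
  by apply: irr_nonvanish => //; have [_ _ pr] := irC; case/pr.
rewrite mevalM mulf_eq0 negb_or -evE ev_linmap => /andP[gz yz].
exists z; split=> // U zU; apply/eqP => h.
have free := tframe_free zU (DP z ^~ Dz).
have tn : t = n.
  apply/eqP; rewrite eqn_leq (bound _ _ indY') /=.
  by rewrite -(eqP free) rank_leq_col.
subst t; have unit : U *m Y' \in unitmx by rewrite -row_free_unit.
have : ratio_kernel Y z = 0.
  apply: algind_free indY _; rewrite {1}YE -mulmxA.
  rewrite {1}YE -!mulmxA mulmxA in h.
  by rewrite -(mulKmx unit (B *m _)) h !mulmx0.
by move/colP/(_ 1); rewrite !mxE /= => /eqP; rewrite oppr_eq0; apply/negP; rewrite mxE in yz.
Qed.

Definition ratpt d t (p q : {mpoly F[d]}) (Y : 'M[F]_(d, t)) (v : 'rV[F]_d) : 'rV[F]_(1 + t) :=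
  row_mx (p.@[v 0] / q.@[v 0])%:M (v *m Y).

Definition ratdif d (p q : {mpoly F[d]}) (z u : 'rV[F]_d) : F :=
  (dif p z u * q.@[z 0] - p.@[z 0] * dif q z u) / q.@[z 0] ^+ 2.

(** [P] and [Q] are numerator and denominator of the composite of [G] with the rational map [ratpt];
    the second clause is the product rule. *)
Lemma clear_denominators d t (p q : {mpoly F[d]}) (Y : 'M[F]_(d, t)) (G : {mpoly F[1 + t]}) :
  exists P Q : {mpoly F[d]}, (forall v : 'rV[F]_d, q.@[v 0] != 0 ->
     Q.@[v 0] != 0 /\ P.@[v 0] = Q.@[v 0] * G.@[(ratpt p q Y v) 0]) /\
  forall z u : 'rV[F]_d, q.@[z 0] != 0 -> dif P z u =
    Q.@[z 0] * dif G (ratpt p q Y z) (row_mx (ratdif p q z u)%:M (u *m Y)) +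
    dif Q z u * G.@[(ratpt p q Y z) 0].
Proof.
elim/mpoly_ring_ind: G => [c|i|G H [P [Q [h1 h2]]] [P' [Q' [h1' h2']]]|G H [P [Q [h1 h2]]] [P' [Q' [h1' h2']]]].
- exists c%:MP, 1%:MP; split=> [v|z u] _; first by rewrite !mevalC oner_neq0 mul1r.
  by rewrite !difC mulr0 mul0r addr0.
- have [k ->|k ->] := split_ordP i.
    exists p, q; split=> [v qv|z u qz]; rewrite ?mevalXU ?difX !row_mxEl ord1 !mxE eqxx mulr1n.
      by rewrite mulrC divfK.
    by rewrite mulr1n /ratdif; field.
  exists (linmap Y 0 k), 1; split=> [v qv|z u qz]; rewrite ?mevalXU ?difX !row_mxEr.
    by rewrite meval1 oner_neq0 mul1r -evE ev_linmap.
  by rewrite -mpolyC1 difC mul0r addr0 mevalC mul1r -(dmx_linmap Y z) [RHS]mxE.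
- exists (P * Q' + P' * Q), (Q * Q'); split=> [v qv|z u qz].
    have [Q0 PE] := h1 v qv; have [Q0' PE'] := h1' v qv.
    by rewrite !mevalD !mevalM mulf_neq0 // PE PE'; split=> //; ring.
  have [_ PE] := h1 z qz; have [_ PE'] := h1' z qz.
  by rewrite !difD !difM h2 // h2' // mevalD mevalM PE PE'; ring.
- exists (P * P'), (Q * Q'); split=> [v qv|z u qz].
    have [Q0 PE] := h1 v qv; have [Q0' PE'] := h1' v qv.
    by rewrite !mevalM mulf_neq0 // PE PE'; split=> //; ring.
  have [_ PE] := h1 z qz; have [_ PE'] := h1' z qz.
  by rewrite !difM h2 // h2' // mevalM PE PE' mevalM; ring.
Qed.

(* If [p / q] were algebraic over every pair of three independent linear forms, its differential *)
(* would vanish, hence it would be constant.                                                     *)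
Lemma fibre_curve d (C : set 'rV[F]_d) (p q f : {mpoly F[d]}) (bad : seq F) : irr C ->
  (forall t (Y : 'M[F]_(d, t)), algind C Y -> (t <= 3)%N) ->
  (forall z, C z -> exists U : 'M[F]_(3, d), tframe C z U) ->
  ~ vanish C q -> (forall l, ~ vanish C (p - l%:MP * q)) -> ~ vanish C f ->
  exists lam C' (Y : 'M[F]_(d, 2)), [/\ lam \notin bad, irr C', vanish C `<=` vanish C',
    forall v, C' v -> p.@[v 0] = lam * q.@[v 0] & ~ vanish C' f /\ algind C' Y].
Proof.
move=> irC bound tanC qC pqC fC; have [t [Y [indY maxY]]] := algmax_exists irC.
have [D DC DP] := generic_tangent charF irC indY maxY.
have t3 : t = 3.
  apply/eqP; rewrite eqn_leq (bound _ _ indY) /=; have [z Cz Dz] := (not_vanishP _ _).1 DC.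
  have [U zU] := tanC z Cz.
  by have := rank_leq_col (U *m Y); rewrite (eqP (tframe_free zU (DP z ^~ Dz))).
subst t; pose E (k : 'I_3) : 'M[F]_(3, 2) := col' k 1%:M.
pose i0 : 'I_(1 + 2) := lshift 2 0.
pose rel k (G : {mpoly F[1 + 2]}) := forall v, C v -> q.@[v 0] != 0 -> G.@[(ratpt p q (Y *m E k) v) 0] = 0.
have [_ _ Cpr] := irC.
have rel0 k (G : {mpoly F[1 + 2]}) (P Q : {mpoly F[d]}) :
    (forall v : 'rV[F]_d, q.@[v 0] != 0 -> Q.@[v 0] != 0 /\ P.@[v 0] = Q.@[v 0] * G.@[(ratpt p q (Y *m E k) v) 0]) ->
    rel k G <-> vanish C P.
  move=> PQ; split=> [Gk|PC v Cv qv].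
    have : vanish C (P * q).
      move=> v Cv; rewrite mevalM; have [->|qv] := eqVneq q.@[v 0] 0; first by rewrite mulr0.
      by rewrite (PQ v qv).2 Gk // mulr0 mul0r.
    by case/Cpr.
  have [Qv PE] := PQ v qv; have := PC v Cv; rewrite PE => /eqP.
  by rewrite mulf_eq0 (negPf Qv) => /eqP.
(* If p / q is algebraically independent of two of the three forms, [irr_cut] applies with these
   two. *)
have [[k kP]|nok] := pselect (exists k, forall G, rel k G -> G = 0).
  suff [lam [C' [h1 h2 h3 h4 h5]]] : exists lam C', [/\ lam \notin bad, irr C', vanish C `<=` vanish C',
    forall v, C' v -> p.@[v 0] = lam * q.@[v 0] & ~ vanish C' f /\ algind C' (Y *m E k)].
    by exists lam, C', (Y *m E k).
  apply: irr_cut => // n l G linj relG.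
  pose sub : 'rV[{mpoly F[1 + 2]}]_2 := \row_j 'X_(rshift 1 j).
  have subE (z1 : 'rV[F]_1) (z2 : 'rV[F]_2) : ev (row_mx z1 z2) sub = z2.
    by apply/rowP => j; rewrite !mxE mevalXU row_mxEr.
  pose H := \sum_i cmp sub (G i) * \prod_(j < n | j != i) ('X_i0 - (l j)%:MP).
  have HE (z1 : 'rV[F]_1) (z2 : 'rV[F]_2) : H.@[(row_mx z1 z2) 0] =
      \sum_i (G i).@[z2 0] * \prod_(j < n | j != i) (z1 0 0 - l j).
    rewrite raddf_sum; apply: eq_bigr => i _ /=; rewrite mevalM ev_cmp subE rmorph_prod.
    congr (_ * _); apply: eq_bigr => j _; rewrite /= mevalB mevalC.
    by rewrite mevalXU row_mxEl.
  have H0 : H = 0.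
    apply: kP => v Cv qv; rewrite HE; apply: (mulIf (expf_neq0 n.-1 qv)); rewrite mul0r -[RHS](relG v Cv).
    rewrite mulr_suml; apply: eq_bigr => i _; rewrite -mulrA; congr (_ * _).
    have -> : q.@[v 0] ^+ n.-1 = \prod_(j < n | j != i) q.@[v 0].
      by rewrite prodr_const cardC1 card_ord.
    rewrite -big_split; apply: eq_bigr => j _.
    by rewrite /= mxE eqxx mulr1n mulrBl divfK.
  move=> i; have : G i * \prod_(j < n | j != i) (l i - l j)%:MP = 0.
    apply: (mpoly_fun_eq0 charF) => z; have := HE (l i)%:M z; rewrite H0 meval0.
    rewrite (bigD1 i) //= [X in _ + X]big1 => [|j ji]; last first.
      by rewrite (bigD1 i) 1?eq_sym //= mxE eqxx mulr1n subrr mul0r mulr0.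
    rewrite addr0 => ->; rewrite mevalM rmorph_prod; congr (_ * _); apply: eq_bigr => j _.
    by rewrite /= mevalC mxE eqxx mulr1n.
  move/eqP; rewrite mulf_eq0 => /orP[/eqP//|/prodf_eq0[j ji]].
  by rewrite mpolyC_eq0 subr_eq0 inj_eq // eq_sym (negPf ji).
exfalso; have /choice[G GP] k : exists G, [/\ G != 0, rel k G & forall i, rel k G^`M(i) -> G^`M(i) = 0].
  apply: min_msize; apply: contrapT => h; apply: nok; exists k => G Gk.
  by apply/eqP/negPn/negP => G0; apply: h; exists G.
have dG0 k : ~ rel k (G k)^`M(i0).
  move=> relG; have [Gk0 GkC Gkm] := GP k; have {relG} Gi := Gkm _ relG.
  case/eqP: Gk0; apply: (mpoly_fun_eq0 charF) => z.
  have -> : z = row_mx (lsubmx z) (rsubmx z) by rewrite hsubmxK.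
  rewrite (first_var_const charF _ _ Gi); set H := cmp _ (G k).
  suff h : cmp (linmap (E k)) H = 0.
    have RE : row' k 1%:M *m E k = 1%:M :> 'M[F]_2.
      apply/matrixP => i j; transitivity (((1%:M : 'M[F]_3) *m 1%:M) (lift k i) (lift k j)).
        by rewrite !mxE; apply: eq_bigr => a _; rewrite !mxE.
      by rewrite mulmx1 !mxE (inj_eq lift_inj).
    have := congr1 (meval ((rsubmx z *m row' k 1%:M) 0)) h; rewrite ev_cmp ev_linmap meval0.
    by rewrite -mulmxA RE mulmx1.
  apply: indY => v Cv; rewrite ev_cmp ev_linmap -mulmxA -ev_linmap -ev_cmp.
  suff : vanish C (cmp (linmap (Y *m E k)) H) by exact.
  suff : vanish C (cmp (linmap (Y *m E k)) H * q) by case/Cpr.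
  move=> {Cv}v Cv; rewrite mevalM ev_cmp ev_linmap -(first_var_const charF (p.@[v 0] / q.@[v 0])%:M _ Gi).
  by have [->|qv] := eqVneq q.@[v 0] 0; rewrite ?mulr0 // GkC ?mul0r.
have /choice[P PP] k : exists P : {mpoly F[d]}, ~ vanish C P /\
    forall v : 'rV[F]_d, q.@[v 0] != 0 -> P.@[v 0] != 0 -> (G k)^`M(i0).@[(ratpt p q (Y *m E k) v) 0] != 0.
  have [P [Q [PQ _]]] := clear_denominators p q (Y *m E k) (G k)^`M(i0).
  exists P; split=> [PC|v qv Pv]; first by apply: (dG0 k); exact/(rel0 _ _ _ _ PQ).
  by have [_] := PQ v qv; apply: contra_eq_neq => ->; rewrite mulr0.
(* The tangent vectors [u k] are dual to the three forms. Along [u k] the two forms in the k-th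
   relation are stationary, so p / q is as well; thus the whole differential of p / q vanishes. *)
have stat (z : 'rV[F]_d) : C z -> D.@[z 0] != 0 -> q.@[z 0] != 0 -> (forall k, (P k).@[z 0] != 0) ->
    forall j, (G 0)^`M(rshift 1 j).@[(ratpt p q (Y *m E 0) z) 0] = 0.
  move=> Cz Dz qz Pz; have [U zU] := tanC z Cz.
  have Ufree := tframe_free zU (DP z ^~ Dz); have unit : U *m Y \in unitmx by rewrite -row_free_unit.
  pose u (k : 'I_3) : 'rV[F]_d := delta_mx 0 k *m invmx (U *m Y) *m U.
  have uY k : u k *m Y = delta_mx 0 k by rewrite /u -(mulmxA _ U) mulmxKV.
  have dG k (w : 'rV[F]_d) : tang C z w -> dif (G k) (ratpt p q (Y *m E k) z) (row_mx (ratdif p q z w)%:M (w *m (Y *m E k))) = 0.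
    move=> tw; have [P' [Q' [PQ dP]]] := clear_denominators p q (Y *m E k) (G k).
    have [_ Gk _] := GP k; have /tw := (rel0 k _ _ _ PQ).1 Gk; rewrite dP // Gk // mulr0 addr0.
    by move=> /eqP; rewrite mulf_eq0 (negPf (PQ z qz).1) => /eqP.
  have tu k : tang C z (u k) by case: zU => _; apply.
  have r0 k : ratdif p q z (u k) = 0.
    have := dG k _ (tu k); rewrite mulmxA uY.
    have -> : delta_mx 0 k *m E k = 0 :> 'rV[F]_2.
      by apply/rowP => j; rewrite -rowE !mxE (negPf (neq_lift _ _)).
    rewrite row_mx_first difZr dif_delta mxE eqxx mulr1n => /eqP.
    by rewrite mulf_eq0 (negPf ((PP k).2 z qz (Pz k))) orbF => /eqP.
  move=> j; have := dG 0 _ (tu (lift 0 j)); rewrite r0 mulmxA uY.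
  have -> : row_mx 0%:M (delta_mx 0 (lift 0 j) *m E 0) = delta_mx 0 (rshift 1 j) :> 'rV[F]_(1 + 2).
    apply/rowP => i; rewrite -rowE; have [l ->|l ->] := split_ordP i; rewrite ?row_mxEl ?row_mxEr !mxE.
      by rewrite mul0rn eqxx eq_lrshift.
    by rewrite (inj_eq lift_inj) eqxx eq_rshift eq_sym.
  by rewrite dif_delta.
have dGj j : (G 0)^`M(rshift 1 j) = 0.
  have [_ _ Gm] := GP 0; apply: Gm.
  have [P' [Q' [PQ _]]] := clear_denominators p q (Y *m E 0) (G 0)^`M(rshift 1 j).
  apply/(rel0 _ _ _ _ PQ).
  suff : vanish C (P' * (D * (q * \prod_k P k))).
    case/Cpr => //; case/Cpr => //; case/Cpr => // h; exfalso; move: h; apply: prime_prod => // k _.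
    by case: (PP k).
  move=> z Cz; apply/eqP/negPn/negP; rewrite !mevalM !mulf_eq0 !negb_or rmorph_prod.
  move=> /and4P[P'z Dz qz /prodf_neq0 Pz]; have [_ P'E] := PQ z qz.
  by case/eqP: P'z; rewrite P'E stat ?mulr0 // => k; exact: Pz.
(* By minimality [G 0] now involves p / q alone, so p / q has finitely many values and is constant
   on [C]. *)
have [r rP] := line_poly (G 0) 0 (delta_mx 0 i0).
have rE (z : 'rV[F]_(1 + 2)) : (G 0).@[z 0] = r.[z 0 i0].
  rewrite (rP _).1; apply: mderiv_indep => // i; have [l ->|l ->] := split_ordP i.
    by right; rewrite !mxE ord1 !eqxx mulr1 add0r.
  by left; exact: dGj.
have r0 : r != 0.
  have [G00 _ _] := GP 0; apply: contra G00 => /eqP r0; apply/eqP; apply: (mpoly_fun_eq0 charF) => z.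
  by rewrite rE r0 horner0.
have [s sE] := closed_field_poly_normal r.
suff : vanish C ((\prod_(x <- s) (p - x%:MP * q)) * q).
  by case/Cpr => //; apply: prime_prod => // x _; exact: pqC.
move=> v Cv; rewrite mevalM; have [->|qv] := eqVneq q.@[v 0] 0; first by rewrite mulr0.
have [_ Gr _] := GP 0; have := Gr v Cv qv; rewrite rE row_mxEl mxE eqxx mulr1n sE hornerZ horner_prod.
move/eqP; rewrite mulf_eq0 lead_coef_eq0 (negPf r0) /= => /eqP h.
move/eqP: h; rewrite prodf_seq_eq0 => /hasP[x xs]; rewrite !hornerE subr_eq0 => /eqP h.
by rewrite (big_rem x) //= !mevalM mevalB mevalM mevalC -h divfK // subrr !mul0r.
Qed.

End FibreCurves.

(** * Regular functions and regular maps on projective sets *)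

Section RegularLines.
Variable F : closedFieldType.
Hypothesis pigeonF : has_large_fibres F.

(** With finitely many values x, the product of the a - x b vanishes on the cone, hence one factor
    does and [g] is constant where [b] is nonzero. Two such open sets meet. *)
Lemma regular_const d (A : set (Proj F d)) (g : 'rV[F]_d -> F) : zclosed A -> irreducible A ->
  (forall v (s : F), cone A v -> s != 0 -> g (s *: v) = g v) ->
  (forall v, cone A v -> exists a b : {mpoly F[d]}, b.@[v 0] != 0 /\
     forall w, cone A w -> a.@[w 0] = g w * b.@[w 0]) ->
  forall v w, cone A v -> cone A w -> g v = g w.
Proof.
move=> Acl Airr gs greg; have irC := irr_cone Acl Airr.
have [s sP] : exists s : seq F, forall v, cone A v -> g v \in s.
  apply: (regular_finite_values pigeonF) greg.
  - by move=> v v0; exact: cone_closed.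
  - by move=> v; exact: cone_neq0.
  - by move=> v c Cv c0; split; [exact: cone_scale | exact: gs].
have val v : cone A v -> exists b : {mpoly F[d]}, b.@[v 0] != 0 /\
    forall w, cone A w -> b.@[w 0] != 0 -> g w = g v.
  move=> Cv; have [a [b [bv ab]]] := greg v Cv; exists b; split=> //.
  have /existsNP[x /not_implyP[xs /contrapT xC]] :
      ~ forall x, x \in s -> ~ vanish (cone A) (a - x%:MP * b).
    move=> h; have : ~ vanish (cone A) (\prod_(x <- s) (a - x%:MP * b)).
      by rewrite big_seq; apply: prime_prod.
    apply=> w Cw; rewrite (big_rem (g w)) ?sP //= mevalM mevalB mevalM mevalC ab //.
    by rewrite subrr mul0r.
  have gx w : cone A w -> b.@[w 0] != 0 -> g w = x.
    move=> Cw bw; have := xC w Cw; rewrite mevalB mevalM mevalC ab // => /eqP.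
    by rewrite subr_eq0 (inj_eq (mulIf bw)) => /eqP.
  by move=> w Cw bw; rewrite !gx.
move=> v w Cv Cw; have [b [bv bP]] := val v Cv; have [c [cw cP]] := val w Cw.
have [||z Cz [bz cz]] := irr_nonvanish irC (f := b) (g := c).
- by apply/not_vanishP; exists v.
- by apply/not_vanishP; exists w.
by rewrite -(bP z) // (cP z).
Qed.

(* A regular map to a projective space, represented by arbitrary nonzero vectors on the lines. *)
Definition regline d e (C : set 'rV[F]_d) (l : 'rV[F]_d -> 'rV[F]_e) :=
  [/\ forall v, C v -> l v != 0,
      forall v (s : F), C v -> s != 0 -> exists c, l (s *: v) = c *: l v &
      forall v, C v -> exists Q : 'rV[{mpoly F[d]}]_e, ev v Q != 0 /\
        forall w, C w -> exists c, ev w Q = c *: l w].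

(** The quotients l_i l_j^m / D(l) are regular functions, hence constant, and they determine [l] up
    to a scalar. *)
Lemma regline_const d e m (A : set (Proj F d)) (l : 'rV[F]_d -> 'rV[F]_e) (D : {mpoly F[e]}) :
  zclosed A -> irreducible A -> regline (cone A) l -> D \is m.+1.-homog ->
  (forall v, cone A v -> D.@[(l v) 0] != 0) ->
  forall v w, cone A v -> cone A w -> exists c, l w = c *: l v.
Proof.
move=> Acl Airr [l0 ls lreg] Dh DA; have Ds := homog_scale _ _ Dh.
pose g i j v := l v 0 i * l v 0 j ^+ m / D.@[(l v) 0].
have gE i j w c x : cone A w -> x = c *: l w -> x 0 i * x 0 j ^+ m = g i j w * D.@[x 0].
  move=> Cw ->; rewrite Ds !mxE /g exprMn exprS.
  by have := DA w Cw => Dw; field.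
have gconst i j v w : cone A v -> cone A w -> g i j v = g i j w.
  apply: regular_const => // {}v => [s Cv s0|Cv].
    have Csv := cone_scale Cv s0; have [c lE] := ls v s Cv s0.
    by rewrite [LHS]/g (gE _ _ _ _ _ Cv lE) mulfK ?DA.
  have [Q [Q0 QP]] := lreg v Cv; exists (cmp Q ('X_i * 'X_j ^+ m)), (cmp Q D); split.
    have [c QE] := QP v Cv; rewrite ev_cmp QE Ds mulf_neq0 ?DA // expf_neq0 //.
    by apply: contra Q0 => /eqP c0; rewrite QE c0 scale0r.
  move=> w' Cw; have [c QE] := QP w' Cw.
  by rewrite !ev_cmp mevalM rmorphXn /= !mevalXU (gE _ _ _ _ _ Cw QE).
move=> v w Cv Cw; have /rV0Pn[j lj] := l0 v Cv.
have gj : g j j w != 0 by rewrite -(gconst j j v w) // /g !mulf_neq0 ?expf_neq0 ?invr_eq0 ?DA.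
have lw : l w 0 j != 0 by apply: contra gj => /eqP lw; rewrite /g lw !mul0r.
exists (l w 0 j / l v 0 j); apply/rowP => i; rewrite mxE.
have := gconst i j v w Cv Cw; have := gconst j j v w Cv Cw; rewrite /g.
move: (DA v Cv) (DA w Cw) => Dv Dw gjj gij.
rewrite -!mulrA in gij gjj.
have X0 : l v 0 j ^+ m / D.@[(l v) 0] != 0 by rewrite mulf_neq0 ?expf_neq0 ?invr_eq0.
have Y0 : l w 0 j ^+ m / D.@[(l w) 0] != 0 by rewrite mulf_neq0 ?expf_neq0 ?invr_eq0.
rewrite mulrAC; apply: (canRL (mulfK lj)); apply: (mulIf (mulf_neq0 X0 Y0)).
move: gij gjj {X0 Y0}; move: (l v 0 j ^+ m / D.@[(l v) 0]) (l w 0 j ^+ m / D.@[(l w) 0]) => X Y gij gjj.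
transitivity ((l w 0 i * Y) * (l v 0 j * X)); first by ring.
by rewrite -gij gjj; ring.
Qed.

(* Cramer's rule, for a maximal minor that does not vanish at [v0]. *)
Lemma cramer d k D E (C : set 'rV[F]_d) (Phi : 'M[{mpoly F[d]}]_(D, E)) (K : 'rV[F]_d -> 'M[F]_(k, D))
    (v0 : 'rV[F]_d) (b : 'rV[F]_D) :
  (forall v, C v -> row_free (K v) /\ K v *m ev v Phi = 0) ->
  (k + \rank (ev v0 Phi))%N = D -> b *m ev v0 Phi = 0 ->
  exists Q : 'rV[{mpoly F[d]}]_D, ev v0 Q = b /\ forall v, C v -> (ev v Q <= K v)%MS.
Proof.
move=> KP rk bPhi; set rho := \rank (ev v0 Phi) in rk.
(* These constant matrices cut out of [Phi] a square block that is the identity at [v0]. *)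
pose R := pinvmx (col_base (ev v0 Phi)); pose S := pinvmx (row_base (ev v0 Phi)).
have RS : R *m ev v0 Phi *m S = 1%:M.
  transitivity (R *m (col_base (ev v0 Phi) *m row_base (ev v0 Phi)) *m S); first by rewrite mulmx_base.
  by rewrite mulmxA mulVpmx ?col_base_full // mul1mx mulmxVp ?row_base_free.
pose cst a c (A : 'M[F]_(a, c)) := map_mx (@mpolyC d F) A.
pose PS := Phi *m cst _ _ S; pose N := cst _ _ R *m PS.
pose kap := \det N *: cst _ _ b - cst _ _ b *m PS *m \adj N *m cst _ _ R.
have evPS v : ev v PS = ev v Phi *m S by rewrite evM ev_const.
have evN v : ev v N = R *m (ev v Phi *m S) by rewrite evM ev_const evPS.
(* The extra determinant makes the row zero, hence harmless, where the block [N] is singular. *)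
exists (\det N *: kap); split=> [|v Cv].
  rewrite evZ ev_det evN mulmxA RS det1 scale1r evB evZ ev_det evN mulmxA RS det1 scale1r ev_const.
  by rewrite !evM ev_const mulmxA bPhi !mul0mx subr0.
rewrite evZ ev_det; have [->|dN] := eqVneq (\det (ev v N)) 0; first by rewrite scale0r sub0mx.
apply: scalemx_sub; have [Kfree KPhi] := KP v Cv.
have kapE : ev v kap = \det (ev v N) *: b - b *m ev v PS *m \adj (ev v N) *m R.
  by rewrite evB evZ ev_det (evM v (_ *m _)) (evM v (_ *m PS)) (evM v _ PS) ev_adj !ev_const.
have kapPS : ev v kap *m (ev v Phi *m S) = 0.
  rewrite kapE mulmxBl -scalemxAl -(mulmxA _ R) -evN -(mulmxA _ (\adj _)) mul_adj_mx.
  by rewrite mul_mx_scalar evPS subrr.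
have rkPS : (rho <= \rank (ev v Phi *m S))%N.
  have unit : ev v N \in unitmx by rewrite unitmxE unitfE.
  by have := mxrankM_maxr R (ev v Phi *m S); rewrite -evN (mxrank_unit unit).
have Ksub : (K v <= kermx (ev v Phi *m S))%MS by apply/sub_kermxP; rewrite mulmxA KPhi mul0mx.
apply: (@submx_trans _ _ _ _ _ _ (kermx (ev v Phi *m S))); first exact/sub_kermxP.
have [le <-] := mxrank_leqif_sup Ksub; move: le rkPS rk.
rewrite mxrank_ker (eqP Kfree) => le r1 r2; rewrite eqn_leq le /=.
by apply: leq_trans (leq_sub2l _ r1) _; rewrite leq_subLR addnC r2.
Qed.

(** A line that is locally the kernel of a polynomial matrix has a polynomial generator by Cramer's
    rule; the factor [g] removes the points where the local description fails. *)
Lemma regline_kernel d D (C : set 'rV[F]_d) (l : 'rV[F]_d -> 'rV[F]_D) :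
  (forall v, C v -> l v != 0) ->
  (forall v (s : F), C v -> s != 0 -> exists c, l (s *: v) = c *: l v) ->
  (forall v0, C v0 -> exists E (Phi : 'M[{mpoly F[d]}]_(D, E)) (g : {mpoly F[d]}),
     g.@[v0 0] != 0 /\ forall v, C v -> g.@[v 0] != 0 ->
     forall x, x *m ev v Phi = 0 <-> exists c, x = c *: l v) ->
  regline C l.
Proof.
move=> l0 ls lP; split=> // v0 Cv0; have [E [Phi [g [g0 gP]]]] := lP v0 Cv0.
have rk : (1 + \rank (ev v0 Phi))%N = D.
  have kerE : (kermx (ev v0 Phi) :=: l v0)%MS.
    apply/eqmxP/andP; split; last by apply/sub_kermxP/(gP v0 Cv0 g0); exists 1; rewrite scale1r.
    apply/rV_subP => x /sub_kermxP/(gP v0 Cv0 g0)[c ->]; exact: scalemx_sub.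
  have := mxrank_ker (ev v0 Phi); rewrite kerE rank_rV (l0 v0 Cv0).
  by have := rank_leq_row (ev v0 Phi); lia.
have [||Q [Q0 QP]] := @cramer d 1 D E [set v | C v /\ g.@[v 0] != 0] Phi l v0 (l v0) _ rk _.
- move=> v [Cv gv]; split; first by rewrite /row_free rank_rV l0.
  by apply/(gP v Cv gv); exists 1; rewrite scale1r.
- by apply/(gP v0 Cv0 g0); exists 1; rewrite scale1r.
exists (g *: Q); split; first by rewrite evZ Q0 scaler_eq0 negb_or g0 l0.
move=> w Cw; rewrite evZ; have [->|gw] := eqVneq g.@[w 0] 0; first by exists 0; rewrite !scale0r.
have /QP/sub_rVP[c ->] : [set v | C v /\ g.@[v 0] != 0] w by [].
by exists (g.@[w 0] * c); rewrite scalerA.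
Qed.

End RegularLines.

(** * Linear algebra of two fibres *)

Section PairsOfFibres.
Variable F : closedFieldType.

(** No nonzero direction [b] on the base moves a nonzero point of the fibre inside the fibre: to
    first order, neighbouring fibres are disjoint. *)
Definition nondeg m d (A D1 D2 : 'M[F]_(m, d)) := forall (c : 'rV[F]_m) b1 b2,
  (c *m (b1 *: D1 + b2 *: D2) <= A)%MS -> c = 0 \/ (b1 = 0 /\ b2 = 0).

Lemma rank_mod a b d (U : 'M[F]_(a, d)) (B : 'M[F]_(b, d)) :
  \rank (B + U)%MS = (\rank B + \rank (U *m cokermx B))%N.
Proof.
have := mxrank_sum_cap U B; have := mxrank_mul_ker U (cokermx B).
have -> : \rank (U :&: kermx (cokermx B))%MS = \rank (U :&: B)%MS.
  have kB : (kermx (cokermx B) :=: B)%MS.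
    apply/eqmxP/andP; split; last by apply/sub_kermxP; rewrite mulmx_coker.
    by apply/rV_subP => u /sub_kermxP; rewrite submxE => ->.
  by rewrite (cap_eqmx (eqmx_refl _) kB).
rewrite (addsmxC B U) => h1 h2; apply/eqP.
by rewrite -(eqn_add2r (\rank (U :&: B)%MS)) h2 -addnA h1 addnC.
Qed.

Lemma rank_add_free m d (A E : 'M[F]_(m, d)) : row_free A ->
  (forall c : 'rV[F]_m, (c *m E <= A)%MS -> c = 0) -> \rank (A + E)%MS = (m + m)%N.
Proof.
move=> /eqP Afree h; rewrite rank_mod Afree; congr (_ + _)%N; apply/eqP.
rewrite -/(row_free _) -kermx_eq0; apply/negPn/negP => /rowV0Pn[c /sub_kermxP cE].
by rewrite (h c) ?eqxx // submxE -mulmxA cE.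
Qed.

(* Otherwise [D2] acts on [D1] modulo [A] through a square matrix, which has an eigenvector. *)
Lemma hopf_bound m d (A D1 D2 : 'M[F]_(m.+1, d)) : row_free A -> nondeg A D1 D2 ->
  ((m.+1 + m.+1).+1 <= \rank (A + D1 + D2)%MS)%N.
Proof.
move=> Afree nd; have rAD : \rank (A + D1)%MS = (m.+1 + m.+1)%N.
  apply: rank_add_free => // c cD; have [||[/eqP]] // := nd c 1 0; last by rewrite oner_eq0.
  by rewrite scale1r scale0r addr0.
rewrite ltnNge; apply/negP => le.
have sub : (D2 <= A + D1)%MS.
  apply: submx_trans (addsmxSr (A + D1)%MS D2) _.
  have [_ <-] := mxrank_leqif_sup (addsmxSl (A + D1)%MS D2).
  by rewrite eqn_leq mxrankS ?addsmxSl //= rAD.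
have /sub_addsmxP[[X Y] /= D2E] := sub.
have [l lroot] : exists l, root (char_poly Y) l.
  by apply/closed_rootP; rewrite size_char_poly.
have /eigenvalueP[c cY c0] : eigenvalue Y l by rewrite eigenvalue_root_char.
have h : (c *m (- l *: D1 + 1 *: D2) <= A)%MS.
  rewrite scale1r D2E mulmxDr mulmxDr scaleNr mulmxN -scalemxAr !mulmxA cY -scalemxAl.
  by rewrite addrCA addNr addr0 submxMl.
by have [/eqP|[_ /eqP]] := nd c _ _ h; rewrite ?(negPf c0) ?oner_eq0.
Qed.

Lemma rank1_sub e (u v : 'rV[F]_e) : (\rank (u + v)%MS <= 1)%N -> v != 0 -> (u <= v)%MS.
Proof.
move=> r v0; apply: submx_trans (addsmxSl u v) _.
have [_ <-] := mxrank_leqif_sup (addsmxSr u v).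
by rewrite eqn_leq mxrankS ?addsmxSr //= rank_rV v0.
Qed.

(** Fix x = c0 P1 nonzero and let P be P2 minus the multiple of P1 that agrees with it at c0. Where
    c P is nonzero, both c P1 and (c + c0) P1 are multiples of it, so x is one too. Hence P, and
    then P1, has its image in the line of x. *)
Lemma rank1_pencil m e (P1 P2 : 'M[F]_(m, e)) :
  (forall c : 'rV[F]_m, (\rank (c *m P1 + c *m P2)%MS <= 1)%N) ->
  (exists b1 b2, (b1, b2) != (0, 0) /\ b1 *: P1 + b2 *: P2 = 0) \/ (\rank (P1 + P2)%MS <= 1)%N.
Proof.
move=> r1; have [P10|P10] := eqVneq P1 0.
  left; exists 1, 0; rewrite P10 scaler0 scale0r addr0; split=> //.
  by rewrite xpair_eqE oner_eq0.
have [c0 c0P] : exists c0 : 'rV_m, c0 *m P1 != 0.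
  apply: contrapT => /forallNP h; case/eqP: P10; apply/row_matrixP => i; rewrite row0 rowE.
  by apply/eqP/negPn/negP; exact: h.
set x := c0 *m P1 in c0P; have /sub_rVP[l lE] : (c0 *m P2 <= x)%MS.
  by apply: rank1_sub c0P; rewrite addsmxC; exact: r1.
pose P := P2 - l *: P1; have c0P0 : c0 *m P = 0 by rewrite mulmxBr lE -scalemxAr subrr.
have dep (c : 'rV[F]_m) : c *m P != 0 -> (c *m P1 <= c *m P)%MS.
  move=> cP; apply: rank1_sub cP; apply: leq_trans (r1 c); apply: mxrankS.
  rewrite addsmx_sub addsmxSl /= /P mulmxBr -scalemxAr.
  by rewrite addmx_sub ?addsmxSr // eqmx_opp scalemx_sub ?addsmxSl.
have [P0|P0] := eqVneq P 0.
  left; exists (- l), 1; split; last by rewrite scale1r scaleNr addrC.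
  by rewrite xpair_eqE oner_eq0 andbF.
right; have [c1 c1P] : exists c1 : 'rV_m, c1 *m P != 0.
  apply: contrapT => /forallNP h; case/eqP: P0; apply/row_matrixP => i; rewrite row0 rowE.
  by apply/eqP/negPn/negP; exact: h.
have xsub (c : 'rV[F]_m) : c *m P != 0 -> (x <= c *m P)%MS.
  move=> cP; have h : ((c0 + c) *m P1 <= c *m P)%MS.
    by rewrite -[X in (_ <= X)%MS]add0r -c0P0 -mulmxDl; apply: dep; rewrite mulmxDl c0P0 add0r.
  by rewrite -(addrK (c *m P1) x) -mulmxDl addmx_sub // eqmx_opp dep.
have subx (c : 'rV[F]_m) : c *m P != 0 -> (c *m P <= x)%MS.
  move=> cP; have /sub_rVP[a xE] := xsub c cP.
  have a0 : a != 0 by apply: contra c0P => /eqP a0; rewrite xE a0 scale0r.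
  by apply/sub_rVP; exists a^-1; rewrite xE scalerA mulVf ?scale1r.
have P_sub (c : 'rV[F]_m) : (c *m P <= x)%MS by have [->|/subx//] := eqVneq (c *m P) 0; exact: sub0mx.
have P1_sub (c : 'rV[F]_m) : (c *m P1 <= x)%MS.
  have [cP|cP] := eqVneq (c *m P) 0; last exact: submx_trans (dep c cP) (subx c cP).
  have h : ((c + c1) *m P1 <= x)%MS.
    have nz : (c + c1) *m P != 0 by rewrite mulmxDl cP add0r.
    exact: submx_trans (dep _ nz) (subx _ nz).
  by rewrite -(addrK (c1 *m P1) (c *m P1)) -mulmxDl addmx_sub // eqmx_opp (submx_trans (dep _ c1P) (subx _ c1P)).
apply: (@leq_trans (\rank x)); last by rewrite rank_rV; case: (_ != 0).
apply: mxrankS; rewrite addsmx_sub; apply/andP; split; apply/row_subP => i; rewrite rowE //.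
have -> : P2 = P + l *: P1 by rewrite /P subrK.
by rewrite mulmxDr -scalemxAr addmx_sub ?scalemx_sub.
Qed.

Lemma det_perturb n (M0 M1 : 'M[F]_n) : \det M0 != 0 -> exists2 s, s != 0 & \det (M0 + s *: M1) != 0.
Proof.
move=> dM; pose p := \det (map_mx polyC M0 + 'X *: map_mx polyC M1).
have pE s : p.[s] = \det (M0 + s *: M1).
  rewrite /p -horner_evalE -det_map_mx; congr (\det _); apply/matrixP => i j.
  by rewrite !mxE /= horner_evalE !hornerE.
have p0 : p != 0 by apply: contra dM => /eqP p0; rewrite -[M0]addr0 -(scale0r M1) -pE p0 horner0.
by have [s] := poly_neq0_cofinite [:: 0] p0; rewrite inE pE => s0; exists s.
Qed.

(** A plane spanned by c P1, c P2 contains the whole primed pencil, which already has rank two, so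
    all such planes coincide. For other c, the vector c0 + s c again yields this plane for a
    suitable nonzero s. *)
Lemma rank2_pencils m m' e (P1 P2 : 'M[F]_(m, e)) (P1' P2' : 'M[F]_(m', e)) (c0 : 'rV[F]_m) :
  (forall (c : 'rV[F]_m) (c' : 'rV[F]_m'), (\rank (c *m P1 + c *m P2 + (c' *m P1' + c' *m P2'))%MS <= 2)%N) ->
  (1 < \rank (c0 *m P1 + c0 *m P2)%MS)%N -> (1 < \rank (P1' + P2')%MS)%N ->
  exists J : 'M[F]_e, [/\ (\rank J <= 2)%N, (P1 + P2 <= J)%MS & (P1' + P2' <= J)%MS].
Proof.
move=> r2 c0P P'; pose I (c : 'rV[F]_m) := (c *m P1 + c *m P2)%MS.
have P'I c : (1 < \rank (I c))%N -> (P1' + P2' <= I c)%MS.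
  move=> cP; suff h (c' : 'rV[F]_m') : (c' *m P1' + c' *m P2' <= I c)%MS.
    rewrite addsmx_sub; apply/andP; split; apply/row_subP => i; rewrite rowE.
      exact: submx_trans (addsmxSl _ _) (h (delta_mx 0 i)).
    exact: submx_trans (addsmxSr _ _) (h (delta_mx 0 i)).
  apply: submx_trans (addsmxSr (I c) _) _.
  have [_ <-] := mxrank_leqif_sup (addsmxSl (I c) (c' *m P1' + c' *m P2')%MS).
  by rewrite eqn_leq mxrankS ?addsmxSl //= (leq_trans (r2 c c')).
have II c : (1 < \rank (I c))%N -> (I c <= I c0)%MS.
  move=> cP; apply: submx_trans (P'I _ c0P); have [_ <-] := mxrank_leqif_sup (P'I c cP).
  rewrite eqn_leq mxrankS ?P'I //=; apply: leq_trans P'.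
  by apply: leq_trans (r2 c 0); apply: mxrankS; exact: addsmxSl.
have Isub c : (I c <= I c0)%MS.
  pose stack (c : 'rV[F]_m) := col_mx (c *m P1) (c *m P2).
  have IE c' : (I c' :=: stack c')%MS by exact: addsmxE.
  have free0 : row_free (stack c0) by rewrite /row_free eqn_leq rank_leq_row -IE.
  pose Z := pinvmx (stack c0).
  have d0 : \det (stack c0 *m Z) != 0 by rewrite mulmxVp // det1 oner_neq0.
  have [s s0 ds] := det_perturb (stack c *m Z) d0.
  pose c1 : 'rV[F]_m := c0 + s *: c; have big : (1 < \rank (I c1))%N.
    rewrite IE; apply: leq_trans (mxrankM_maxl _ Z).
    have -> : stack c1 *m Z = stack c0 *m Z + s *: (stack c *m Z).
      by rewrite scalemxAl -mulmxDl; congr (_ *m _); rewrite /stack /c1 scale_col_mx add_col_mx !mulmxDl -!scalemxAl.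
    by rewrite mxrank_unit // unitmxE unitfE.
  have sub := II _ big; rewrite /I /c1 !addsmx_sub !mulmxDl -!scalemxAl in sub *.
  have cE i : (i = P1 \/ i = P2) -> (c *m i <= c0 *m P1 + c0 *m P2)%MS.
    move=> iP; rewrite -[c *m i]scale1r -(mulVf s0) -scalerA scalemx_sub //.
    rewrite -(addKr (c0 *m i) (s *: (c *m i))) addmx_sub ?eqmx_opp //.
      by case: iP => ->; [exact: addsmxSl | exact: addsmxSr].
    by case/andP: sub => h1 h2; case: iP => ->.
  by rewrite !cE; [| right | left].
exists (I c0); split.
- by apply: leq_trans (r2 c0 0); apply: mxrankS; exact: addsmxSl.
- rewrite addsmx_sub; apply/andP; split; apply/row_subP => i; rewrite rowE.
    exact: submx_trans (addsmxSl _ _) (Isub (delta_mx 0 i)).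
  exact: submx_trans (addsmxSr _ _) (Isub (delta_mx 0 i)).
- exact: P'I.
Qed.

(** Work modulo A + A'. If both derivative pencils are large there, they share a plane by
    [rank2_pencils]. If one has total rank at most one, its osculating space exceeds A + A' by at
    most one dimension, and [hopf_bound] makes it equal to that sum, so it contains the other fibre.
    What remains is a vanishing member of the pencil. *)
Lemma pair_cases m d (A D1 D2 A' D1' D2' : 'M[F]_(m.+1, d)) :
  row_free A -> row_free A' -> (A :&: A' = 0)%MS -> nondeg A D1 D2 -> nondeg A' D1' D2' ->
  (forall c c' : 'rV[F]_m.+1, (\rank (A + A' + (c *m D1 + c *m D2 + (c' *m D1' + c' *m D2')))%MS <= (m.+1 + m.+1).+2)%N) ->
  [\/ exists b1 b2, (b1, b2) != (0, 0) /\ ((b1 *: D1 + b2 *: D2)%R <= A + A')%MS,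
      \rank (A + D1 + D2)%MS = (m.+1 + m.+1).+1 /\ (A' <= A + D1 + D2)%MS,
      \rank (A' + D1' + D2')%MS = (m.+1 + m.+1).+1 /\ (A <= A' + D1' + D2')%MS |
      exists H : 'M[F]_d, [/\ (\rank H <= (m.+1 + m.+1).+2)%N, (A + D1 + D2 <= H)%MS & (A' + D1' + D2' <= H)%MS]].
Proof.
move=> Afree A'free AA' nd nd' bound; pose B := (A + A')%MS.
  have [Q QE] : {Q | Q = cokermx B} by exists (cokermx B).
have rB : \rank B = (m.+1 + m.+1)%N.
  by have := mxrank_sum_cap A A'; rewrite AA' mxrank0 addn0 (eqP Afree) (eqP A'free).
have modE k (U : 'M[F]_(k, d)) : \rank (B + U)%MS = (m.+1 + m.+1 + \rank (U *m Q))%N by rewrite rank_mod rB QE.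
have sumQ (U1 U2 : 'M[F]_(m.+1, d)) : \rank ((U1 + U2)%MS *m Q) = \rank (U1 *m Q + U2 *m Q)%MS.
  by apply/eqmx_rank/eqmxP; exact: addsmxMr.
have r2 (c c' : 'rV[F]_m.+1) : (\rank (c *m (D1 *m Q) + c *m (D2 *m Q) + (c' *m (D1' *m Q) + c' *m (D2' *m Q)))%MS <= 2)%N.
  rewrite -(leq_add2l (m.+1 + m.+1)).
  have -> : \rank (c *m (D1 *m Q) + c *m (D2 *m Q) + (c' *m (D1' *m Q) + c' *m (D2' *m Q)))%MS =
      \rank ((c *m D1 + c *m D2 + (c' *m D1' + c' *m D2'))%MS *m Q).
    rewrite !mulmxA; apply/eqmx_rank/eqmxP; apply: eqmx_sym. apply: eqmx_trans (addsmxMr _ _ _) _.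
    by apply: adds_eqmx; exact: addsmxMr.
  by rewrite -modE; apply: leq_trans (bound c c') _; rewrite !addnS addn0.
have osc (X Y Z X' : 'M[F]_(m.+1, d)) : (X <= B)%MS -> (X' <= B)%MS ->
    row_free X -> nondeg X Y Z ->
    (\rank (Y *m Q + Z *m Q)%MS <= 1)%N -> \rank (X + Y + Z)%MS = (m.+1 + m.+1).+1 /\ (X' <= X + Y + Z)%MS.
  move=> XB X'B Xfree Xnd r1; have lb := hopf_bound Xfree Xnd.
  have sub : (X + Y + Z <= B + (Y + Z))%MS by rewrite -addsmxA; apply: addsmxS.
  have ub : (\rank (B + (Y + Z))%MS <= (m.+1 + m.+1).+1)%N by rewrite modE sumQ; move: r1; clear; lia.
  have rE : \rank (X + Y + Z)%MS = (m.+1 + m.+1).+1.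
    by apply/eqP; rewrite eqn_leq lb andbT; apply: leq_trans ub; exact: mxrankS.
  split=> //; apply: submx_trans (submx_trans X'B (addsmxSl B (Y + Z)%MS)) _.
  by have [_ <-] := mxrank_leqif_sup sub; rewrite eqn_leq mxrankS //= rE.
have oscA := osc A D1 D2 A' (addsmxSl _ _) (addsmxSr _ _) Afree nd.
have oscA' := osc A' D1' D2' A (addsmxSr _ _) (addsmxSl _ _) A'free nd'.
have [[c0 c0P]|noc] := pselect (exists c : 'rV[F]_m.+1, (1 < \rank (c *m (D1 *m Q) + c *m (D2 *m Q))%MS)%N).
  have [r1|r1] := leqP (\rank (D1' *m Q + D2' *m Q)%MS) 1; first by constructor 3; exact: oscA'.
  have [J [rJ J1 J2]] := rank2_pencils r2 c0P r1; constructor 4.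
  exists (B + (D1 + D2 + (D1' + D2')))%MS; split.
  - rewrite modE; apply: (@leq_trans (m.+1 + m.+1 + 2)); last by rewrite addn2.
    rewrite leq_add2l.
    apply: leq_trans rJ; apply: mxrankS.
    apply: submx_trans (_ : ((D1 *m Q + D2 *m Q) + (D1' *m Q + D2' *m Q) <= J)%MS); last first.
      by rewrite addsmx_sub J1 J2.
    have h k (X Y : 'M[F]_(k, d)) : ((X + Y)%MS *m Q <= X *m Q + Y *m Q)%MS by rewrite (addsmxMr X Y Q).
    by rewrite addsmxMr; apply: addsmxS; exact: h.
  - by rewrite -addsmxA; apply: addsmxS; [exact: addsmxSl | exact: addsmxSl].
  - by rewrite -addsmxA; apply: addsmxS; [exact: addsmxSr | exact: addsmxSr].
have [|[b1 [b2 [b0 bP]]]|r1] := @rank1_pencil m.+1 d (D1 *m Q) (D2 *m Q).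
- by move=> c; rewrite leqNgt; apply/negP => h; apply: noc; exists c.
- constructor 1; exists b1, b2; split=> //.
  by rewrite submxE -/B -QE mulmxDl -!scalemxAl bP.
- by constructor 2; exact: oscA.
Qed.

End PairsOfFibres.

(** * Tangent fields and scrolls *)

Section TangentFields.
Variable F : closedFieldType.

Lemma vspace_matrix d (T : {vspace 'rV[F]_d}) :
  exists U : 'M[F]_(\dim T, d), row_free U /\ forall u, u \in T <-> (u <= U)%MS.
Proof.
pose U := \matrix_(i < \dim T) (vbasis T)`_i.
exists U; split; last first.
  move=> u; split=> [uT|/submxP[c ->]]; last first.
    rewrite mulmx_sum_row; apply: rpred_sum => i _; rewrite rowK; apply: rpredZ.
    by apply: vbasis_mem; rewrite mem_nth // size_tuple.
  rewrite (coord_vbasis uT); apply: summx_sub => i _; apply: scalemx_sub.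
  by rewrite -[X in (X <= _)%MS](rowK (fun i : 'I_(\dim T) => (vbasis T)`_i) i) row_sub.
apply: row_free_ker => c; rewrite mulmx_sum_row => h.
apply/rowP => i; rewrite mxE; have /freeP := basis_free (vbasisP T).
apply=> //; rewrite -[RHS]h; apply: eq_bigr => j _; rewrite rowK //.
Qed.

Lemma tang_basis d (A : set (Proj F d)) : zclosed A -> nonsingular A ->
  forall v : 'rV[F]_d, cone A v -> exists U : 'M[F]_((krull_dim A).+1, d),
    row_free U /\ forall u, tang (cone A) v u <-> (u <= U)%MS.
Proof.
move=> Acl ns v [p Ap vp]; have [T [dT TP]] := ns p v Ap vp.
have memT u : u \in T <-> tang (cone A) v u.
  rewrite TP; split=> h f.
    move=> fA; rewrite (hc_sum f) dif_sum big1 // => k _.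
    by apply: (h _ k (hc_homog k f)) => q w Aq wq; apply: (vanish_hc (val k) fA); exists q.
  by move=> k fk fA; apply: h => w [q Aq wq]; exact: fA wq.
have [U [Ufree UE]] := vspace_matrix T.
case: _ / dT U UE Ufree => U UE Ufree; exists U; split=> // u.
by rewrite -memT UE.
Qed.

(** Choose finitely many polynomials of the ideal whose gradients at [v0] have maximal rank;
    adjoining one more gradient does not shrink the kernel there. *)
Lemma grad_matrix d (C : set 'rV[F]_d) (v0 : 'rV[F]_d) :
  exists E (Phi : 'M[{mpoly F[d]}]_(d, E)),
    (forall v u : 'rV[F]_d, tang C v u -> u *m ev v Phi = 0) /\
    forall u : 'rV[F]_d, u *m ev v0 Phi = 0 -> tang C v0 u.
Proof.
pose gm n (f : 'I_n -> {mpoly F[d]}) : 'M[{mpoly F[d]}]_(d, n) := \matrix_(i, j) (f j)^`M(i).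
have evgm n (f : 'I_n -> {mpoly F[d]}) v u j : (u *m ev v (gm n f)) 0 j = dif (f j) v u.
  by rewrite mxE; apply: eq_bigr => i _; rewrite !mxE mulrC.
pose P r := `[< exists n (f : 'I_n -> {mpoly F[d]}), (forall j, vanish C (f j)) /\ \rank (ev v0 (gm n f)) = r >].
have P0 : exists r, P r.
  by exists 0%N; apply/asboolP; exists 0%N, (fun=> 0); split=> [[]//|]; apply/eqP; rewrite -leqn0 rank_leq_col.
have Pb r : P r -> (r <= d)%N by move=> /asboolP[n [f [_ <-]]]; exact: rank_leq_row.
have [r /asboolP[n [f [fC rf]]] rmax] := ex_maxnP P0 Pb.
exists n, (gm n f); split=> [v u vu|u u0 g gC].
  by apply/rowP => j; rewrite evgm mxE vu.
pose f' (j : 'I_(1 + n)) := if split j is inr k then f k else g.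
have f'E : gm _ f' = row_mx (gm _ (fun _ : 'I_1 => g)) (gm _ f).
  apply/matrixP => i j; rewrite !mxE /f'; case: split => k; by rewrite !mxE.
have sub : (kermx (ev v0 (gm n f)) <= kermx (ev v0 (gm _ f')))%MS.
  have rr : (\rank (ev v0 (gm _ f')) <= \rank (ev v0 (gm n f)))%N.
    rewrite rf; apply: rmax; apply/asboolP; exists (1 + n)%N, f'; split=> // j.
    by rewrite /f'; case: split.
  have le : (kermx (ev v0 (gm _ f')) <= kermx (ev v0 (gm n f)))%MS.
    apply/sub_kermxP; have := mulmx_ker (ev v0 (gm _ f')); rewrite f'E ev_row_mx mul_mx_row => h.
    by rewrite -[LHS](row_mxKr (kermx (row_mx (ev v0 (gm _ (fun _ : 'I_1 => g))) (ev v0 (gm n f))) *m ev v0 (gm _ (fun _ : 'I_1 => g)))) h -row_mx0 row_mxKr.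
  have [_ <-] := mxrank_leqif_sup le; rewrite eqn_leq mxrankS //= !mxrank_ker leq_sub2l //.
have : u *m ev v0 (gm _ f') = 0 by apply/sub_kermxP/(submx_trans _ sub)/sub_kermxP.
by move/rowP/(_ (lshift n 0)); rewrite evgm /f' mxE (unsplitK (inl _)).
Qed.

(** Tangent spaces of constant dimension are kernels of constant rank, so Cramer's rule extends a
    tangent vector to a polynomial field. *)
Lemma tang_field d k (C : set 'rV[F]_d) (K : 'rV[F]_d -> 'M[F]_(k, d)) :
  (forall v, C v -> row_free (K v) /\ forall u, tang C v u <-> (u <= K v)%MS) ->
  forall v0 b, C v0 -> tang C v0 b ->
  exists Q : 'rV[{mpoly F[d]}]_d, ev v0 Q = b /\ forall v, C v -> tang C v (ev v Q).
Proof.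
move=> KP v0 b Cv0 tb; have [E [Phi [Phi1 Phi0]]] := grad_matrix C v0.
have KPhi v : C v -> K v *m ev v Phi = 0.
  move=> Cv; apply/row_matrixP => i; rewrite row_mul row0; apply: Phi1.
  by apply/(KP v Cv).2; exact: row_sub.
have rk : (k + \rank (ev v0 Phi))%N = d.
  have [Kfree KE] := KP v0 Cv0.
  have kerE : (kermx (ev v0 Phi) :=: K v0)%MS.
    apply/eqmxP/andP; split; last by apply/sub_kermxP/KPhi.
    by apply/rV_subP => x /sub_kermxP/Phi0/KE.
  have := mxrank_ker (ev v0 Phi); rewrite kerE (eqP Kfree).
  by have := rank_leq_row (ev v0 Phi); lia.
have [||Q [Q0 QP]] := @cramer F d k d E C Phi K v0 b _ rk _.
- by move=> v Cv; split; [have [] := KP v Cv | exact: KPhi].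
- exact: Phi1.
by exists Q; split=> // v Cv; apply/(KP v Cv).2; exact: QP.
Qed.

Lemma tang_local d (C : set 'rV[F]_d) (f G : {mpoly F[d]}) (v u : 'rV[F]_d) : tang C v u ->
  f.@[v 0] = 0 -> G.@[v 0] != 0 -> (forall w, C w -> G.@[w 0] != 0 -> f.@[w 0] = 0) -> dif f v u = 0.
Proof.
move=> t fv Gv h; have : dif (f * G) v u = 0.
  apply: t => w Cw; rewrite mevalM; have [->|/(h w Cw)->] := eqVneq G.@[w 0] 0; by rewrite ?mulr0 ?mul0r.
by rewrite difM fv mul0r addr0 => /eqP; rewrite mulf_eq0 (negPf Gv) orbF => /eqP.
Qed.

End TangentFields.

(** * From projective bundles to scrolls of affine cones *)

Section ScrollData.
Variable F : closedFieldType.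

Lemma ev_mxvec d a b (v : 'rV[F]_d) (A : 'M[{mpoly F[d]}]_(a, b)) : ev v (mxvec A) = mxvec (ev v A).
Proof. by rewrite /ev map_mxvec. Qed.

Lemma ev_trmx d a b (v : 'rV[F]_d) (A : 'M[{mpoly F[d]}]_(a, b)) : ev v A^T = (ev v A)^T.
Proof. by rewrite /ev map_trmx. Qed.

Lemma outerE d e (u : 'rV[F]_d) (q : 'rV[F]_e) i j : (u^T *m q) i j = u 0 i * q 0 j.
Proof. by rewrite mxE big_ord1 mxE. Qed.

Lemma outer_prop d e (u u' : 'rV[F]_d) (q q' : 'rV[F]_e) : u != 0 -> q != 0 ->
  u^T *m q = u'^T *m q' -> exists2 c, c != 0 & u = c *: u'.
Proof.
move=> u0 /rV0Pn[j qj] E; have uE : u = (q' 0 j / q 0 j) *: u'.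
  apply/rowP => i; rewrite mxE; have /matrixP/(_ i j) := E; rewrite !mxE !big_ord1 !mxE => h.
  by apply: (mulIf qj); rewrite h; field.
exists (q' 0 j / q 0 j) => //; apply: contra u0 => /eqP c0; by rewrite uE c0 scale0r.
Qed.

Lemma wedge_sub d (u v : 'rV[F]_d) : v != 0 -> (forall i j, u 0 i * v 0 j = u 0 j * v 0 i) -> (u <= v)%MS.
Proof.
move=> /rV0Pn[j vj] h; apply/sub_rVP; exists (u 0 j / v 0 j); apply/rowP => i; rewrite mxE.
by apply: (mulIf vj); rewrite h; field.
Qed.

Lemma zopen_poly d (U : set (Proj F d)) p (v : 'rV[F]_d) : zopen U -> U p -> coords v p ->
  exists2 h : {mpoly F[d]}, h.@[v 0] != 0 & forall q w, coords w q -> h.@[w 0] != 0 -> U q.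
Proof.
move=> /zclosedP Uo Up vp; have [|h hU hv] := Uo p v _ vp; first by move=> /(_ Up).
exists h => // q w wq hw; apply: contrapT => nU; case/eqP: hw; apply: hU; by exists q.
Qed.

Lemma regular_rep d e (A : set (Proj F d)) (B : set (Proj F e)) f p (v : 'rV[F]_d) :
  regular_map A B f -> A p -> coords v p -> exists (Q : 'rV[{mpoly F[d]}]_e) (g : {mpoly F[d]}),
    g.@[v 0] != 0 /\ forall q w, A q -> coords w q -> g.@[w 0] != 0 -> coords (ev w Q) (f q).
Proof.
move=> [_ /(_ p) freg] Ap vp; have [U [k [Q [Uo Up _ QP]]]] := freg Ap.
have [h hv hU] := zopen_poly Uo Up vp; exists (\row_j Q j), h; split=> // q w Aq wq hw.
have := QP q w Aq (hU q w wq hw) wq; congr (coords _ _).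
by apply/rowP => j; rewrite !mxE.
Qed.

(** The row [P] gives coordinates of the projection to the base near [x0], valid where [g] is
    nonzero. *)
Definition local_proj d e (CX : set 'rV[F]_d) (CW : set 'rV[F]_e) (L : 'rV[F]_e -> 'M[F]_d)
    (x0 : 'rV[F]_d) (g : {mpoly F[d]}) (P : 'rV[{mpoly F[d]}]_e) :=
  g.@[x0 0] != 0 /\ forall x, CX x -> g.@[x 0] != 0 -> CW (ev x P) /\ (x <= L (ev x P))%MS.

(* A scroll [X -> W] in terms of the affine cones [CX], [CW]: the fibre over [w] is P(row space of [L w]). *)
Record scroll d e (CX : set 'rV[F]_d) (CW : set 'rV[F]_e) (L : 'rV[F]_e -> 'M[F]_d) : Prop := Scroll {
  scroll_fibre : forall (w : 'rV[F]_e) (x : 'rV[F]_d), CW w -> x != 0 -> (x <= L w)%MS -> CX x;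
  scroll_cover : forall x, CX x -> exists2 w, CW w & (x <= L w)%MS;
  scroll_fibre0 : forall w, CW w -> L w != 0;
  scroll_disjoint : forall (w w' : 'rV[F]_e) (x : 'rV[F]_d), CW w -> CW w' -> x != 0 -> (x <= L w)%MS -> (x <= L w')%MS ->
    exists2 c : F, c != 0 & w' = c *: w;
  scroll_scale : forall w (c : F), CW w -> c != 0 -> (L (c *: w) :=: L w)%MS;
  scroll_proj : forall x, CX x -> exists g P, local_proj CX CW L x g P;
  scroll_section : forall (w : 'rV[F]_e) (x : 'rV[F]_d), CW w -> x != 0 -> (x <= L w)%MS ->
    exists (g : {mpoly F[e]}) (S : 'rV[{mpoly F[e]}]_d), [/\ g.@[w 0] != 0, exists2 c : F, c != 0 & ev w S = c *: x &
      forall w', CW w' -> g.@[w' 0] != 0 -> ev w' S != 0 /\ (ev w' S <= L w')%MS];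
  scroll_vertical : forall (x v : 'rV[F]_d) g P (c : F), CX x -> local_proj CX CW L x g P -> tang CX x v ->
    dmx x v P = c *: ev x P -> (v <= L (ev x P))%MS
}.

Section FromBundle.
Variables (d e r : nat) (X : set (Proj F d)) (W : set (Proj F e)) (E : vector_bundle W r)
  (pi : Proj F d -> Proj F e).
Hypothesis bundle : projective_bundle X E pi.
Hypothesis linear_fibres : forall w, W w -> linear_subspace (X `&` pi @^-1` [set w]).

Definition over (x : 'rV[F]_d) (w : 'rV[F]_e) := exists p, [/\ X p, coords x p & coords w (pi p)].

Lemma over_fibre : exists L : 'rV[F]_e -> 'M[F]_d, forall w, cone W w ->
  forall x, over x w <-> x != 0 /\ (x <= L w)%MS.
Proof.
have h (w : 'rV[F]_e) : exists L : 'M[F]_d, cone W w -> forall x, over x w <-> x != 0 /\ (x <= L)%MS.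
  have [[q Wq wq]|nW] := pselect (cone W w); last by exists 0.
  have [T TE] := linear_fibres Wq; have [U [_ UT]] := vspace_matrix T; exists (<<U>>%MS) => _ x.
  rewrite genmxE -UT; split=> [[p [Xp xp wp]]|[x0 xT]].
    split; first exact: coords_neq0 xp.
    have : (X `&` pi @^-1` [set q]) p by split=> //=; exact: coords_inj wp wq.
    by rewrite TE /= xp -memvE.
  have [p xp] := coords_ex x0; have : [set p | (val p <= T)%VS] p by rewrite /= xp -memvE.
  by rewrite -TE => -[Xp /= pq]; exists p; split=> //; rewrite pq.
by have [L LP] := choice h; exists L.
Qed.

Lemma over_prop x w w' : over x w -> over x w' -> exists2 c, c != 0 & w' = c *: w.
Proof.
move=> [p [_ xp wp]] [p' [_ xp' wp']]; rewrite -(coords_inj xp xp') in wp'.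
exact: coords_prop wp wp'.
Qed.

Lemma over_scale x w c : over x w -> c != 0 -> over x (c *: w).
Proof. by move=> [p [Xp xp wp]] c0; exists p; split=> //; exact: coords_scale. Qed.

Lemma over_cone x w : over x w -> cone X x /\ cone W w.
Proof.
by move=> [p [Xp xp wp]]; split; [exists p | exists (pi p) => //; apply: bundle.1.1].
Qed.

(** In a chart, keep the fibre coordinate [q] of the point and let the base point vary. *)
Lemma over_section w x : over x w -> exists (g : {mpoly F[e]}) (S : 'rV[{mpoly F[e]}]_d),
  [/\ g.@[w 0] != 0, exists2 c : F, c != 0 & ev w S = c *: x &
   forall w', cone W w' -> g.@[w' 0] != 0 -> over (ev w' S) w'].
Proof.
move=> [p [Xp xp wp]]; have [[piW pireg] [psi [iso _]]] := bundle.
have [i _ Ui] := vb_cover E (piW p Xp); have [freg [h [hreg hf fh]]] := iso i.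
pose q := vpick (val (psi i p)); have qp : coords q (psi i p) := vpick_coords _.
have Bz w1 (z1 : Proj F r) : W w1 -> vb_chart i w1 -> prod_set (W `&` vb_chart i) setT (segre w1 z1).
  by move=> Ww Uw; exists w1, z1.
have zp : coords (mxvec (w^T *m q)) (segre (pi p) (psi i p)) by exact: segreP.
have [Q [g [gz QP]]] := regular_rep hreg (Bz _ _ (piW p Xp) Ui) zp.
have [u uw uU] := zopen_poly (vb_open i) Ui wp.
pose M : 'rV[{mpoly F[e]}]_(e * r) := mxvec ((varmx F e)^T *m map_mx (@mpolyC e F) q).
have evM' w1 : ev w1 M = mxvec (w1^T *m q) by rewrite ev_mxvec evM ev_trmx ev_const ev_varmx.
exists (u * cmp M g), (cmpmx M Q); split.
- by rewrite mevalM mulf_neq0 // ev_cmp evM'.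
- rewrite ev_cmpmx evM'; have := QP _ _ (Bz _ _ (piW p Xp) Ui) zp gz.
  by rewrite hf // => cp; exact: coords_prop xp cp.
move=> w' [p' Wp' wp']; rewrite mevalM mulf_eq0 negb_or ev_cmp evM' => /andP[uw' gw'].
have Up' := uU p' w' wp' uw'; have zp' := segreP wp' qp.
have Bz' := Bz p' (psi i p) Wp' Up'; have := QP _ _ Bz' zp' gw'.
rewrite ev_cmpmx evM' => cp; have [Xh Uh] := hreg.1 _ Bz'; exists (h (segre p' (psi i p))).
split=> //; have /= fhE := fh _ Bz'.
have [a ap] : exists a, coords a (pi (h (segre p' (psi i p)))) by eexists; exact: vpick_coords.
have [b bp] : exists b, coords b (psi i (h (segre p' (psi i p)))) by eexists; exact: vpick_coords.
have := segreP ap bp; rewrite fhE => abp; have [c c0 cE] := coords_prop abp zp'.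
have {}cE : (w')^T *m q = (c *: a)^T *m b.
  by apply: (can_inj mxvecK); rewrite cE [(c *: a)^T]linearZ /= -scalemxAl linearZ.
have [c' c'0 ->] := outer_prop (coords_neq0 wp') (coords_neq0 qp) cE.
by rewrite scalerA; apply: coords_scale => //; rewrite mulf_neq0.
Qed.

(** In a trivialisation a vector killed by the differential of the projection moves only the fibre
    coordinate, hence is the derivative of a curve inside the linear fibre. *)
Lemma over_vertical (L : 'rV[F]_e -> 'M[F]_d) (x v : 'rV[F]_d) g P (c : F) :
  (forall w, cone W w -> forall x, over x w <-> x != 0 /\ (x <= L w)%MS) ->
  cone X x -> local_proj (cone X) (cone W) L x g P -> tang (cone X) x v ->
  dmx x v P = c *: ev x P -> (v <= L (ev x P))%MS.
Proof.
move=> LP Cx [gx gP] tv dP; have [p Xp xp] := Cx; set w := ev x P in dP *.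
have gover y : cone X y -> g.@[y 0] != 0 -> over y (ev y P).
  by move=> Cy gy; have [Cw yL] := gP y Cy gy; apply/LP => //; split=> //; exact: cone_neq0 Cy.
have Cw : cone W w by have [] := gP x Cx gx.
have wp : coords w (pi p).
  by have [p' [_ xp' wp']] := gover x Cx gx; rewrite (coords_inj xp xp').
have [[piW _] [psi [iso _]]] := bundle.
have [i _ Ui] := vb_cover E (piW p Xp); have [freg [h [hreg hf fh]]] := iso i.
have Ap : (X `&` pi @^-1` vb_chart i) p by [].
have [Phi [g1 [g1x PhiP]]] := regular_rep freg Ap xp.
have [u uw uU] := zopen_poly (vb_open i) Ui wp.
have zp := PhiP p x Ap xp g1x; set z := ev x Phi in zp.
have [Psi [g2 [g2z PsiP]]] := regular_rep hreg (freg.1 p Ap) zp.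
pose G := g1 * cmp Phi g2 * g * cmp P u.
have Gx : G.@[x 0] != 0 by rewrite /G !mevalM !mulf_neq0 // ev_cmp.
have GP y : cone X y -> G.@[y 0] != 0 -> exists q,
    [/\ coords y q, coords (ev y P) (pi q), coords (ev y Phi) (segre (pi q) (psi i q)) & coords (ev (ev y Phi) Psi) q].
  move=> Cy; rewrite /G !mevalM !ev_cmp !mulf_eq0 !negb_or => /andP[/andP[/andP[g1y g2y] gy] uy].
  have [q [Xq yq Pq]] := gover y Cy gy; have Aq : (X `&` pi @^-1` vb_chart i) q.
    by split=> //; exact: uU uy.
  have Phiq := PhiP q y Aq yq g1y; exists q; split=> //.
  by have := PsiP _ _ (freg.1 q Aq) Phiq g2y; rewrite hf.
have [mu mu0 zx] : exists2 mu, mu != 0 & ev z Psi = mu *: x.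
  by have [q [xq _ _ zq]] := GP x Cx Gx; exact: coords_prop xq zq.
have [q0 q0p] : exists q, coords q (psi i p) by eexists; exact: vpick_coords.
have [q q_neq0 zE] : exists2 q : 'rV[F]_r, q != 0 & z = mxvec (w^T *m q).
  have [s0 s00 zE] := coords_prop (segreP wp q0p) zp; exists (s0 *: q0).
    by rewrite scaler_eq0 negb_or s00 (coords_neq0 q0p).
  by rewrite [LHS]zE -scalemxAr linearZ.
pose Pm := vec_mx Phi; have PmE : ev x Pm = w^T *m q by rewrite /Pm /ev map_vec_mx -/(ev x Phi) -/z zE mxvecK.
(* The first factor of the chart is proportional to [P], which is stationary modulo [w]; so the
   derivative keeps the factor [w]. *)
pose z' := dmx x v Phi; have [q' z'E] : exists q', z' = mxvec (w^T *m q').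
  have [k wk] := rV0Pn _ (coords_neq0 wp).
  have rel a b : dif (Pm a b * P 0 k - Pm k b * P 0 a) x v = 0.
    apply: (tang_local tv _ Gx); first by rewrite mevalB !mevalM -!evE PmE !mxE !big_ord1 !mxE; ring.
    move=> y Cy /(GP y Cy)[y' [_ wy zy _]].
    have [b0 b0p] : exists b0, coords b0 (psi i y') by eexists; exact: vpick_coords.
    have [s _ yE] := coords_prop (segreP wy b0p) zy.
    have evPm : ev y Pm = s *: ((ev y P)^T *m b0) by rewrite /Pm /ev map_vec_mx -/(ev y Phi) yE linearZ /= mxvecK.
    by rewrite mevalB !mevalM -!evE evPm !mxE !big_ord1 !mxE; ring.
  have dPk a : dif (P 0 a) x v = c * w 0 a by have /rowP/(_ a) := dP; rewrite !mxE.
  exists (\row_b (vec_mx z' k b / w 0 k)); rewrite -[LHS]vec_mxK; congr mxvec; apply/matrixP => a b.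
  have PmV a' : (Pm a' b).@[x 0] = w 0 a' * q 0 b by rewrite -evE PmE outerE.
  have dE a' : dif (Pm a' b) x v = vec_mx z' a' b by rewrite /z' /Pm !mxE.
  have := rel a b; rewrite difB !difM !dPk !PmV !dE -!evE -/w => rel0.
  rewrite outerE [X in _ = _ * X]mxE; apply: (mulIf wk); rewrite -mulrA divfK //.
  by apply/eqP; rewrite -subr_eq0 -[X in _ == X]rel0; apply/eqP; ring.
(* The line z + s z' = w ⊗ (q + s q') stays over [w], and [Psi] carries it into [L w]. *)
have yL : (dmx z z' Psi <= L w)%MS.
  have [j qj] := rV0Pn _ q_neq0; pose K := cokermx (L w).
  have evK t : ev t (Psi *m map_mx (@mpolyC _ F) K) = ev t Psi *m K by rewrite evM ev_const.
  have PsiL t : (ev t Psi *m K == 0) = (ev t Psi <= L w)%MS by rewrite -submxE.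
  have zL : ev z Psi *m K = 0.
    by apply/eqP; rewrite PsiL zx; apply: scalemx_sub; have [] := gP x Cx gx.
  rewrite submxE; apply/eqP/rowP => k; rewrite [RHS]mxE.
  pose f := (Psi *m map_mx (@mpolyC _ F) K) 0 k.
  have df : dif f z z' = (dmx z z' Psi *m K) 0 k.
    by have /rowP/(_ k) := dmxM z z' Psi (map_mx (@mpolyC _ F) K); rewrite dmx_const mulmx0 addr0 ev_const mxE => <-.
  have fz : f.@[z 0] = 0 by rewrite -evE evK zL mxE.
  have : dif (g2 * f) z z' = 0.
    apply: (@dif_along_line _ _ _ _ _ [:: - (q 0 j / q' 0 j)]) => s; rewrite inE => sj.
    have lE : z + s *: z' = mxvec (w^T *m (q + s *: q')).
      by rewrite mulmxDr -scalemxAr zE z'E; apply: (can_inj vec_mxK); rewrite mxvecK linearD /= linearZ /= !mxvecK.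
    have qs : q + s *: q' != 0.
      apply: contra sj => /eqP/rowP/(_ j); rewrite !mxE => hj; have q'j : q' 0 j != 0.
        by apply: contra qj => /eqP q'j; rewrite -hj q'j mulr0 addr0.
      by apply/eqP; apply: (mulIf q'j); rewrite mulNr divfK //; apply/eqP; rewrite -addr_eq0 addrC hj.
    have [a ap] := coords_ex qs; have Bz : prod_set (W `&` vb_chart i) setT (segre (pi p) a).
      by exists (pi p), a; split=> //; split=> //; exact: piW.
    have zs := segreP wp ap; rewrite -lE in zs; rewrite mevalM.
    have [->|g2s] := eqVneq g2.@[(z + s *: z') 0] 0; first by rewrite mul0r.
    have hp := PsiP _ _ Bz zs g2s; have [Xh Uh] := hreg.1 _ Bz; have /= fhE := fh _ Bz.
    suff ov : over (ev (z + s *: z') Psi) w.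
      have /LP[//|_] := ov; rewrite submxE => /eqP/rowP/(_ k) hk.
      by rewrite -evE evK hk mxE mulr0.
    exists (h (segre (pi p) a)); split=> //.
    have [b bp] : exists b, coords b (pi (h (segre (pi p) a))) by eexists; exact: vpick_coords.
    have [b' b'p] : exists b', coords b' (psi i (h (segre (pi p) a))) by eexists; exact: vpick_coords.
    have := segreP bp b'p; rewrite fhE => bbp; have [t t0 tE] := coords_prop bbp zs.
    have {}tE : w^T *m (q + s *: q') = (t *: b)^T *m b'.
      by apply: (can_inj mxvecK); rewrite -lE tE [(t *: b)^T]linearZ /= -scalemxAl linearZ.
    have [c' c'0 ->] := outer_prop (coords_neq0 wp) qs tE.
    by rewrite scalerA; apply: coords_scale => //; rewrite mulf_neq0.
  by rewrite difM fz mulr0 add0r df => /eqP; rewrite mulf_eq0 (negPf g2z) => /eqP.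
(* On X the composite is proportional to the identity, so its derivative along [v] is [mu *: v]
   modulo [x]. *)
pose Th := cmpmx Phi Psi; have dTh a : dif (Th 0 a) x v = dmx z z' Psi 0 a.
  by have /rowP/(_ a) := dmx_cmpmx Phi Psi x v; rewrite mxE => ->.
have ThV a (y : 'rV[F]_d) : (Th 0 a).@[y 0] = ev (ev y Phi) Psi 0 a by rewrite -evE ev_cmpmx.
have rel a b : dif (Th 0 a * 'X_b - Th 0 b * 'X_a) x v = 0.
  apply: (tang_local tv _ Gx); first by rewrite mevalB !mevalM !mevalXU !ThV -/z zx !mxE; ring.
  move=> y Cy /(GP y Cy)[y' [yp' _ _ /(coords_prop yp')[s _ yE]]].
  by rewrite mevalB !mevalM !mevalXU !ThV yE !mxE; ring.
have x0 := coords_neq0 xp; have sub : (dmx z z' Psi - mu *: v <= x)%MS.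
  apply: wedge_sub => // a b; have := rel a b.
  rewrite difB !difM !difX !dTh !mevalXU !ThV -/z zx; move: (dmx z z' Psi) => y {rel} rel.
  rewrite !mxE in rel *; apply/eqP; rewrite -subr_eq0 -[X in _ == X]rel; apply/eqP; ring.
have -> : v = mu^-1 *: (dmx z z' Psi - (dmx z z' Psi - mu *: v)) by rewrite subKr scalerA mulVf ?scale1r.
apply/scalemx_sub/addmx_sub => //; rewrite eqmx_opp; apply: submx_trans sub _.
by have [] := gP x Cx gx.
Qed.

Lemma over_surj w : X !=set0 -> cone W w -> exists x, over x w.
Proof.
move=> [p0 Xp0] [p Wp wp]; have [_ [psi [iso _]]] := bundle.
have [i0 _ Ui0] := vb_cover E (bundle.1.1 p0 Xp0); have [i _ Ui] := vb_cover E Wp.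
have [freg [h [hreg hf fh]]] := iso i; pose a := psi i0 p0.
have Bz : prod_set (W `&` vb_chart i) setT (segre p a) by exists p, a.
have [Xh Uh] := hreg.1 _ Bz; have /= fhE := fh _ Bz; set q := h (segre p a) in Xh Uh fhE.
exists (vpick (val q)), q; split=> //; first exact: vpick_coords.
have bp := vpick_coords (pi q); have b'p := vpick_coords (psi i q); have ap := vpick_coords a.
have := segreP bp b'p; rewrite fhE => bbp; have [t t0 tE] := coords_prop bbp (segreP wp ap).
have {}tE : w^T *m vpick (val a) = (t *: vpick (val (pi q)))^T *m vpick (val (psi i q)).
  by apply: (can_inj mxvecK); rewrite tE [(t *: _)^T]linearZ /= -scalemxAl linearZ.
have [c' c'0 ->] := outer_prop (coords_neq0 wp) (coords_neq0 ap) tE.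
by rewrite scalerA; apply: coords_scale => //; rewrite mulf_neq0.
Qed.

Lemma scroll_of_bundle : X !=set0 -> exists L, scroll (cone X) (cone W) L.
Proof.
move=> Xne; have [L LP] := over_fibre; exists L; split.
- by move=> w x Cw x0 xL; have /over_cone[] : over x w by exact/LP.
- move=> x [p Xp xp]; have ox : over x (vpick (val (pi p))) by exists p; split=> //; exact: vpick_coords.
  have [_ Cw] := over_cone ox; exists (vpick (val (pi p))) => //.
  by have /LP[] := ox.
- move=> w Cw; have [x /LP[//|x0 xL]] := over_surj Xne Cw.
  by apply: contra x0 => /eqP L0; move: xL; rewrite L0 submx0.
- move=> w w' x Cw Cw' x0 xL xL'; apply: (@over_prop x); exact/LP.
- move=> w c Cw c0; have Ccw := cone_scale Cw c0.
  apply/eqmxP/andP; split; apply/rV_subP => x xL; have [->|x0] := eqVneq x 0; rewrite ?sub0mx //.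
    have ox : over x (c *: w) by exact/LP.
    have := over_scale ox (invr_neq0 c0); rewrite scalerA mulVf // scale1r.
    by case/LP.
  have /over_scale/(_ c0) : over x w by exact/LP.
  by case/LP.
- move=> x [p Xp xp]; have [P [g [gx gP]]] := regular_rep bundle.1 Xp xp.
  exists g, P; split=> // y [q Xq yq] gy; have oy : over y (ev y P) by exists q; split=> //; exact: gP.
  by have [_ Cw] := over_cone oy; split=> //; case/LP: oy.
- move=> w x Cw x0 xL; have ox : over x w by exact/LP.
  have [g [S [gw Sx gS]]] := over_section ox; exists g, S; split=> // w' Cw' gw'.
  by have /LP[] := gS w' Cw' gw'.
- by move=> x v g P c Cx; exact: over_vertical.
Qed.

End FromBundle.
End ScrollData.

(** * Local frames of the fibres and tangent spaces of the scroll *)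

Section LocalFrames.
Variable F : closedFieldType.

Lemma line_avoid0 d (x y : 'rV[F]_d) : x != 0 -> exists bad : seq F, forall t, t \notin bad -> x + t *: y != 0.
Proof.
move=> /rV0Pn[j xj]; exists [:: - (x 0 j / y 0 j)] => t; rewrite inE; apply: contra => /eqP/rowP/(_ j).
rewrite !mxE => h; have yj : y 0 j != 0 by apply: contra xj => /eqP yj; rewrite -h yj mulr0 addr0.
by apply/eqP; apply: (mulIf yj); rewrite mulNr divfK //; apply/eqP; rewrite -addr_eq0 addrC h.
Qed.

Lemma tangD d (C : set 'rV[F]_d) (v u u' : 'rV[F]_d) a : tang C v u -> tang C v u' -> tang C v (u + a *: u').
Proof. by move=> t t' f fC; rewrite difDr difZr t // t' // mulr0 addr0. Qed.

Lemma tang_euler d (C : set 'rV[F]_d) (v : 'rV[F]_d) : (forall s, s != 0 -> C (s *: v)) -> tang C v v.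
Proof.
move=> h f fC; apply: (@dif_along_line _ _ _ _ _ [:: -1]) => s; rewrite inE => s1; apply: (fC).
rewrite -[X in X + _]scale1r -scalerDl; apply: h; rewrite addrC; by rewrite addr_eq0.
Qed.

Lemma tang_scale d (C : set 'rV[F]_d) (v u : 'rV[F]_d) s : (forall s v, C v -> s != 0 -> C (s *: v)) -> s != 0 ->
  tang C (s *: v) u -> tang C v u.
Proof.
move=> Cs s0 t f fC; pose M := linmap (s^-1%:M : 'M[F]_d).
have evM' w : ev w M = s^-1 *: w by rewrite ev_linmap mul_mx_scalar.
have : dif (cmp M f) (s *: v) u = 0.
  by apply: t => w Cw; rewrite ev_cmp evM'; apply: fC; apply: Cs => //; rewrite invr_eq0.
rewrite dif_cmp evM' dmx_linmap mul_mx_scalar scalerA mulVf // scale1r difZr => /eqP.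
by rewrite mulf_eq0 invr_eq0 (negPf s0) => /eqP.
Qed.

Lemma row_free_open d k e (M : 'M[{mpoly F[d]}]_(k, e)) (v0 : 'rV[F]_d) : row_free (ev v0 M) ->
  exists2 g : {mpoly F[d]}, g.@[v0 0] != 0 & forall v : 'rV[F]_d, g.@[v 0] != 0 -> row_free (ev v M).
Proof.
move=> fr; pose Z := pinvmx (ev v0 M); pose cZ := map_mx (@mpolyC d F) Z.
have gE (v : 'rV[F]_d) : (\det (M *m cZ)).@[v 0] = \det (ev v M *m Z) by rewrite ev_det evM ev_const.
exists (\det (M *m cZ)) => [|v]; first by rewrite gE mulmxVp // det1 oner_eq0.
rewrite gE => dv; apply/row_freeP; exists (Z *m invmx (ev v M *m Z)).
by rewrite mulmxA mulmxV // unitmxE unitfE.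
Qed.

Lemma row_free3P e (x y z : 'rV[F]_e) : row_free (col_mx (col_mx x y) z) <->
  forall a b c, a *: x + b *: y + c *: z = 0 -> [/\ a = 0, b = 0 & c = 0].
Proof.
have mulE a b c : row_mx (row_mx a%:M b%:M) c%:M *m col_mx (col_mx x y) z = a *: x + b *: y + c *: z.
  by rewrite !mul_row_col !mul_scalar_mx.
split=> [fr a b c h|h].
  have : row_mx (row_mx (a%:M : 'M[F]_1) (b%:M : 'M[F]_1)) (c%:M : 'M[F]_1) = 0.
    by apply: (row_free_inj fr); rewrite mul0mx mulE.
  have sc0 (t : F) : (t%:M : 'M[F]_1) = 0 -> t = 0 by move=> /matrixP/(_ 0 0); rewrite !mxE.
  by rewrite -[X in _ = X]row_mx0 => /eq_row_mx[]; rewrite -[X in _ = X]row_mx0 => /eq_row_mx[/sc0-> /sc0->] /sc0->.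
apply: row_free_ker => a; rewrite -(hsubmxK a) -(hsubmxK (lsubmx a)).
move: (lsubmx (lsubmx a)) (rsubmx (lsubmx a)) (rsubmx a) => a1 a2 a3.
rewrite (mx11_scalar a1) (mx11_scalar a2) (mx11_scalar a3) mulE => /h[-> -> ->].
by rewrite !raddf0 !row_mx0.
Qed.

Variables (d e n1 : nat) (CX : set 'rV[F]_d) (CW : set 'rV[F]_e) (L : 'rV[F]_e -> 'M[F]_d).
Variables (KW : 'rV[F]_e -> 'M[F]_(3, e)) (KX : 'rV[F]_d -> 'M[F]_(n1, d)).
Hypothesis S : scroll CX CW L.
Hypothesis CW0 : forall w, CW w -> w != 0.
Hypothesis CWs : forall s w, CW w -> s != 0 -> CW (s *: w).
Hypothesis KWP : forall w, CW w -> row_free (KW w) /\ forall u, tang CW w u <-> (u <= KW w)%MS.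
Hypothesis KXP : forall x, CX x -> row_free (KX x) /\ forall u, tang CX x u <-> (u <= KX x)%MS.

Lemma section_frame w0 : CW w0 ->
  exists (g : {mpoly F[e]}) (E : 'M[{mpoly F[e]}]_(\rank (L w0), d)), [/\ g.@[w0 0] != 0, (ev w0 E :=: L w0)%MS &
    forall w, CW w -> g.@[w 0] != 0 -> row_free (ev w E) /\ (ev w E <= L w)%MS].
Proof.
move=> Cw0; pose B := row_base (L w0).
have Bi i : row i B != 0.
  have := row_base_free (L w0); apply: contraTneq => Bi0; rewrite -kermx_eq0; apply/rowV0Pn.
  exists (delta_mx 0 i); last by apply/rV0Pn; exists i; rewrite mxE !eqxx oner_eq0.
  by apply/sub_kermxP; rewrite -rowE.
have BL i : (row i B <= L w0)%MS by apply: submx_trans (row_sub _ _) _; rewrite eq_row_base.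
have h i : exists gS : {mpoly F[e]} * 'rV[{mpoly F[e]}]_d, [/\ gS.1.@[w0 0] != 0, exists2 c : F, c != 0 & ev w0 gS.2 = c *: row i B &
      forall w', CW w' -> gS.1.@[w' 0] != 0 -> (ev w' gS.2 <= L w')%MS].
  have [g [s [g0 sE gP]]] := scroll_section S Cw0 (Bi i) (BL i); exists (g, s); split=> // w' Cw' gw'.
  by have [] := gP w' Cw' gw'.
have [gS gSP] := choice h; pose E := \matrix_i (gS i).2.
have rowE' w i : row i (ev w E) = ev w (gS i).2 by apply/rowP => j; rewrite !mxE.
have EL : (ev w0 E :=: L w0)%MS.
  apply: eqmx_trans (eq_row_base (L w0)); apply/eqmxP/andP; split; apply/row_subP => i.
    have [_ [c _ cE] _] := gSP i; rewrite rowE' cE; apply/scalemx_sub/row_sub.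
  have [_ [c c0 cE] _] := gSP i; rewrite -/B -[row i B]scale1r -(mulVf c0) -scalerA -cE -rowE'.
  exact/scalemx_sub/row_sub.
have [g gw0 gfree] : exists2 g : {mpoly F[e]}, g.@[w0 0] != 0 & forall w : 'rV[F]_e, g.@[w 0] != 0 -> row_free (ev w E).
  by apply: row_free_open; rewrite /row_free EL.
exists (g * \prod_i (gS i).1), E; split=> // [|w Cw].
  rewrite mevalM mulf_neq0 // rmorph_prod /=; apply/prodf_neq0 => i _; by have [] := gSP i.
rewrite mevalM mulf_eq0 negb_or rmorph_prod /= => /andP[gw /prodf_neq0 gi]; split; first exact: gfree.
by apply/row_subP => i; rewrite rowE'; have [_ _ /(_ w Cw (gi i isT))] := gSP i.
Qed.

Lemma tangent_frame w0 : CW w0 -> exists (g : {mpoly F[e]}) (u1 u2 : 'rV[{mpoly F[e]}]_e), g.@[w0 0] != 0 /\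
  forall w, CW w -> g.@[w 0] != 0 -> [/\ tang CW w (ev w u1), tang CW w (ev w u2),
    (forall b1 b2, ((b1 *: ev w u1 + b2 *: ev w u2)%R <= w)%MS -> b1 = 0 /\ b2 = 0) &
    forall u, tang CW w u -> exists b1 b2, ((u - (b1 *: ev w u1 + b2 *: ev w u2))%R <= w)%MS].
Proof.
move=> Cw0; have [Kfree KE] := KWP Cw0.
have w0K : (w0 <= KW w0)%MS by apply/KE/tang_euler => s s0; exact: CWs.
have pick k (U : 'M[F]_(k, e)) : (\rank U < 3)%N -> exists2 b : 'rV_e, (b <= KW w0)%MS & ~~ (b <= U)%MS.
  move=> rU; have /row_subPn[i Ki] : ~~ (KW w0 <= U)%MS.
    by apply: contraL rU => /mxrankS; rewrite (eqP Kfree) -leqNgt.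
  by exists (row i (KW w0)) => //; exact: row_sub.
have [|b1 b1K b1w] := pick _ w0; first by rewrite rank_rV; case: (_ != 0).
have [|b2 b2K b2w] := pick _ (col_mx w0 b1); first exact: rank_leq_row.
have [u1 [u1E u1P]] := @tang_field F e 3 CW KW KWP w0 b1 Cw0 ((KE _).2 b1K).
have [u2 [u2E u2P]] := @tang_field F e 3 CW KW KWP w0 b2 Cw0 ((KE _).2 b2K).
pose M := col_mx (col_mx (varmx F e) u1) u2.
have evM' w : ev w M = col_mx (col_mx w (ev w u1)) (ev w u2) by rewrite !ev_col_mx ev_varmx.
have [|g gw0 gP] := @row_free_open e _ e M w0.
  rewrite evM' u1E u2E; apply/row_free3P => a b c h.
  have c0 : c = 0.
    apply: contraNeq b2w => c0; rewrite -[b2]scale1r -(mulVf c0) -scalerA scalemx_sub //.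
    rewrite -(addKr (a *: w0 + b *: b1) (c *: b2)) h addr0 eqmx_opp -addsmxE.
    by apply: addmx_sub_adds; exact: scalemx_sub.
  rewrite c0 scale0r addr0 in h; have b0 : b = 0.
    apply: contraNeq b1w => b0; rewrite -[b1]scale1r -(mulVf b0) -scalerA scalemx_sub //.
    by rewrite -(addKr (a *: w0) (b *: b1)) h addr0 eqmx_opp scalemx_sub.
  move/eqP: h; rewrite b0 scale0r addr0 scaler_eq0 (negPf (CW0 Cw0)) orbF => /eqP.
  by [].
exists g, u1, u2; split=> // w Cw gw; split; try exact: u1P; try exact: u2P.
- move=> c1 c2 /sub_rVP[c cE]; have := gP w gw; rewrite evM' => /row_free3P/(_ (- c) c1 c2)[].
    by rewrite -addrA cE scaleNr addNr.
  by [].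
- move=> u /(KWP Cw).2 uK; have MK : (ev w M <= KW w)%MS.
    rewrite evM' !col_mx_sub; apply/andP; split; first (apply/andP; split).
    + by apply/(KWP Cw).2/tang_euler => s s0; exact: CWs.
    + by apply/(KWP Cw).2; exact: u1P.
    + by apply/(KWP Cw).2; exact: u2P.
  have KM : (KW w <= ev w M)%MS.
    by have [_ <-] := mxrank_leqif_sup MK; rewrite (eqP (gP w gw)) (eqP (KWP Cw).1).
  have /submxP[a ->] := submx_trans uK KM; rewrite evM' -(hsubmxK a) -(hsubmxK (lsubmx a)).
  move: (lsubmx (lsubmx a)) (rsubmx (lsubmx a)) (rsubmx a) => a1 a2 a3.
  rewrite (mx11_scalar a1) (mx11_scalar a2) (mx11_scalar a3) !mul_row_col !mul_scalar_mx.
  by exists (a2 0 0), (a3 0 0); rewrite -[X in (X - _)%R]addrA addrK scalemx_sub.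
Qed.

(* Along the section [c *m E] of the bundle the projection differentiates the identity [P (c *m E w) ~ w]. *)
Lemma frame_raw w0 : CW w0 -> exists (g : {mpoly F[e]}) (E D1 D2 : 'M[{mpoly F[e]}]_(\rank (L w0), d)),
  [/\ g.@[w0 0] != 0, (ev w0 E :=: L w0)%MS & forall w, CW w -> g.@[w 0] != 0 ->
   [/\ row_free (ev w E), (ev w E <= L w)%MS,
     forall (c : 'rV[F]_(\rank (L w0))) b1 b2, c != 0 ->
       (c *m (b1 *: ev w D1 + b2 *: ev w D2) <= L w)%MS -> b1 = 0 /\ b2 = 0 &
     forall (c : 'rV[F]_(\rank (L w0))) u, c != 0 ->
       tang CX (c *m ev w E) u <-> (u <= L w + c *m ev w D1 + c *m ev w D2)%MS]].
Proof.
move=> Cw0; have [g1 [E [g1w EL EP]]] := section_frame Cw0.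
have [g2 [u1 [u2 [g2w uP]]]] := tangent_frame Cw0.
(* The derivative of the frame along the vector field [u]. *)
pose D (u : 'rV[{mpoly F[e]}]_e) : 'M[{mpoly F[e]}]_(\rank (L w0), d) := \matrix_(i, j) \sum_k (E i j)^`M(k) * u 0 k.
have DE w u : ev w (D u) = dmx w (ev w u) E.
  by apply/matrixP => i j; rewrite !mxE rmorph_sum /=; apply: eq_bigr => k _; rewrite mevalM !mxE.
exists (g1 * g2), E, (D u1), (D u2); split=> //; first by rewrite mevalM mulf_neq0.
move=> w Cw; rewrite mevalM mulf_eq0 negb_or => /andP[g1n g2n]; have [Efree EL'] := EP w Cw g1n.
have [tu1 tu2 ufree uspan] := uP w Cw g2n; rewrite !DE.
pose cst (c : 'rV[F]_(\rank (L w0))) : 'rV[{mpoly F[e]}]_d := map_mx (@mpolyC e F) c *m E.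
have ev_cst c w' : ev w' (cst c) = c *m ev w' E by rewrite evM ev_const.
have d_cst c u : dmx w u (cst c) = c *m dmx w u E by rewrite dmxM dmx_const mul0mx add0r ev_const.
have cE0 (c : 'rV[F]_(\rank (L w0))) w' : CW w' -> g1.@[w' 0] != 0 -> c != 0 -> c *m ev w' E != 0 /\ (c *m ev w' E <= L w')%MS.
  move=> Cw' gw' c0; have [fr sub] := EP w' Cw' gw'; split; last exact: submx_trans (submxMl _ _) sub.
  by apply: contra c0 => /eqP h; apply/eqP; apply: (row_free_inj fr); rewrite h mul0mx.
have cEX (c : 'rV[F]_(\rank (L w0))) w' : CW w' -> g1.@[w' 0] != 0 -> c != 0 -> CX (c *m ev w' E).
  by move=> Cw' gw' c0; have [h1 h2] := cE0 c w' Cw' gw' c0; refine (scroll_fibre S Cw' h1 h2).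
have tangD_ (c : 'rV[F]_(\rank (L w0))) u : c != 0 -> tang CW w u -> tang CX (c *m ev w E) (c *m dmx w u E).
  move=> c0 tu f fX; have : dif (cmp (cst c) f) w u = 0.
    apply: (tang_local tu _ g1n) => [|w' Cw' gw']; rewrite ev_cmp ev_cst; apply: fX; exact: cEX.
  by rewrite dif_cmp ev_cst d_cst.
have tangL (c : 'rV[F]_(\rank (L w0))) y : c != 0 -> (y <= L w)%MS -> tang CX (c *m ev w E) y.
  move=> c0 yL f fX; have [x0 xL] := cE0 c w Cw g1n c0; have [bad badP] := line_avoid0 y x0.
  apply: (dif_along_line (s := bad)) => t tb; apply: (fX); apply: (scroll_fibre S Cw (badP t tb)).
  by rewrite addmx_sub ?scalemx_sub.
(* Modulo [w], the differential of [P] sends the derivative of c E along [u] to [lam *: u] and kills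
   the fibre. *)
have main (c : 'rV[F]_(\rank (L w0))) : c != 0 -> exists g P lam, [/\ local_proj CX CW L (c *m ev w E) g P, lam != 0,
    ev (c *m ev w E) P = lam *: w, forall u, tang CW w u -> ((dmx (c *m ev w E) (c *m dmx w u E) P - lam *: u)%R <= w)%MS &
    forall y, (y <= L w)%MS -> (dmx (c *m ev w E) y P <= w)%MS].
  move=> c0; have [x0 xL] := cE0 c w Cw g1n c0; have Cx := cEX c w Cw g1n c0.
  set x := c *m ev w E in x0 xL Cx *; have [g [P lP]] := scroll_proj S Cx.
  have [Cp xp] := lP.2 x Cx lP.1; have [lam lam0 PE] := scroll_disjoint S Cw Cp x0 xL xp.
  have w_neq0 := CW0 Cw; exists g, P, lam; split=> // [u tu|y yL]; apply: wedge_sub => // i j.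
    have gw : (g1 * cmp (cst c) g).@[w 0] != 0 by rewrite mevalM mulf_neq0 // ev_cmp ev_cst; exact: lP.1.
    have : dif (cmp (cst c) (P 0 i) * 'X_j - cmp (cst c) (P 0 j) * 'X_i) w u = 0.
      apply: (tang_local tu _ gw).
        by rewrite mevalB !mevalM !mevalXU !ev_cmp !ev_cst -!evE -/x PE !mxE; ring.
      move=> w' Cw'; rewrite mevalM mulf_eq0 negb_or ev_cmp ev_cst => /andP[g1w' gw'].
      have [x1 x1L] := cE0 c w' Cw' g1w' c0; have [Cp' xp'] := lP.2 _ (cEX c w' Cw' g1w' c0) gw'.
      have [lam' _ PE'] := scroll_disjoint S Cw' Cp' x1 x1L xp'.
      by rewrite mevalB !mevalM !mevalXU !ev_cmp !ev_cst -!evE PE' !mxE; ring.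
    rewrite difB !difM !difX !mevalXU !ev_cmp !dif_cmp !ev_cst !d_cst -!evE -/x PE => rel.
    by rewrite !mxE in rel *; apply/eqP; rewrite -subr_eq0 -[X in _ == X]rel; apply/eqP; ring.
  have [bad badP] := line_avoid0 y x0.
  have : dif (g * (P 0 i * (w 0 j)%:MP - P 0 j * (w 0 i)%:MP)) x y = 0.
    apply: (dif_along_line (s := bad)) => t tb; have x1 := badP t tb.
    have x1L : ((x + t *: y)%R <= L w)%MS by rewrite addmx_sub ?scalemx_sub.
    have Cx1 : CX (x + t *: y) by refine (scroll_fibre S Cw x1 x1L).
    rewrite mevalM; have [->|gt] := eqVneq g.@[(x + t *: y) 0] 0; first by rewrite mul0r.
    have [Cp' xp'] := lP.2 _ Cx1 gt; have [lam' _ PE'] := scroll_disjoint S Cw Cp' x1 x1L xp'.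
    by rewrite mevalB !mevalM !mevalC -!evE PE' !mxE; ring.
  rewrite difM difB !difM !difC mevalB !mevalM !mevalC -!evE PE => rel.
  have gx := lP.1; apply: (mulfI gx); rewrite !mxE in rel *.
  by apply/eqP; rewrite -subr_eq0 -[X in _ == X]rel; apply/eqP; ring.
split=> // [c b1 b2 c0 cb|c v c0].
  have [g [P [lam [_ lam0 _ du dL]]]] := main c c0.
  pose u := b1 *: ev w u1 + b2 *: ev w u2; have tu : tang CW w u.
    by move=> f fC; rewrite difDr !difZr tu1 // tu2 // !mulr0 addr0.
  have uE : dmx w u E = b1 *: dmx w (ev w u1) E + b2 *: dmx w (ev w u2) E.
    by apply/matrixP => i j; rewrite !mxE difDr !difZr.
  rewrite -uE in cb; apply: ufree; rewrite -/u -[u]scale1r -(mulVf lam0) -scalerA scalemx_sub //.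
  by rewrite -(subKr (dmx (c *m ev w E) (c *m dmx w u E) P) (lam *: u)) addmx_sub ?eqmx_opp ?dL ?du.
split; last first.
  move=> /sub_addsmxP[[y1 y2] /= ->]; have /sub_addsmxP[[z1 z2] /= ->] := submxMl y1 (L w + c *m dmx w (ev w u1) E)%MS.
  rewrite (mx11_scalar y2) (mx11_scalar z2) !mul_scalar_mx.
  by apply: tangD; [apply: tangD; [exact: tangL (submxMl _ _) |] |]; exact: tangD_.
move=> tv; have [g [P [lam [lP lam0 PE du dL]]]] := main c c0; set x := c *m ev w E in lP PE du dL tv.
have Cx : CX x by exact: cEX.
have tP : tang CW w (dmx x v P).
  apply: (@tang_scale _ _ _ _ lam) => // f fW; have : dif (cmp P f) x v = 0.
    apply: (tang_local tv _ lP.1) => [|y Cy gy]; rewrite ev_cmp; last by apply: fW; have [] := lP.2 y Cy gy.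
    by apply: fW; rewrite PE; exact: CWs.
  by rewrite dif_cmp PE.
have [b1 [b2 bE]] := uspan _ tP.
(* A combination of frame derivatives with the same image on the base as [v]; the difference is
   vertical, hence in the fibre. *)
pose v1 := lam^-1 *: (b1 *: (c *m dmx w (ev w u1) E) + b2 *: (c *m dmx w (ev w u2) E)).
have tv1 : tang CX x v1.
  by move=> f fX; rewrite /v1 difZr difDr !difZr !tangD_ // !mulr0 addr0 mulr0.
have dlin a (u u' : 'rV[F]_d) : dmx x (u + a *: u') P = dmx x u P + a *: dmx x u' P.
  by apply/matrixP => i j; rewrite !mxE difDr difZr.
have vL : (v - v1 <= L w)%MS.
  have sub : (dmx x (v - v1) P <= w)%MS.
    have -> : dmx x (v - v1) P = dmx x v P - lam^-1 *: (b1 *: dmx x (c *m dmx w (ev w u1) E) P + b2 *: dmx x (c *m dmx w (ev w u2) E) P).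
      by apply/matrixP => i j; rewrite !mxE -scaleN1r difDr !difZr difDr !difZr; ring.
    have -> : dmx x v P = dmx x v P - (b1 *: ev w u1 + b2 *: ev w u2) + lam^-1 *: (b1 *: (lam *: ev w u1) + b2 *: (lam *: ev w u2)).
      by rewrite !scalerA !(mulrC _ lam) -!scalerA -scalerDr scalerA mulVf // scale1r subrK.
    rewrite -addrA -scalerBr addmx_sub // scalemx_sub //.
    rewrite opprD addrACA -!scalerBr addmx_sub // scalemx_sub // -opprB eqmx_opp; exact: du.
  have [wL Lw] : (L w <= L (ev x P))%MS /\ (L (ev x P) <= L w)%MS by rewrite PE !(scroll_scale S Cw lam0).
  apply: submx_trans _ Lw; have /sub_rVP[a aE] := sub.
  apply: (@scroll_vertical _ _ _ _ _ _ S x (v - v1) g P (a / lam)) => //.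
    by rewrite -scaleN1r; apply: tangD.
  by rewrite aE PE scalerA divfK.
have -> : v = (v - v1) + v1 by rewrite subrK.
rewrite -addsmxA addmx_sub_adds // /v1 scalemx_sub // addmx_sub_adds // scalemx_sub //.
Qed.

(** The tangent space of the cone at a point of the fibre is the fibre plus two independent
    directions. *)
Lemma fibre_rank w : CW w -> (\rank (L w)).+2 = n1.
Proof.
move=> Cw; have [g [E [D1 [D2 [gw EL /(_ w Cw gw)[Efree _ nd tE]]]]]] := frame_raw Cw.
have s0 : (0 < \rank (L w))%N by rewrite lt0n mxrank_eq0; refine (scroll_fibre0 S Cw).
pose c : 'rV[F]_(\rank (L w)) := delta_mx 0 (Ordinal s0).
have c0 : c != 0 by apply/rV0Pn; exists (Ordinal s0); rewrite mxE !eqxx oner_eq0.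
have x0 : c *m ev w E != 0.
  by apply: contra c0 => /eqP h; apply/eqP; apply: (row_free_inj Efree); rewrite h mul0mx.
have Cx : CX (c *m ev w E) by apply: (scroll_fibre S Cw x0); rewrite -EL submxMl.
have [Kfree KE] := KXP Cx; pose U := col_mx (c *m ev w D1) (c *m ev w D2).
have KU : (KX (c *m ev w E) :=: L w + U)%MS.
  apply/eqmxP/andP; split; apply/rV_subP => u.
    by move/KE/tE => /(_ c0); rewrite -addsmxA => h; apply: submx_trans h _; rewrite addsmxS // addsmxE.
  by move=> uU; apply/KE/tE => //; rewrite -addsmxA; apply: submx_trans uU _; rewrite addsmxS // addsmxE.
rewrite -(eqP Kfree) KU rank_mod -addn2; congr (_ + _)%N; apply/esym/eqP.
rewrite -/(row_free _); apply: row_free_ker => a; rewrite mulmxA => aU.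
have : (a *m U <= L w)%MS by rewrite submxE aU.
rewrite -(hsubmxK a) mul_row_col (mx11_scalar (lsubmx a)) (mx11_scalar (rsubmx a)) !mul_scalar_mx.
rewrite !scalemxAr -mulmxDr => /(nd c _ _ c0)[-> ->].
by rewrite raddf0 row_mx0.
Qed.

Lemma local_frame m w0 : n1 = m.+2 -> CW w0 ->
  exists (g : {mpoly F[e]}) (E D1 D2 : 'M[{mpoly F[e]}]_(m, d)), g.@[w0 0] != 0 /\ forall w, CW w -> g.@[w 0] != 0 ->
   [/\ row_free (ev w E), (ev w E :=: L w)%MS, nondeg (ev w E) (ev w D1) (ev w D2) &
     forall (c : 'rV[F]_m) u, c != 0 ->
       tang CX (c *m ev w E) u <-> (u <= ev w E + c *m ev w D1 + c *m ev w D2)%MS].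
Proof.
move=> n1E Cw0; have rk w : CW w -> \rank (L w) = m by move=> /fibre_rank; rewrite n1E => -[].
have := frame_raw Cw0; rewrite (rk w0 Cw0) => -[g [E [D1 [D2 [gw _ h]]]]].
exists g, E, D1, D2; split=> // w Cw gwn; have [Efree sub nd tE] := h w Cw gwn.
have EL : (ev w E :=: L w)%MS.
  by apply/eqmxP; rewrite -(geq_leqif (mxrank_leqif_eq sub)) (eqP Efree) rk.
split=> // [c b1 b2|c u c0].
  by rewrite EL => hc; have [|c0] := eqVneq c 0; [left | right; exact: nd c0 hc].
by rewrite (tE c u c0) -!addsmxA (adds_eqmx EL (eqmx_refl _)).
Qed.

End LocalFrames.

(** * The secant variety *)

Section SecantVariety.
Variable F : closedFieldType.
Hypothesis charF : [pchar F] =i pred0.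

Definition sums d (C : set 'rV[F]_d) : set 'rV[F]_d :=
  [set z | exists v v', [/\ C v, C v' & z = v + v']].

(** Polynomial in each argument separately: enough to argue on C x C as on an irreducible set. *)
Definition sep_poly d (f : 'rV[F]_d -> 'rV[F]_d -> F) :=
  (forall v', exists p : {mpoly F[d]}, forall v : 'rV[F]_d, p.@[v 0] = f v v') /\
  (forall v, exists p : {mpoly F[d]}, forall v' : 'rV[F]_d, p.@[v' 0] = f v v').

Lemma sep_poly_nonvanish d (C : set 'rV[F]_d) f g a a' b b' : irr C -> sep_poly f -> sep_poly g ->
  C a -> C a' -> C b -> C b' -> f a a' != 0 -> g b b' != 0 ->
  exists v v', [/\ C v, C v', f v v' != 0 & g v v' != 0].
Proof.
move=> iC [f1 f2] [g1 g2] Ca Ca' Cb Cb' fa gb.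
have [p pE] := f1 a'; have [q qE] := g1 b'.
have [||v Cv [pv qv]] := irr_nonvanish iC (f := p) (g := q).
- by apply/not_vanishP; exists a; rewrite ?pE.
- by apply/not_vanishP; exists b; rewrite ?qE.
have [p' p'E] := f2 v; have [q' q'E] := g2 v.
have [||v' Cv' [pv' qv']] := irr_nonvanish iC (f := p') (g := q').
- by apply/not_vanishP; exists a'; rewrite // p'E -pE.
- by apply/not_vanishP; exists b'; rewrite // q'E -qE.
by exists v, v'; split; rewrite // -?p'E -?q'E.
Qed.

Lemma ev_shift d (v v' : 'rV[F]_d) (f : {mpoly F[d]}) :
  (cmp (varmx F d + map_mx (@mpolyC d F) v') f).@[v 0] = f.@[(v + v') 0].
Proof. by rewrite ev_cmp evD ev_varmx ev_const. Qed.

Lemma sep_poly_sum d (f : {mpoly F[d]}) : sep_poly (fun v v' => f.@[(v + v') 0]).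
Proof.
split=> v; exists (cmp (varmx F d + map_mx (@mpolyC d F) v) f) => v'; rewrite ev_shift //.
by rewrite addrC.
Qed.

Lemma irr_sums d (C : set 'rV[F]_d) : irr C -> irr (sums C).
Proof.
move=> iC; have [_ C1 _] := iC; split.
- split=> [v _|f g hf hg v Cv|a f hf v Cv]; first by rewrite meval0.
    by rewrite mevalD hf // hg // addr0.
  by rewrite mevalM hf // mulr0.
- move=> h; apply: C1 => v Cv; have := h (v + v); rewrite !meval1; apply; by exists v, v.
move=> f g fg; apply: contrapT => /not_orP[/not_vanishP[_ [a [a' [Ca Ca' ->]]] fa]].
move=> /not_vanishP[_ [b [b' [Cb Cb' ->]]] gb].
have [v [v' [Cv Cv' fv gv]]] :=
  sep_poly_nonvanish iC (sep_poly_sum f) (sep_poly_sum g) Ca Ca' Cb Cb' fa gb.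
have /eqP := fg (v + v') (ex_intro _ v (ex_intro _ v' (And3 Cv Cv' erefl))).
by rewrite mevalM mulf_eq0 (negPf fv) (negPf gv).
Qed.

Lemma tang_sums d (C : set 'rV[F]_d) (v v' u : 'rV[F]_d) : C v' -> tang C v u -> tang (sums C) (v + v') u.
Proof.
move=> Cv' tu f fS; have : dif (cmp (varmx F d + map_mx (@mpolyC d F) v') f) v u = 0.
  by apply: tu => w Cw; rewrite ev_shift; apply: fS; exists w, v'.
rewrite dif_cmp evD ev_varmx ev_const; congr (dif _ _ _ = _).
by apply/rowP => j; rewrite !mxE difD difX difC addr0.
Qed.

(** This is the inclusion half of Terracini's lemma: both tangent spaces are tangent to [sums C] at
    v + v'. A pair of too large rank would, after extending bases to polynomial fields, give the
    same rank at a general pair, where the tangent dimension of [sums C] bounds it. *)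
Lemma sum_tangent_bound d k n (C : set 'rV[F]_d) (K : 'rV[F]_d -> 'M[F]_(k, d)) : irr C ->
  (forall v, C v -> row_free (K v) /\ forall u, tang C v u <-> (u <= K v)%MS) ->
  (forall t (Y : 'M[F]_(d, t)), algind (sums C) Y -> (t <= n)%N) ->
  forall v v', C v -> C v' -> (\rank (K v + K v')%MS <= n)%N.
Proof.
move=> iC KP ind v0 v0' Cv0 Cv0'; rewrite leqNgt; apply/negP => big.
have [D DC Dn] := tangent_dim_le charF (irr_sums iC) ind.
have fields v1 : C v1 -> exists U : 'M[{mpoly F[d]}]_(k, d), ev v1 U = K v1 /\
    forall v (a : 'rV[F]_k), C v -> tang C v (a *m ev v U).
  move=> Cv1; have h i : exists Q, ev v1 Q = row i (K v1) /\ forall v, C v -> tang C v (ev v Q).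
    by apply: (tang_field KP Cv1); apply/(KP v1 Cv1).2; exact: row_sub.
  have [Q QP] := choice h; exists (\matrix_i Q i).
  have rE v i : row i (ev v (\matrix_i Q i)) = ev v (Q i) by apply/rowP => j; rewrite !mxE.
  split=> [|v a Cv]; first by apply/row_matrixP => i; rewrite rE; have [] := QP i.
  apply/(KP v Cv).2/(submx_trans (submxMl _ _)); apply/row_subP => i; rewrite rE.
  by apply/(KP v Cv).2; have [_] := QP i; apply.
have [U [U0 UP]] := fields v0 Cv0; have [U' [U'0 U'P]] := fields v0' Cv0'.
pose M0 := col_mx (K v0) (K v0').
have {}big : (n < \rank M0)%N by rewrite -addsmxE.
(* Select n + 1 independent combinations of the two bases; their independence is a nonvanishing
   determinant. *)
have [R Rfree] : exists R : 'M[F]_(n.+1, k + k), row_free (R *m M0).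
  pose P : 'M[F]_(n.+1, \rank M0) := pid_mx n.+1; exists (P *m pinvmx (col_base M0)).
  have -> : P *m pinvmx (col_base M0) *m M0 = P *m row_base M0.
    transitivity (P *m (pinvmx (col_base M0) *m (col_base M0 *m row_base M0))); first by rewrite mulmx_base -(mulmxA P _ M0).
    by rewrite (mulmxA (pinvmx _)) mulVpmx ?col_base_full // mul1mx.
  by rewrite /row_free mxrankMfree ?row_base_free // rank_pid_mx.
pose Z := pinvmx (R *m M0).
pose f v v' := \det (R *m col_mx (ev v U) (ev v' U') *m Z).
pose cst v a b (A : 'M[F]_(a, b)) := map_mx (@mpolyC v F) A.
have fsep : sep_poly f.
  split=> v1.
    exists (\det (cst d _ _ R *m col_mx U (cst d _ _ (ev v1 U')) *m cst d _ _ Z)) => v.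
    by rewrite ev_det !evM ev_col_mx !ev_const.
  exists (\det (cst d _ _ R *m col_mx (cst d _ _ (ev v1 U)) U' *m cst d _ _ Z)) => v.
  by rewrite ev_det !evM ev_col_mx !ev_const.
have f0 : f v0 v0' != 0 by rewrite /f U0 U'0 mulmxVp ?det1 ?oner_neq0.
have [_ [b [b' [Cb Cb' ->]]] Db] := (not_vanishP _ _).1 DC.
have [v [v' [Cv Cv' fv Dv]]] := sep_poly_nonvanish iC fsep (sep_poly_sum D) Cv0 Cv0' Cb Cb' f0 Db.
suff : (n.+1 <= n)%N by rewrite ltnn.
apply: (Dn (v + v') _ (R *m col_mx (ev v U) (ev v' U')) Dv); split=> [|a].
  apply/row_freeP; exists (Z *m invmx (R *m col_mx (ev v U) (ev v' U') *m Z)).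
  by rewrite mulmxA mulmxV // unitmxE unitfE.
rewrite mulmxA -(hsubmxK (a *m R)) mul_row_col -[rsubmx _ *m _]scale1r; apply: tangD.
  by apply: tang_sums => //; exact: UP.
by rewrite addrC; apply: tang_sums => //; exact: U'P.
Qed.

Lemma zero_set_sub d (C : set 'rV[F]_d) (Z : set (Proj F d)) (g : {mpoly F[d]}) : zclosed Z -> irr C -> ~ vanish C g ->
  (forall v, C v -> g.@[v 0] != 0 -> cone Z v) -> zero_set C `<=` Z.
Proof.
move=> /zclosedP Zcl [_ C1 Cpr] gC CZ p Cp; apply: contrapT => nZp.
have [h hZ hp] := Zcl p _ nZp (vpick_coords p); have [k hk] := hc_nonvanish hp.
have hkZ := vanish_hc k hZ; case/eqP: hk; apply: (Cp _ k) (hc_homog k h) _ (vpick_coords p).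
have [//|/gC//] : vanish C (hc k h) \/ vanish C g; apply: Cpr => v Cv.
rewrite mevalM; have [->|gv] := eqVneq g.@[v 0] 0; first by rewrite mulr0.
by rewrite hkZ ?mul0r //; exact: CZ.
Qed.

(** A nonzero sum v + v' lies on the secant through the two points; if they coincide it is a point
    of X, which lies on a secant through any other point. *)
Lemma zero_set_sums_secant d (X : set (Proj F d)) (p1 p2 : Proj F d) : zclosed X -> irreducible X ->
  X p1 -> X p2 -> p1 <> p2 -> zero_set (sums (cone X)) `<=` secant_variety X.
Proof.
move=> Xcl Xirr Xp1 Xp2 p12 q Sq Z Zcl XZ; have iC := irr_cone Xcl Xirr.
have [w1 [_ w1p]] : exists w, cone X w /\ coords w p1.
  by exists (vpick (val p1)); split; [exists p1 => //|]; exact: vpick_coords.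
have [i wi] := rV0Pn _ (coords_neq0 w1p).
apply: (zero_set_sub Zcl (irr_sums iC) (g := 'X_i)) Sq => [|_ [v [v' [[x Xx vx] [x' Xx' vx'] ->]]]].
  apply/not_vanishP; exists (w1 + w1); last by rewrite mevalXU mxE -mulr2n -mulr_natr mulf_neq0 // charF0.
  by exists w1, w1; split=> //; exists p1.
rewrite mevalXU => zi; have z0 : v + v' != 0 by apply: contra zi => /eqP ->; rewrite mxE.
have [p zp] := coords_ex z0; exists p => //; apply: XZ.
have sub (y y' : Proj F d) : coords v y -> coords v' y' -> (val p <= val y + val y')%VS.
  move=> yv yv'; rewrite zp yv yv' -memvE; by apply: memv_add; rewrite memv_line.
have [xx'|xx'] := pselect (x = x'); last by exists x, x'; split=> //; exact: sub.
have [y [Xy xy]] : exists y, X y /\ x <> y.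
  by have [xE|h] := pselect (x = p1); [exists p2; rewrite xE | exists p1].
exists x, y; split=> //; apply: subv_trans (addvSl _ _).
by have := sub x x' vx vx'; rewrite xx' addvv.
Qed.

Lemma sub_secant d (X : set (Proj F d)) (p1 p2 : Proj F d) : X p1 -> X p2 -> p1 <> p2 -> X `<=` secant_variety X.
Proof.
move=> Xp1 Xp2 p12 x Xx Z Zcl; apply.
have [y [Xy xy]] : exists y, X y /\ x <> y.
  by have [xE|h] := pselect (x = p1); [exists p2; rewrite xE | exists p1].
by exists x, y; split=> //; exact: addvSl.
Qed.

Lemma has_chainS d (A B : set (Proj F d)) k : has_chain A k -> A `<=` B -> has_chain B k.
Proof.
move=> [Z [h1 h2]] AB; exists Z; split=> // i /h1[h3 h4 h5]; split=> //.
exact: subset_trans AB.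
Qed.

Lemma irreducible_setT d : irreducible (setT : set (Proj F d.+1)).
Proof.
have ind : algind setT (1%:M : 'M[F]_d.+1).
  by move=> G h; apply: (mpoly_fun_eq0 charF) => v; rewrite -[v]mulmx1; exact: h.
have iT : irr (setT : set 'rV[F]_d.+1).
  split.
  - split=> [v _|f g hf hg v Cv|a f hf v Cv]; first by rewrite meval0.
      by rewrite mevalD hf // hg // addr0.
    by rewrite mevalM hf // mulr0.
  - by move=> /(_ 0 I)/eqP; rewrite meval1 oner_eq0.
  move=> f g fg; have : f * g = 0 by apply: (mpoly_fun_eq0 charF) => v; exact: fg.
  move/eqP; rewrite mulf_eq0 => /orP[]/eqP->; [left|right] => v _; exact: meval0.
have := zero_set_irreducible iT ind; congr irreducible.
apply/seteqP; split=> // p _ f k v _ fT _; exact: fT.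
Qed.

Lemma secant_chain_bound d (X : set (Proj F d.+1)) k : secant_variety X <> setT -> has_chain (secant_variety X) k ->
  (k.+2 <= d.+1)%N.
Proof.
move=> nT h; suff c : has_chain (setT : set (Proj F d.+1)) k.+1 by have := chain_length_bound c.
apply: (has_chain_extend h).
- split=> // sub; apply: nT; apply/seteqP; split=> //.
- by exists set0; split=> [f []|]; apply/seteqP; split=> // p _ f v [].
- exact: irreducible_setT.
Qed.

End SecantVariety.

(** * Osculating spaces of the fibres *)

Section FullOsculation.
Variable F : closedFieldType.
Hypothesis charF : [pchar F] =i pred0.

Lemma rank_open d k e r (M : 'M[{mpoly F[d]}]_(k, e)) (v0 : 'rV[F]_d) : (r <= \rank (ev v0 M))%N ->
  exists2 g : {mpoly F[d]}, g.@[v0 0] != 0 & forall v : 'rV[F]_d, g.@[v 0] != 0 -> (r <= \rank (ev v M))%N.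
Proof.
move=> rM; pose M0 := ev v0 M; pose P : 'M[F]_(r, \rank M0) := pid_mx r; pose R := P *m pinvmx (col_base M0).
have RM : R *m M0 = P *m row_base M0.
  transitivity (P *m (pinvmx (col_base M0) *m (col_base M0 *m row_base M0))); first by rewrite mulmx_base -(mulmxA P _ M0).
  by rewrite (mulmxA (pinvmx _)) mulVpmx ?col_base_full // mul1mx.
have [|g g0 gP] := @row_free_open F d r e (map_mx (@mpolyC d F) R *m M) v0.
  by rewrite evM ev_const RM /row_free mxrankMfree ?row_base_free // rank_pid_mx.
exists g => // v /gP; rewrite evM ev_const => /eqP {1}<-; exact: mxrankM_maxr.
Qed.

Lemma ord2P (i : 'I_2) : i = 0 \/ i = 1.
Proof. by case: (unliftP 0 i) => [j|] ->; [right | left] => //; rewrite ord1; apply/val_inj. Qed.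

(** A relation between two forms may be taken homogeneous. It then splits into linear factors, none
    of which vanishes on [C]. *)
Lemma algind_two d (C : set 'rV[F]_d) (Y : 'M[F]_(d, 2)) : irr C ->
  (forall s v, C v -> s != 0 -> C (s *: v)) ->
  (forall c : 'cV[F]_2, c != 0 -> exists2 v, C v & v *m Y *m c != 0) -> algind C Y.
Proof.
move=> iC Cs nz G GC; have [_ C1 Cpr] := iC.
have hcC k v : C v -> (hc k G).@[(v *m Y) 0] = 0.
  move=> Cv; apply: (hc_vanish (s := [:: 0])) => x; rewrite inE => x0.
  by rewrite scalemxAl; apply: GC; exact: Cs.
suff h k (H : {mpoly F[2]}) : H \is k.-homog -> (forall v, C v -> H.@[(v *m Y) 0] = 0) -> H = 0.
  by rewrite (hc_sum G) big1 // => k _; apply: h (hc_homog k G) _ => v; exact: hcC.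
move=> Hk HC; pose e0 : 'rV[F]_2 := delta_mx 0 0; pose e1 : 'rV[F]_2 := delta_mx 0 1.
have [q qE] := line_poly H e0 e1; have {}qE s : q.[s] = H.@[(e0 + s *: e1) 0] by have [] := qE s.
have HE (y : 'rV[F]_2) : y 0 0 != 0 -> H.@[y 0] = y 0 0 ^+ k * q.[y 0 1 / y 0 0].
  move=> y0; have E : y 0 0 *: (e0 + y 0 1 / y 0 0 *: e1) = y; last by rewrite qE -(homog_scale _ _ Hk) E.
  apply/rowP => i; rewrite !mxE; have [->|->] := ord2P i.
    by rewrite eqxx /= mulr0 addr0 mulr1.
  by rewrite !eqxx /= add0r mulr1 mulrC divfK.
have [q0|q0] := eqVneq q 0.
  have : 'X_0 * H = 0.
    apply: (mpoly_fun_eq0 charF) => y; rewrite mevalM mevalXU; have [->|y0] := eqVneq (y 0 0) 0; first by rewrite mul0r.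
    by rewrite HE // q0 horner0 !mulr0.
  move/eqP; rewrite mulf_eq0 -msize_poly_eq0 msizeX => /orP[|/eqP//].
  by rewrite mdeg1.
exfalso; have [r qr] := closed_field_poly_normal q.
pose lin (c : 'cV[F]_2) := linmap (Y *m c) 0 0.
have linE c (v : 'rV[F]_d) : (lin c).@[v 0] = (v *m Y *m c) 0 0 by rewrite /lin -evE ev_linmap mulmxA.
have nvl c : c != 0 -> ~ vanish C (lin c).
  move=> /nz[v Cv h]; apply/not_vanishP; exists v => //; rewrite linE.
  by apply: contra h => /eqP h; apply/eqP/matrixP => i j; rewrite !ord1 h mxE.
have colE a b : (\col_(i < 2) if i == 0 then a else b) = 0 :> 'cV[F]_2 -> a = 0 /\ b = 0.
  by move=> h0; have /matrixP h := h0; have := h 0 0; have := h 1 0; rewrite !mxE /=.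
pose cc (a b : F) : 'cV[F]_2 := \col_(i < 2) if i == 0 then a else b.
have ccE a b (y : 'rV[F]_2) : (y *m cc a b) 0 0 = y 0 0 * a + y 0 1 * b.
  by rewrite mxE big_ord_recl big_ord1 !mxE /=; congr (_ + y 0 _ * b); apply/val_inj.
have n0 : ~ vanish C (lin (cc 1 0)).
  by apply: nvl; apply/negP => /eqP/colE[/eqP]; rewrite oner_eq0.
have : ~ vanish C (lin (cc 1 0) * \prod_(z <- r) lin (cc (- z) 1)).
  move=> /Cpr[//|]; apply: (prime_prod iC) => z _; apply: nvl.
  by apply/negP => /eqP/colE[_ /eqP]; rewrite oner_eq0.
apply=> v Cv; rewrite mevalM linE ccE mulr1 mulr0 addr0 rmorph_prod /=.
have [->|y0] := eqVneq ((v *m Y) 0 0) 0; first by rewrite mul0r.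
have := HC v Cv; rewrite HE // => /eqP; rewrite mulf_eq0 expf_eq0 (negPf y0) andbF /= -/(root q _).
rewrite qr rootZ ?lead_coef_eq0 // root_prod_XsubC => zr.
rewrite (big_rem _ zr) /= linE ccE (_ : _ + _ = 0) ?mul0r ?mulr0 //; first by field.
Qed.

Lemma pencil_span m d (A A' D1 D2 : 'M[F]_(m.+1, d)) b1 b2 : row_free A -> row_free A' -> nondeg A D1 D2 ->
  (b1, b2) != (0, 0) -> ((b1 *: D1 + b2 *: D2)%R <= A + A')%MS -> (A + A' :=: A + (b1 *: D1 + b2 *: D2)%R)%MS.
Proof.
move=> Afree A'free nd b0 bD; apply/eqmxP.
have sub : (A + (b1 *: D1 + b2 *: D2)%R <= A + A')%MS by rewrite addsmx_sub addsmxSl bD.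
rewrite andbC -(geq_leqif (mxrank_leqif_eq sub)).
have -> : \rank (A + (b1 *: D1 + b2 *: D2)%R)%MS = (m.+1 + m.+1)%N.
  apply: rank_add_free => // c h; have [//|[b10 b20]] := nd c b1 b2 h.
  by rewrite b10 b20 eqxx in b0.
by have := mxrank_adds_leqif A A'; rewrite (eqP Afree) (eqP A'free) => -[].
Qed.

Lemma addsmx3 a b c d (U : 'M[F]_(a, d)) (V : 'M[F]_(b, d)) (W : 'M[F]_(c, d)) :
  [/\ (U <= U + V + W)%MS, (V <= U + V + W)%MS & (W <= U + V + W)%MS].
Proof.
split; last exact: addsmxSr.
- exact: submx_trans (addsmxSl U V) (addsmxSl _ _).
- exact: submx_trans (addsmxSr U V) (addsmxSl _ _).
Qed.

Lemma rank_lt_add a b d (U : 'M[F]_(a, d)) (V : 'M[F]_(b, d)) : ~~ (V <= U)%MS -> (\rank U < \rank (U + V)%MS)%N.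
Proof.
move=> VU; rewrite ltnNge; apply: contra VU => le; apply: submx_trans (addsmxSr U V) _.
by have [_ <-] := mxrank_leqif_sup (addsmxSl U V); rewrite eqn_leq mxrankS ?addsmxSl.
Qed.

Definition frame_at m d e (CX : set 'rV[F]_d) (L : 'rV[F]_e -> 'M[F]_d) (w : 'rV[F]_e) (A D1 D2 : 'M[F]_(m, d)) :=
  [/\ row_free A, (A :=: L w)%MS, nondeg A D1 D2 &
     forall (c : 'rV[F]_m) u, c != 0 -> tang CX (c *m A) u <-> (u <= A + c *m D1 + c *m D2)%MS].

Lemma nondeg_rank m d (A D1 D2 : 'M[F]_(m, d)) (c : 'rV[F]_m) : row_free A -> nondeg A D1 D2 -> c != 0 ->
  \rank (A + c *m D1 + c *m D2)%MS = m.+2.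
Proof.
move=> Afree nd c0; pose U := col_mx (c *m D1) (c *m D2).
have -> : \rank (A + c *m D1 + c *m D2)%MS = \rank (A + U)%MS.
  by rewrite -addsmxA (adds_eqmx (eqmx_refl A) (addsmxE (c *m D1) (c *m D2))).
rewrite rank_mod (eqP Afree) -addn2; congr (_ + _)%N; apply/eqP; rewrite -/(row_free _).
apply: row_free_ker => a; rewrite mulmxA => aU; have : (a *m U <= A)%MS by rewrite submxE aU.
rewrite -(hsubmxK a) mul_row_col (mx11_scalar (lsubmx a)) (mx11_scalar (rsubmx a)) !mul_scalar_mx.
rewrite !scalemxAr -mulmxDr => /nd[/eqP|[-> ->]]; first by rewrite (negPf c0).
by rewrite raddf0 row_mx0.
Qed.

Lemma frame_of_rank a k d (T : 'M[F]_(a, d)) : \rank T = k -> exists U : 'M[F]_(k, d), row_free U /\ (U :=: T)%MS.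
Proof. by case: k /; exists (row_base T); split; [exact: row_base_free | exact: eq_row_base]. Qed.

Definition local_frames m d e (CX : set 'rV[F]_d) (CW : set 'rV[F]_e) (L : 'rV[F]_e -> 'M[F]_d) := forall w0, CW w0 ->
  exists (g : {mpoly F[e]}) (E D1 D2 : 'M[{mpoly F[e]}]_(m.+1, d)), g.@[w0 0] != 0 /\
    forall w, CW w -> g.@[w 0] != 0 -> frame_at CX L w (ev w E) (ev w D1) (ev w D2).

Definition tangent_sums_le n d (CX : set 'rV[F]_d) :=
  forall x x' k k' (U : 'M[F]_(k, d)) (U' : 'M[F]_(k', d)), CX x -> CX x' ->
  (forall u, (u <= U)%MS -> tang CX x u) -> (forall u, (u <= U')%MS -> tang CX x' u) ->
  (\rank (U + U')%MS <= n)%N.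

Definition spanning d (CX : set 'rV[F]_d) := forall l : 'cV[F]_d, l != 0 -> exists2 x, CX x & x *m l != 0.

Variables (d e m : nat) (CX : set 'rV[F]_d) (CW : set 'rV[F]_e) (L : 'rV[F]_e -> 'M[F]_d).
Hypothesis S : scroll CX CW L.
Hypothesis iX : irr CX.
Hypothesis iW : irr CW.
Hypothesis CWs : forall s w, CW w -> s != 0 -> CW (s *: w).
Hypothesis CW0 : forall w, CW w -> w != 0.
Hypothesis CXs : forall s x, CX x -> s != 0 -> CX (s *: x).
Hypothesis CX0 : forall x, CX x -> x != 0.
Hypothesis frames : local_frames m CX CW L.
Hypothesis indX : forall t (Y : 'M[F]_(d, t)), algind CX Y -> (t <= m.+3)%N.
Hypothesis secX : tangent_sums_le (m.+1 + m.+1).+2 CX.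
Hypothesis dimV : ((m.+1 + m.+1).+2 < d)%N.
Hypothesis nondegX : spanning CX.

Lemma frame_cone w A D1 D2 (c : 'rV[F]_m.+1) : CW w -> frame_at CX L w A D1 D2 -> c != 0 ->
  CX (c *m A).
Proof.
move=> Cw [Afree AL _ _] c0; have x0 : c *m A != 0.
  by apply: contra c0 => /eqP h; apply/eqP; apply: (row_free_inj Afree); rewrite h mul0mx.
by refine (scroll_fibre S Cw x0 _); rewrite -AL submxMl.
Qed.

Lemma row_nonzero (i : 'I_m.+1) : (delta_mx 0 i : 'rV[F]_m.+1) != 0.
Proof. by apply/rV0Pn; exists i; rewrite mxE !eqxx oner_eq0. Qed.

(** The osculating space is the span of the tangent spaces along the fibre, hence independent of the
    frame. *)
Lemma osc_le w (A D1 D2 A' D1' D2' : 'M[F]_(m.+1, d)) : frame_at CX L w A D1 D2 ->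
  frame_at CX L w A' D1' D2' -> ((A + D1 + D2)%MS <= A' + D1' + D2')%MS.
Proof.
move=> [Afree AL _ tA] [A'free A'L _ tA'].
have AA' : (A <= A')%MS by rewrite AL A'L.
rewrite !addsmx_sub -!addsmxA (submx_trans AA') ?addsmxSl //=.
have h (i : 'I_m.+1) : (row i D1 <= A' + (D1' + D2'))%MS /\ (row i D2 <= A' + (D1' + D2'))%MS.
  have [c cE] := submxP (submx_trans (row_sub i A) AA'); have c0 : c != 0.
    apply: contra (row_nonzero i) => /eqP c0; apply/eqP; apply: (row_free_inj Afree).
    by rewrite -rowE cE c0 !mul0mx.
  have sub (u : 'rV[F]_d) : (u <= A + (delta_mx 0 i : 'rV[F]_m.+1) *m D1 + (delta_mx 0 i : 'rV[F]_m.+1) *m D2)%MS -> (u <= A' + (D1' + D2'))%MS.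
    move=> h1; have := (tA _ _ (row_nonzero i)).2 h1; rewrite -rowE cE => /(tA' _ _ c0).1 h.
    apply: submx_trans h _.
    by rewrite -addsmxA; do 2!apply: addsmxS => //; exact: submxMl.
  split; apply: sub; rewrite -!rowE; last exact: addsmxSr.
  by apply: submx_trans (addsmxSr _ _) (addsmxSl _ _).
by apply/andP; split; apply/row_subP => i; have [] := h i.
Qed.

Lemma osc_ex : exists O : 'rV[F]_e -> 'M[F]_d, forall w (A D1 D2 : 'M[F]_(m.+1, d)), CW w -> frame_at CX L w A D1 D2 ->
  (O w :=: A + D1 + D2)%MS.
Proof.
have h w : exists O : 'M[F]_d, CW w -> forall A D1 D2 : 'M[F]_(m.+1, d), frame_at CX L w A D1 D2 -> (O :=: A + D1 + D2)%MS.
  have [Cw|nCw] := pselect (CW w); last by exists 0.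
  have [g [E [D1 [D2 [gw /(_ w Cw gw) fr]]]]] := frames Cw.
  exists (ev w E + ev w D1 + ev w D2)%MS => _ A' D1' D2' fr'.
  by apply/eqmxP; rewrite !(osc_le fr, osc_le fr').
by have [O OP] := choice h; exists O => w A D1 D2 Cw; exact: OP.
Qed.

Lemma fibres_span r (U : 'M[F]_(r, d)) : (\rank U < d)%N -> exists2 w, CW w & ~~ (L w <= U)%MS.
Proof.
move=> rU; have : cokermx U != 0 by rewrite -mxrank_eq0 mxrank_coker subn_eq0 -ltnNge.
move=> /matrix0Pn[i [j Uij]]; pose l := col j (cokermx U).
have /nondegX[x Cx xl] : l != 0 by apply: contra Uij => /eqP/colP/(_ i); rewrite !mxE => ->.
have [w Cw xw] := scroll_cover S Cx; exists w => //; apply: contra xl => wU.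
have := submx_trans xw wU; rewrite submxE => /eqP h.
by rewrite /l colE mulmxA h mul0mx.
Qed.

Lemma fibres_disjoint w w' : CW w -> CW w' -> ~ (exists c, w' = c *: w) -> (L w :&: L w' = 0)%MS.
Proof.
move=> Cw Cw' ne; apply/eqP/rowV0P => x; rewrite sub_capmx => /andP[xw xw'].
apply/eqP/negPn/negP => x0; have [c _ cE] := scroll_disjoint S Cw Cw' x0 xw xw'.
by apply: ne; exists c.
Qed.

(** The rank bound of [pair_cases] comes from sums of tangent spaces; a zero [c] is replaced by a
    nonzero one, since tangent spaces are taken at nonzero points. *)
Lemma fibre_pair w w' (A D1 D2 A' D1' D2' : 'M[F]_(m.+1, d)) : CW w -> CW w' -> ~ (exists c, w' = c *: w) ->
  frame_at CX L w A D1 D2 -> frame_at CX L w' A' D1' D2' ->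
  [\/ (A' <= A + D1 + D2)%MS /\ exists b1 b2, (b1, b2) != (0, 0) /\ ((b1 *: D1 + b2 *: D2)%R <= A + A')%MS,
      \rank (A + D1 + D2)%MS = (m.+1 + m.+1).+1 /\ (A' <= A + D1 + D2)%MS,
      \rank (A' + D1' + D2')%MS = (m.+1 + m.+1).+1 /\ (A <= A' + D1' + D2')%MS |
      exists H : 'M[F]_d, [/\ (\rank H <= (m.+1 + m.+1).+2)%N, (A + D1 + D2 <= H)%MS & (A' + D1' + D2' <= H)%MS]].
Proof.
move=> Cw Cw' ne fr fr'; have [Afree AL nd tA] := fr; have [A'free A'L nd' tA'] := fr'.
have AA' : (A :&: A' = 0)%MS.
  by apply/eqP; rewrite -mxrank_eq0 (cap_eqmx AL A'L) mxrank_eq0; apply/eqP; exact: fibres_disjoint.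
have [] := pair_cases Afree A'free AA' nd nd'; [|move=> [b1 [b2 [b0 bD]]]|by constructor 2|by constructor 3|by constructor 4].
  have bound (c c' : 'rV[F]_m.+1) : c != 0 -> c' != 0 ->
      (\rank (A + A' + (c *m D1 + c *m D2 + (c' *m D1' + c' *m D2')))%MS <= (m.+1 + m.+1).+2)%N.
    move=> c0 c'0; apply: leq_trans (secX (frame_cone Cw fr c0) (frame_cone Cw' fr' c'0)
      (fun u => (tA c u c0).2) (fun u => (tA' c' u c'0).2)).
    apply: mxrankS; rewrite !addsmx_sub; set T1 := (A + _ + _)%MS; set T2 := (A' + _ + _)%MS.
    have lft k1 (U : 'M[F]_(k1, d)) : (U <= T1)%MS -> (U <= T1 + T2)%MS by move=> h; apply: submx_trans h (addsmxSl _ _).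
    have rgt k1 (U : 'M[F]_(k1, d)) : (U <= T2)%MS -> (U <= T1 + T2)%MS by move=> h; apply: submx_trans h (addsmxSr _ _).
    have [a1 a2 a3] := addsmx3 A (c *m D1) (c *m D2); have [a4 a5 a6] := addsmx3 A' (c' *m D1') (c' *m D2').
    by rewrite (lft _ A) // (rgt _ A') // (lft _ (c *m D1)) // (lft _ (c *m D2)) // (rgt _ (c' *m D1')) // rgt.
  have ex0 (c : 'rV[F]_m.+1) : exists c1 : 'rV[F]_m.+1, [/\ c1 != 0, (c *m D1 <= c1 *m D1)%MS, (c *m D2 <= c1 *m D2)%MS,
      (c *m D1' <= c1 *m D1')%MS & (c *m D2' <= c1 *m D2')%MS].
    have [->|c0] := eqVneq c 0; last by exists c.
    by exists (delta_mx 0 0); rewrite !mul0mx !sub0mx row_nonzero.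
  move=> c c'; have [c1 [c10 h1 h2 _ _]] := ex0 c; have [c1' [c1'0 _ _ h3 h4]] := ex0 c'.
  by apply: leq_trans (bound _ _ c10 c1'0); apply: mxrankS; do ![apply: addsmxS => //].
constructor 1; split; last by exists b1, b2.
have := addsmxSr A A'; rewrite (pencil_span Afree A'free nd b0 bD) => h; apply: submx_trans h _.
by rewrite -addsmxA addsmxS // addmx_sub_adds // scalemx_sub.
Qed.

(* Otherwise projecting from an osculating space would be a nonconstant rational function on *)
(* [X] whose differential vanishes identically. *)
Lemma full_osculation : exists w (A D1 D2 : 'M[F]_(m.+1, d)),
  [/\ CW w, frame_at CX L w A D1 D2 & row_full (A + D1 + D2)%MS].
Proof.
have [O OE] := osc_ex; apply: contrapT => nofull.
have rO w : CW w -> (\rank (O w) < d)%N.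
  move=> Cw; rewrite ltn_neqAle rank_leq_row andbT; apply/negP => full; apply: nofull.
  have [g [E [D1 [D2 [gw /(_ w Cw gw) fr]]]]] := frames Cw.
  by exists w, (ev w E), (ev w D1), (ev w D2); split=> //; rewrite /row_full -(OE _ _ _ _ Cw fr).
pose isR r := `[< exists2 w, CW w & \rank (O w) = r >].
have [w1 Cw1] : exists w, CW w.
  by have [|w Cw _] := @fibres_span 0 0; [rewrite mxrank0; move: dimV; clear; lia | exists w].
have P0 : exists r, isR r by exists (\rank (O w1)); apply/asboolP; exists w1.
have Pb r : isR r -> (r <= d)%N by move=> /asboolP[w _ <-]; exact: rank_leq_row.
have [rho /asboolP[ws Cws rws] rmax] := ex_maxnP P0 Pb.
have {}rmax w : CW w -> (\rank (O w) <= rho)%N by move=> Cw; apply: rmax; apply/asboolP; exists w.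
have [w0 Cw0 w0P] := fibres_span (rO ws Cws).
have [h1 h1P h1W] : exists2 h : {mpoly F[e]}, ~ vanish CW h &
    forall w, CW w -> h.@[w 0] != 0 -> ~~ (L w0 <= O w)%MS.
  have [g [E [D1 [D2 [gw fr]]]]] := frames Cws; pose cL := map_mx (@mpolyC e F) (L w0).
  pose M := col_mx (col_mx (col_mx E D1) D2) cL.
  have evM' w : CW w -> g.@[w 0] != 0 -> (ev w M :=: O w + L w0)%MS.
    move=> Cw gw'; have OE' := OE _ _ _ _ Cw (fr w Cw gw'); rewrite /M !ev_col_mx ev_const.
    apply: eqmx_trans (eqmx_sym (addsmxE _ _)) _; apply: adds_eqmx (eqmx_refl _).
    apply: eqmx_sym; apply: eqmx_trans OE' _; apply: eqmx_trans (addsmxE _ _).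
    by apply: adds_eqmx (eqmx_refl _); exact: addsmxE.
  have [|h hw hP] := @rank_open e _ d rho.+1 M ws.
    by rewrite evM' // -rws rank_lt_add.
  exists (g * h); first by apply/not_vanishP; exists ws; rewrite // mevalM mulf_neq0.
  move=> w Cw; rewrite mevalM mulf_eq0 negb_or => /andP[gw' /hP]; rewrite evM' //.
  by apply: contraL => sub; rewrite -leqNgt (addsmx_idPl sub) rmax.
have [h2 h2P h2W] : exists2 h : {mpoly F[e]}, ~ vanish CW h &
    forall w, CW w -> h.@[w 0] != 0 -> ~~ (L w <= O w0)%MS.
  have [w2 Cw2 w2P] := fibres_span (rO w0 Cw0); have [g [E [D1 [D2 [gw fr]]]]] := frames Cw2.
  pose K := map_mx (@mpolyC e F) (cokermx (O w0)).
  have evK w : ev w (E *m K) = ev w E *m cokermx (O w0) by rewrite evM ev_const.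
  have [_ EL _ _] := fr w2 Cw2 gw; move: w2P; rewrite -EL submxE -evK => /matrix0Pn[i [j Eij]].
  exists (g * (E *m K) i j).
    by apply/not_vanishP; exists w2; rewrite // mevalM mulf_neq0 // -evE.
  move=> w Cw; rewrite mevalM mulf_eq0 negb_or => /andP[gw' nz]; have [_ EL' _ _] := fr w Cw gw'.
  rewrite -EL' submxE -evK; apply: contra nz => /eqP/matrixP/(_ i j).
  by rewrite -evE => ->; rewrite mxE.
have [g0 [E0 [D01 [D02 [g0w /(_ w0 Cw0 g0w) fr0]]]]] := frames Cw0.
have O0E := OE _ _ _ _ Cw0 fr0.
(* For general [w] neither osculating space contains the other fibre, so only the last case of
   [fibre_pair] is left; there adding [L w] to [O w0] already fills the common space. *)
have main w : CW w -> (h1 * h2).@[w 0] != 0 ->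
    \rank (O w0) = (m.+1 + m.+1).+1 /\ (\rank (O w0 + L w)%MS <= (\rank (O w0)).+1)%N /\ (O w <= O w0 + L w)%MS.
  move=> Cw; rewrite mevalM mulf_eq0 negb_or => /andP[/(h1W w Cw) L0w /(h2W w Cw) Lw0].
  have [g [E [D1 [D2 [gw /(_ w Cw gw) fr]]]]] := frames Cw; have OwE := OE _ _ _ _ Cw fr.
  have ne : ~ exists c, w = c *: w0.
    move=> [c wE]; have c0 : c != 0.
      by apply: contraNneq (CW0 Cw) => c0; rewrite wE c0 scale0r.
    have := scroll_scale S Cw0 c0; rewrite -wE => LL; move: Lw0; rewrite LL O0E.
    by have [_ <- _ _] := fr0; have [->] := addsmx3 (ev w0 E0) (ev w0 D01) (ev w0 D02).
  have [_ A0L _ _] := fr0; have [_ AL _ _] := fr.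
  have [[sub _]|[_ sub]|[_ sub]|[H [rH H0 H1]]] := fibre_pair Cw0 Cw ne fr0 fr.
  - by move: Lw0; rewrite O0E -AL sub.
  - by move: Lw0; rewrite O0E -AL sub.
  - by move: L0w; rewrite OwE -A0L sub.
  rewrite -O0E in H0; rewrite -OwE in H1.
  have LwH : (L w <= H)%MS.
    by apply: submx_trans H1; rewrite OwE -AL; have [] := addsmx3 (ev w E) (ev w D1) (ev w D2).
  have sub : (O w0 + L w <= H)%MS by rewrite addsmx_sub H0.
  have lt : (\rank (O w0) < \rank (O w0 + L w)%MS)%N.
    exact: rank_lt_add.
  have r2 : (\rank (O w0 + L w)%MS <= \rank H)%N by exact: mxrankS.
  have lb : ((m.+1 + m.+1).+1 <= \rank (O w0))%N.
    by rewrite O0E; have [A0free _ nd _] := fr0; exact: hopf_bound.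
  have rO0 : \rank (O w0) = (m.+1 + m.+1).+1.
    by apply/eqP; rewrite eqn_leq lb andbT -ltnS (leq_trans lt) // (leq_trans r2).
  split=> //; split; first by rewrite rO0 (leq_trans r2).
  apply: submx_trans H1 _; have [_ <-] := mxrank_leqif_sup sub.
  by rewrite eqn_leq r2 (leq_trans rH) // -rO0.
have [w Cw hw] := irr_nonvanish iW h1P h2P.
have [rO0 _] : \rank (O w0) = (m.+1 + m.+1).+1 /\ True.
  by split=> //; have [] := main w Cw; rewrite ?mevalM ?mulf_neq0 //; case: hw.
(* Two independent linear forms vanishing on [O w0]; their quotient is the function with zero
   differential. *)
pose K := cokermx (O w0); pose Y : 'M[F]_(d, 2) := col_base K *m pid_mx 2.
have rK : (2 <= \rank K)%N by rewrite mxrank_coker rO0; move: dimV; clear; lia.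
have OK : O w0 *m col_base K = 0.
  apply: (row_free_inj (row_base_free K)); rewrite -mulmxA mulmx_base mul0mx; exact: mulmx_coker.
have OY : O w0 *m Y = 0 by rewrite mulmxA OK mul0mx.
have Yinj (c : 'cV[F]_2) : Y *m c = 0 -> c = 0.
  rewrite -mulmxA => h; have full : row_full (pid_mx 2 : 'M[F]_(\rank K, 2)) by rewrite /row_full rank_pid_mx.
  apply: (row_full_inj full); rewrite mulmx0; apply: (row_full_inj (col_base_full K)); by rewrite mulmx0.
clearbody Y; have indY : algind CX Y.
  apply: algind_two => // c c0; have [|x Cx xc] := @nondegX (Y *m c).
    by apply: contra c0 => /eqP/Yinj ->.
  by exists x; rewrite // -mulmxA.
have [y Cy y0] : exists2 y, CX y & y *m Y != 0.
  have [|x Cx xc] := @nondegX (Y *m delta_mx 0 0).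
    by apply/eqP => /Yinj/matrixP/(_ 0 0)/eqP; rewrite !mxE !eqxx oner_eq0.
  by exists x => //; apply: contra xc => /eqP xY; rewrite mulmxA xY mul0mx.
have [j yj] := rV0Pn _ y0.
have [w3 Cw3 hw3] : exists2 w, CW w & (h1 * h2).@[w 0] != 0.
  by exists w => //; rewrite mevalM mulf_neq0 //; case: hw.
have [g3 [E3 [D31 [D32 [g3w /(_ w3 Cw3 g3w) fr3]]]]] := frames Cw3.
have Cx3 := frame_cone Cw3 fr3 (row_nonzero 0); set x3 := delta_mx 0 0 *m ev w3 E3 in Cx3.
have [gP [P [gx gPP]]] := scroll_proj S Cx3; have [CP xP] := gPP x3 Cx3 gx.
have x3L : (x3 <= L w3)%MS by have [_ <- _ _] := fr3; exact: submxMl.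
have [lam lam0 PE] := scroll_disjoint S Cw3 CP (CX0 Cx3) x3L xP.
pose P' := lam^-1%:MP *: P; have evP' x : ev x P' = lam^-1 *: ev x P by rewrite evZ mevalC.
have [||z Cz [z1 z2]] := irr_nonvanish iX (f := gP * cmp P' (h1 * h2)) (g := linmap Y 0 j).
- apply/not_vanishP; exists x3 => //; rewrite mevalM mulf_neq0 // ev_cmp evP' PE scalerA mulVf // scale1r.
  exact: hw3.
- by apply/not_vanishP; exists y; rewrite // -evE ev_linmap.
have [|z4 [Cz4 hz4 zU]] := @ratio_not_stationary F charF d m.+3 CX Y (gP * cmp P' (h1 * h2) * linmap Y 0 j) iX indX indY.
  by apply/not_vanishP; exists z; rewrite // mevalM mulf_neq0.
move: hz4; rewrite mevalM -[(linmap Y 0 j).@[_]]evE ev_linmap mevalM ev_cmp evP' !mulf_eq0 !negb_or => /andP[/andP[gz hz] zY].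
have [CPz zL] := gPP z4 Cz4 gz; set w4 := lam^-1 *: ev z4 P in hz.
have lam'0 : lam^-1 != 0 by rewrite invr_eq0.
have Cw4 : CW w4 by exact: CWs.
have zL4 : (z4 <= L w4)%MS by rewrite /w4 (scroll_scale S CPz lam'0).
have [_ [rH OH]] := main w4 Cw4 hz.
have zO : ~~ (z4 <= O w0)%MS.
  by apply: contra zY => /submxP[c ->]; rewrite -mulmxA OY mulmx0 mxE.
have Hz : (O w0 + L w4 <= O w0 + z4)%MS.
  have sub : (O w0 + z4 <= O w0 + L w4)%MS by rewrite addsmxS.
  have [_ <-] := mxrank_leqif_sup sub; rewrite eqn_leq mxrankS //= (leq_trans rH) //.
  exact: rank_lt_add.
have [g4 [E4 [D41 [D42 [g4w /(_ w4 Cw4 g4w) fr4]]]]] := frames Cw4; have O4 := OE _ _ _ _ Cw4 fr4.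
have [E4free EL4 nd4 t4] := fr4.
have [c zE] : exists c, z4 = c *m ev w4 E4 by apply/submxP; rewrite EL4.
have c0 : c != 0 by apply: contraNneq (CX0 Cz4) => c0; rewrite zE c0 mul0mx.
have [U [Ufree UT]] := frame_of_rank (nondeg_rank E4free nd4 c0).
have Utf : tframe CX z4 U by split=> // a; rewrite zE; apply/t4 => //; rewrite -UT submxMl.
(* The tangent space at [z4] lies in O w0 + z4, where the values of the two forms are proportional
   to those at [z4]; so their quotient is stationary. *)
case/eqP: (zU U Utf); apply/row_matrixP => i; rewrite row0 -mulmxA row_mul.
have sub : (row i U <= O w0 + z4)%MS.
  apply: submx_trans Hz; apply: submx_trans OH; rewrite O4; apply: submx_trans (row_sub i U) _.
  by rewrite UT -!addsmxA; do 2?[apply: addsmxS => //]; exact: submxMl.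
have /sub_addsmxP[[a b] /= ->] := sub; rewrite mulmxDl -!mulmxA (mulmxA (O w0)) OY mul0mx mulmx0 add0r.
rewrite (_ : z4 *m _ = 0) ?mulmx0 //; apply/matrixP => k l; rewrite !ord1 mulmxA mxE big_ord_recl big_ord1.
rewrite [in RHS]mxE [X in _ * X + _]mxE [X in _ + _ * X]mxE /= mulrN.
have -> : lift ord0 ord0 = 1 :> 'I_2 by apply/val_inj.
by rewrite mulrC subrr.
Qed.

End FullOsculation.

(** * Pencils of fibres *)

Section Families.
Variable F : closedFieldType.

(** [K] is, without denominators, a projection whose kernel is the row space of [M]. *)
Lemma coker_poly e k d (M : 'M[{mpoly F[e]}]_(k, d)) (v0 : 'rV[F]_e) : row_free (ev v0 M) ->
  exists (g : {mpoly F[e]}) (K : 'M[{mpoly F[e]}]_d), g.@[v0 0] != 0 /\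
    forall v : 'rV[F]_e, g.@[v 0] != 0 -> row_free (ev v M) /\ forall a (x : 'M[F]_(a, d)), x *m ev v K = 0 <-> (x <= ev v M)%MS.
Proof.
move=> fr; have [Z MZ] : exists Z, ev v0 M *m Z = 1%:M by exists (pinvmx (ev v0 M)); exact: mulmxVp.
pose cZ := map_mx (@mpolyC e F) Z.
have [N evN] : exists N, forall v, ev v N = ev v M *m Z.
  by exists (M *m cZ) => v; rewrite evM ev_const.
exists (\det N), ((\det N)%:M - cZ *m \adj N *m M); split.
  by rewrite ev_det evN MZ det1 oner_neq0.
move=> v; rewrite ev_det => dN; split.
  apply/row_freeP; exists (Z *m invmx (ev v N)).
  by rewrite mulmxA -evN mulmxV // unitmxE unitfE.
have KE : ev v ((\det N)%:M - cZ *m \adj N *m M) = (\det (ev v N))%:M - Z *m \adj (ev v N) *m ev v M.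
  by rewrite evB !evM ev_const ev_adj; congr (_ - _); rewrite -ev_det /ev map_scalar_mx.
move=> a x; rewrite KE mulmxBr mul_mx_scalar; split=> [/eqP|/submxP[y ->]].
  rewrite subr_eq0 => /eqP E; rewrite -[x]scale1r -(mulVf dN) -scalerA E scalemx_sub //.
  by rewrite mulmxA submxMl.
by rewrite !mulmxA -(mulmxA y) -evN -(mulmxA y) mul_mx_adj mul_mx_scalar scalemxAl subrr.
Qed.

Lemma regline_lin d D D' (C : set 'rV[F]_d) (l : 'rV[F]_d -> 'rV[F]_D) (M : 'M[F]_(D, D')) : regline C l ->
  (forall v, C v -> l v *m M != 0) -> regline C (fun v => l v *m M).
Proof.
move=> [l0 ls lreg] lM; split=> // [v s Cv s0|v Cv].
  by have [c ->] := ls v s Cv s0; exists c; rewrite scalemxAl.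
have [Q [Q0 QP]] := lreg v Cv; exists (Q *m map_mx (@mpolyC d F) M); split.
  rewrite evM ev_const; have [c QE] := QP v Cv; rewrite QE -scalemxAl scaler_eq0 negb_or lM // andbT.
  by apply: contra Q0 => /eqP c0; rewrite QE c0 scale0r.
by move=> w Cw; rewrite evM ev_const; have [c ->] := QP w Cw; exists c; rewrite scalemxAl.
Qed.

Lemma regline_sub d D (C C' : set 'rV[F]_d) (l : 'rV[F]_d -> 'rV[F]_D) : C' `<=` C -> regline C l -> regline C' l.
Proof.
move=> CC [l0 ls lreg]; split=> [v /CC|v s /CC|v /CC]; [exact: l0|exact: ls|].
by move=> /lreg[Q [Q0 QP]]; exists Q; split=> // w /CC; exact: QP.
Qed.

Lemma algind2_two_points d (C : set 'rV[F]_d) (Y : 'M[F]_(d, 2)) (v1 : 'rV[F]_d) : algind C Y ->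
  exists2 v, C v & ~ exists c, v = c *: v1.
Proof.
move=> ind; apply: contrapT => h.
have {}h v : C v -> exists c, v = c *: v1 by move=> Cv; apply: contrapT => nc; apply: h; exists v.
pose y := v1 *m Y; have yE v : C v -> exists c, v *m Y = c *: y.
  by move=> /h[c ->]; exists c; rewrite scalemxAl.
pose G : {mpoly F[2]} := (y 0 1)%:MP * 'X_0 - (y 0 0)%:MP * 'X_1.
have G0 : G = 0.
  apply: ind => v /yE[c ->]; rewrite mevalB !mevalM !mevalC !mevalXU !mxE.
  by move: (y 0 0) (y 0 1) => a b; ring.
have Gv (z : 'rV[F]_2) : y 0 1 * z 0 0 - y 0 0 * z 0 1 = 0.
  by have := meval0 (z 0); rewrite -G0 mevalB !mevalM !mevalC !mevalXU.
have y00 : y 0 0 = 0.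
  by apply/eqP; have := Gv (delta_mx 0 1); rewrite !mxE /= mulr0 sub0r mulr1 => /eqP; rewrite oppr_eq0.
have y01 : y 0 1 = 0.
  by have := Gv (delta_mx 0 0); rewrite !mxE /= mulr0 subr0 mulr1.
have : 'X_0 = 0 :> {mpoly F[2]}.
  by apply: ind => v /yE[c ->]; rewrite mevalXU mxE y00 mulr0.
by move/eqP; rewrite -msize_poly_eq0 msizeX.
Qed.

(** The determinant as a form in the entries, to be the nowhere vanishing form of
    [regline_const]. *)
Definition detpoly m : {mpoly F[m * m]} := \det (\matrix_(i < m, j < m) 'X_(mxvec_index i j)).

Lemma ev_detpoly m (M : 'M[F]_m) : (detpoly m).@[(mxvec M) 0] = \det M.
Proof.
rewrite ev_det; congr (\det _); apply/matrixP => i j.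
by rewrite !mxE mevalXU mxvecE.
Qed.

Lemma detpoly_homog m : detpoly m \is m.-homog.
Proof.
have h (f : 'I_m -> 'I_m) : \prod_i (\matrix_(i < m, j < m) 'X_(mxvec_index i j) : 'M[{mpoly F[m * m]}]_m) i (f i)
    \is (\sum_(i < m) 1)%N.-homog.
  apply: (big_ind2 (fun (p : {mpoly F[m * m]}) k => p \is k.-homog)) => [|p k q l hp hq|i _].
  - exact: dhomog1.
  - exact: dhomogM hp hq.
  - by rewrite mxE dhomogX /= mdeg1.
rewrite sum1_card card_ord in h; apply: rpred_sum => s _.
by rewrite -signr_odd; case: (odd _); rewrite ?expr1 ?expr0 ?mulN1r ?mul1r ?rpredN.
Qed.

Variables (d e m : nat) (W : set (Proj F e)) (CX : set 'rV[F]_d) (L : 'rV[F]_e -> 'M[F]_d).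
Hypothesis Wcl : zclosed W.
Hypothesis S : scroll CX (cone W) L.
Hypothesis frames : local_frames m CX (cone W) L.
Hypothesis nondegX : spanning CX.

Lemma fibre_sub_open r (U : 'M[F]_(r, d)) w0 : cone W w0 -> ~~ (L w0 <= U)%MS ->
  exists2 h : {mpoly F[e]}, h.@[w0 0] != 0 & forall w, cone W w -> h.@[w 0] != 0 -> ~~ (L w <= U)%MS.
Proof.
move=> Cw0 LU; have [g [E [D1 [D2 [gw fr]]]]] := frames Cw0.
pose K := map_mx (@mpolyC e F) (cokermx U).
have evK w : ev w (E *m K) = ev w E *m cokermx U by rewrite evM ev_const.
have [_ EL _ _] := fr w0 Cw0 gw; move: LU; rewrite -EL submxE -evK => /matrix0Pn[i [j Eij]].
exists (g * (E *m K) i j); first by rewrite mevalM mulf_neq0 // -evE.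
move=> w Cw; rewrite mevalM mulf_eq0 negb_or => /andP[gw' nz]; have [_ EL' _ _] := fr w Cw gw'.
rewrite -EL' submxE -evK; apply: contra nz => /eqP/matrixP/(_ i j).
by rewrite -evE => ->; rewrite mxE.
Qed.

Lemma fibres_span_open r (U : 'M[F]_(r, d)) : (\rank U < d)%N ->
  exists2 h : {mpoly F[e]}, ~ vanish (cone W) h & forall w, cone W w -> h.@[w 0] != 0 -> ~~ (L w <= U)%MS.
Proof.
move=> rU; have [w Cw wU] := fibres_span S nondegX rU.
by have [h hw hP] := fibre_sub_open Cw wU; exists h => //; apply/not_vanishP; exists w.
Qed.

Lemma zclosed_fibres_in r (U : 'M[F]_(r, d)) : zclosed [set p | W p /\ forall w, coords w p -> (L w <= U)%MS].
Proof.
apply/zclosedP => p v nZ vp; have [Wp|nWp] := pselect (W p); last first.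
  have [h hW hv] := (zclosedP W).1 Wcl p v nWp vp; exists h => // w [q [Wq _] wq].
  by apply: hW; exists q.
have Cv : cone W v by exists p.
have LU : ~~ (L v <= U)%MS.
  apply/negP => LU; apply: nZ; split=> // w wp; have [s s0 ->] := coords_prop vp wp.
  by rewrite (scroll_scale S Cv s0).
have [h hv hP] := fibre_sub_open Cv LU; exists h => // w [q [Wq qU] wq].
apply/eqP; apply: contraT => /hP; rewrite qU // => h1; by apply: h1; exists q.
Qed.

Lemma zclosed_regline D k (l : 'rV[F]_e -> 'rV[F]_D) (M : 'M[F]_(D, k)) : regline (cone W) l ->
  zclosed [set p | W p /\ forall w, coords w p -> l w *m M = 0].
Proof.
move=> [l0 ls lreg]; apply/zclosedP => p v nZ vp; have [Wp|nWp] := pselect (W p); last first.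
  have [h hW hv] := (zclosedP W).1 Wcl p v nWp vp; exists h => // w [q [Wq _] wq].
  by apply: hW; exists q.
have Cv : cone W v by exists p.
have lM : l v *m M != 0.
  apply/eqP => lM; apply: nZ; split=> // w wp; have [s s0 ->] := coords_prop vp wp.
  by have [c ->] := ls v s Cv s0; rewrite -scalemxAl lM scaler0.
have [Q [Q0 QP]] := lreg v Cv; have [c QE] := QP v Cv.
have evQ w : ev w (Q *m map_mx (@mpolyC e F) M) = ev w Q *m M by rewrite evM ev_const.
have /rV0Pn[j qj] : ev v (Q *m map_mx (@mpolyC e F) M) != 0.
  rewrite evQ QE -scalemxAl scaler_eq0 negb_or lM andbT; apply: contra Q0 => /eqP c0.
  by rewrite QE c0 scale0r.
exists ((Q *m map_mx (@mpolyC e F) M) 0 j); last by rewrite -evE.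
move=> w [q [Wq qM] wq]; rewrite -evE evQ; have [|c' ->] := QP w; first by exists q.
by rewrite -scalemxAl qM // scaler0 mxE.
Qed.

End Families.

(** * The pencil of a base point and the frames it induces *)

Section Pencils.
Variable F : closedFieldType.

Definition pen m d (D1 D2 : 'M[F]_(m, d)) (b : 'rV[F]_2) := b 0 0 *: D1 + b 0 1 *: D2.

Lemma penZ m d (D1 D2 : 'M[F]_(m, d)) b c : pen D1 D2 (c *: b) = c *: pen D1 D2 b.
Proof. by apply/matrixP => i j; rewrite !mxE; ring. Qed.

Lemma rV2P (b : 'rV[F]_2) : b 0 0 = 0 -> b 0 1 = 0 -> b = 0.
Proof.
move=> b0 b1; apply/rowP => i; rewrite mxE; case: (unliftP 0 i) => [j|] ->; last by [].
by rewrite -[RHS]b1; congr (b 0 _); rewrite ord1; apply/val_inj.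
Qed.

Lemma rV2_row (b : 'rV[F]_2) : b = row_mx (b 0 0)%:M (b 0 1)%:M :> 'rV_(1 + 1).
Proof.
by apply/rowP => i; rewrite mxE; case: splitP => j; rewrite ord1 mxE eqxx mulr1n => ij; congr (b 0 _); apply/val_inj.
Qed.

Lemma ev_lin_mulmxr e a b c (K : 'M[{mpoly F[e]}]_(b, c)) (w : 'rV[F]_e) :
  ev w (lin_mulmxr K : 'M_(a * b, a * c)) = lin_mulmxr (ev w K).
Proof. by rewrite /lin_mulmxr; apply: map_lin_mx => A; rewrite /= map_mxM. Qed.

Lemma mul_lin_mulmxr a b c (K : 'M[F]_(b, c)) (T : 'M[F]_(a, b)) : mxvec T *m lin_mulmxr K = mxvec (T *m K).
Proof. exact: mul_vec_lin. Qed.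

Lemma nondeg_pen m d (A D1 D2 : 'M[F]_(m.+1, d)) b : nondeg A D1 D2 -> (pen D1 D2 b <= A)%MS -> b = 0.
Proof.
move=> nd bA; have [||[b0 b1]] := nd (delta_mx 0 0) (b 0 0) (b 0 1); last exact: rV2P.
  exact: submx_trans (submxMl _ _) bA.
by move/matrixP/(_ 0 0)/eqP; rewrite !mxE !eqxx oner_eq0.
Qed.

(** Modulo [A] the map b -> pen b is injective, so lying in the pencil is a linear condition [N0] on
    the matrix and [b] is read off by the linear map [Bet]. *)
Lemma pencil_coord m d (A D1 D2 : 'M[F]_(m.+1, d)) : nondeg A D1 D2 ->
  exists k (N0 : 'M[F]_(m.+1 * d, k)) (Bet : 'M[F]_(m.+1 * d, 2)),
   (forall T, mxvec T *m N0 = 0 <-> exists b, ((T - pen D1 D2 b)%R <= A)%MS) /\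
   (forall T b, ((T - pen D1 D2 b)%R <= A)%MS -> mxvec T *m Bet = b).
Proof.
move=> nd; have [K KE] : exists K : 'M[F]_d, forall a (x : 'M[F]_(a, d)), (x <= A)%MS = (x *m K == 0).
  by exists (cokermx A) => a x; rewrite submxE.
have [B BE] : exists B : 'M[F]_(2, m.+1 * d), forall b, b *m B = mxvec (pen D1 D2 b *m K).
  exists (\matrix_(i < 2) mxvec ((if i == 0 then D1 else D2) *m K)) => b.
  rewrite mulmx_sum_row big_ord_recl big_ord1 !rowK /= mulmxDl -!scalemxAl linearD !linearZ /=.
  by congr (_ + b 0 _ *: _); apply/val_inj.
have Bfree : row_free B.
  by apply: row_free_ker => b; rewrite BE => /eqP; rewrite mxvec_eq0 -KE; exact: nondeg_pen.
have EB T b : ((T - pen D1 D2 b)%R <= A)%MS <-> mxvec (T *m K) = b *m B.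
  rewrite KE BE mulmxBl subr_eq0; split=> [/eqP->//|h]; apply/eqP; exact: (can_inj mxvecK).
exists (m.+1 * d)%N, (lin_mulmxr K *m cokermx B), (lin_mulmxr K *m pinvmx B); split=> [T|T b].
  rewrite mulmxA mul_lin_mulmxr; split=> [h|[b /EB->]]; last by rewrite -mulmxA mulmx_coker mulmx0.
  have /submxP[b bE] : (mxvec (T *m K) <= B)%MS by rewrite submxE h.
  by exists b; apply/EB.
by move=> /EB h; rewrite mulmxA mul_lin_mulmxr h -mulmxA mulmxVp // mulmx1.
Qed.

(** Two members that are not proportional would put [D1] and [D2], hence everything, into the proper
    subspace [U]. *)
Lemma pencil_uniq m d r (A D1 D2 : 'M[F]_(m.+1, d)) (U : 'M[F]_(r, d)) b b' : row_full (A + D1 + D2)%MS ->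
  (\rank U < d)%N -> (A <= U)%MS -> b != 0 ->
  (pen D1 D2 b <= U)%MS -> (pen D1 D2 b' <= U)%MS -> exists c, b' = c *: b.
Proof.
move=> full rU AU b0 bU b'U; apply/sub_rVP; apply: wedge_sub => //.
suff D0 : b 0 0 * b' 0 1 = b 0 1 * b' 0 0.
  move=> i j; have [->|->] := ord2P i; have [->|->] := ord2P j => //; first by rewrite mulrC -D0 mulrC.
  by rewrite mulrC D0 mulrC.
apply/eqP; rewrite -subr_eq0; apply: contraTT rU => D0; rewrite -leqNgt.
apply: (@leq_trans (\rank (A + D1 + D2)%MS)); first by rewrite (eqP full).
apply: mxrankS.
rewrite !addsmx_sub AU /=; apply/andP; split.
  rewrite -[D1]scale1r -(mulVf D0) -scalerA scalemx_sub //.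
  have -> : (b 0 0 * b' 0 1 - b 0 1 * b' 0 0) *: D1 = b' 0 1 *: pen D1 D2 b - b 0 1 *: pen D1 D2 b'.
    by apply/matrixP => i j; rewrite !mxE; ring.
  by rewrite addmx_sub ?eqmx_opp ?scalemx_sub.
rewrite -[D2]scale1r -(mulVf D0) -scalerA scalemx_sub //.
have -> : (b 0 0 * b' 0 1 - b 0 1 * b' 0 0) *: D2 = b 0 0 *: pen D1 D2 b' - b' 0 0 *: pen D1 D2 b.
  by apply/matrixP => i j; rewrite !mxE; ring.
by rewrite addmx_sub ?eqmx_opp ?scalemx_sub.
Qed.

Variables (d e m : nat) (CW : set 'rV[F]_e) (CX : set 'rV[F]_d) (L : 'rV[F]_e -> 'M[F]_d).
Hypothesis S : scroll CX CW L.
Hypothesis iW : irr CW.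
Hypothesis CWs : forall s w, CW w -> s != 0 -> CW (s *: w).
Hypothesis CW0 : forall w, CW w -> w != 0.
Hypothesis frames : local_frames m CX CW L.
Hypothesis secX : tangent_sums_le (m.+1 + m.+1).+2 CX.
Hypothesis dimV : ((m.+1 + m.+1).+2 < d)%N.

Definition full_at w (A D1 D2 : 'M[F]_(m.+1, d)) := frame_at CX L w A D1 D2 /\ row_full (A + D1 + D2)%MS.

Hypothesis full_ex : exists w (A D1 D2 : 'M[F]_(m.+1, d)),
  [/\ CW w, frame_at CX L w A D1 D2 & row_full (A + D1 + D2)%MS].

Lemma full_open : exists2 h : {mpoly F[e]}, ~ vanish CW h & forall w, CW w -> h.@[w 0] != 0 ->
  exists A D1 D2, full_at w A D1 D2.
Proof.
have [w0 [A0 [D01 [D02 [Cw0 fr0 full0]]]]] := full_ex; have [g [E [D1 [D2 [gw fr]]]]] := frames Cw0.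
pose M := col_mx (col_mx E D1) D2.
have evM' w : (ev w M :=: ev w E + ev w D1 + ev w D2)%MS.
  rewrite /M !ev_col_mx; apply: eqmx_trans (eqmx_sym (addsmxE _ _)) _.
  by apply: adds_eqmx (eqmx_refl _); apply: eqmx_sym; exact: addsmxE.
have [|h hw hP] := @rank_open F e _ d d M w0.
  apply: (@leq_trans (\rank (A0 + D01 + D02)%MS)); first by rewrite (eqP full0).
  by rewrite evM'; apply: mxrankS; exact: osc_le fr0 (fr w0 Cw0 gw).
exists (g * h); first by apply/not_vanishP; exists w0; rewrite // mevalM mulf_neq0.
move=> w Cw; rewrite mevalM mulf_eq0 negb_or => /andP[gw' /hP]; rewrite evM' => r.
exists (ev w E), (ev w D1), (ev w D2); split; first exact: fr.
by rewrite /row_full eqn_leq rank_leq_col r.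
Qed.

Variables (w0 : 'rV[F]_e) (A D1 D2 : 'M[F]_(m.+1, d)).
Hypothesis Cw0 : CW w0.
Hypothesis full0 : full_at w0 A D1 D2.

Definition away : set 'rV[F]_e := [set w | CW w /\ ~ exists c, w = c *: w0].

Lemma away_scale s w : away w -> s != 0 -> away (s *: w).
Proof.
move=> [Cw ne] s0; split; first exact: CWs.
move=> [c cE]; apply: ne; exists (s^-1 * c); by rewrite -scalerA -cE scalerA mulVf ?scale1r.
Qed.

Lemma fibre_rankE w : CW w -> \rank (L w) = m.+1.
Proof.
move=> Cw; have [g [E [E1 [E2 [gw /(_ w Cw gw) [Efree EL _ _]]]]]] := frames Cw.
by rewrite -EL (eqP Efree).
Qed.

(** When both osculating spaces are all of V, the other cases of [fibre_pair] would bound dim V by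
    [(m.+1 + m.+1).+2]. *)
Lemma pencil_ex_full w B B1 B2 : away w -> full_at w B B1 B2 ->
  exists2 b, b != 0 & (pen D1 D2 b <= A + L w)%MS.
Proof.
move=> [Cw ne] [frw fullw]; have [fr full] := full0; have [_ BL _ _] := frw.
have rB : \rank (B + B1 + B2)%MS = d by exact/eqP.
have rA : \rank (A + D1 + D2)%MS = d by exact/eqP.
have [[_ [b1 [b2 [b0 bD]]]]|[rO _]|[rO _]|[H [rH H0 _]]] := fibre_pair S secX Cw0 Cw ne fr frw.
- exists (\row_i if i == 0 then b1 else b2).
    apply: contra b0 => /eqP/rowP b0; have := b0 0; have := b0 1; rewrite !mxE /= => -> ->; exact: eqxx.
  by rewrite /pen !mxE /= -(adds_eqmx (eqmx_refl A) BL).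
- by exfalso; have := dimV; move: rA; rewrite rO; clear; lia.
- by exfalso; have := dimV; move: rB; rewrite rO; clear; lia.
- by have := leq_trans (mxrankS H0) rH; rewrite rA leqNgt dimV.
Qed.

Lemma away_free w g (E E1 E2 : 'M[{mpoly F[e]}]_(m.+1, d)) : away w -> g.@[w 0] != 0 ->
  (forall w, CW w -> g.@[w 0] != 0 -> frame_at CX L w (ev w E) (ev w E1) (ev w E2)) ->
  row_free (ev w (col_mx (map_mx (@mpolyC e F) A) E)).
Proof.
move=> [Cw ne] gw /(_ w Cw gw)[Efree EL _ _]; have [[Afree AL _ _] _] := full0.
rewrite ev_col_mx ev_const /row_free -addsmxE.
have := mxrank_sum_cap A (ev w E); rewrite (eqP Afree) (eqP Efree) => <-.
by rewrite (cap_eqmx AL EL) (fibres_disjoint S Cw0 Cw ne) mxrank0 addn0.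
Qed.

(* The condition is closed in [w] and holds on the dense set of fully osculating points. *)
Lemma pencil_ex w : away w -> exists2 b, b != 0 & (pen D1 D2 b <= A + L w)%MS.
Proof.
move=> aw; have [Cw ne] := aw; have [g [E [E1 [E2 [gw fr]]]]] := frames Cw.
have [g1 [K [g1w KP]]] := coker_poly (away_free aw gw fr).
pose cst (M : 'M[F]_(m.+1, d)) := map_mx (@mpolyC e F) M.
pose B := col_mx (mxvec (cst D1 *m K)) (mxvec (cst D2 *m K)).
have BE (v : 'rV[F]_e) b : g1.@[v 0] != 0 -> CW v -> g.@[v 0] != 0 ->
    (pen D1 D2 b <= A + L v)%MS <-> b *m ev v B = 0.
  move=> g1v Cv gv; have [_ EL _ _] := fr v Cv gv; have [_ KE] := KP v g1v.
  have -> : b *m ev v B = mxvec (pen D1 D2 b *m ev v K).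
    rewrite ev_col_mx; have := mul_row_col (b 0 0)%:M (b 0 1)%:M (ev v (mxvec (cst D1 *m K))) (ev v (mxvec (cst D2 *m K))).
    rewrite -rV2_row => ->; rewrite !mul_scalar_mx !ev_mxvec !evM !ev_const /pen mulmxDl -!scalemxAl.
    by rewrite linearD !linearZ.
  rewrite -(adds_eqmx (eqmx_refl A) EL) addsmxE -{1}(ev_const v A) -ev_col_mx -(KE _ (pen D1 D2 b)).
  by split=> [->|/eqP]; [rewrite linear0 | rewrite mxvec_eq0 => /eqP].
have [r1|r2] := leqP (\rank (ev w B)) 1.
  have : kermx (ev w B) != 0.
    by rewrite kermx_eq0 /row_free neq_ltn (leq_ltn_trans r1).
  by move=> /rowV0Pn[b /sub_kermxP bB b0]; exists b => //; exact/BE.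
(* Were the rank 2 at [w], it would be 2 at a general point, where [pencil_ex_full] provides a
   kernel vector. *)
have [h hw hP] := rank_open r2; have [f fW fP] := full_open.
have [|v Cv [v1 v2]] := irr_nonvanish iW (f := g * g1 * h) _ fW.
  by apply/not_vanishP; exists w; rewrite // !mevalM !mulf_neq0.
move: v1; rewrite !mevalM !mulf_eq0 !negb_or => /andP[/andP[gv g1v] hv].
have [B0 [B1 [B2 fullv]]] := fP v Cv v2.
have av : away v.
  split=> // -[c vE]; have c0 : c != 0 by apply: contraNneq (CW0 Cv) => c0; rewrite vE c0 scale0r.
  have [fr1 KE] := KP v g1v; move: fr1; rewrite ev_col_mx ev_const /row_free -addsmxE.
  have [_ EL _ _] := fr v Cv gv; have [[Afree AL _ _] _] := full0.
  have EA : (ev v E <= A)%MS by rewrite EL AL vE (scroll_scale S Cw0 c0).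
  rewrite (addsmx_idPl EA) (eqP Afree); by rewrite eq_sym -[X in _ == X]addn0 eqn_add2l.
have [b b0 bP] := pencil_ex_full av fullv; have bB := (BE v b g1v Cv gv).1 bP.
have := hP v hv; rewrite ltnNge; case/negP; rewrite -ltnS ltn_neqAle rank_leq_row andbT.
by apply: contra b0 => fr2; apply/eqP; apply: (row_free_inj fr2); rewrite bB mul0mx.
Qed.

(** Split a member of the pencil along the direct sum of [A] and [L w]; the component in [L w] is
    the frame. It is unique up to a scalar because [b] is, by [pencil_uniq]. *)
Lemma pencil_line : exists tau : 'rV[F]_e -> 'M[F]_(m.+1, d), forall w, away w ->
  [/\ row_free (tau w), (tau w :=: L w)%MS, exists2 b, b != 0 & ((tau w - pen D1 D2 b)%R <= A)%MS &
    forall T b, (T <= L w)%MS -> ((T - pen D1 D2 b)%R <= A)%MS -> exists c, T = c *: tau w].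
Proof.
have [[Afree AL nd _] full] := full0.
suff h w : exists T : 'M[F]_(m.+1, d), away w ->
    [/\ row_free T, (T :=: L w)%MS, exists2 b, b != 0 & ((T - pen D1 D2 b)%R <= A)%MS &
    forall T' b, (T' <= L w)%MS -> ((T' - pen D1 D2 b)%R <= A)%MS -> exists c, T' = c *: T].
  by have [tau tauP] := choice h; exists tau.
have [aw|naw] := pselect (away w); last by exists 0.
have [Cw ne] := aw; have [b b0 bP] := pencil_ex aw; have /sub_addsmxP[[u v] /= bE] := bP.
pose T := pen D1 D2 b - u *m A; have TE : T = v *m L w by rewrite /T bE addrC addKr.
have TA : ((T - pen D1 D2 b)%R <= A)%MS by rewrite /T addrAC subrr sub0r eqmx_opp submxMl.
have TL : (T <= L w)%MS by rewrite TE submxMl.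
have Tfree : row_free T.
  apply: row_free_ker => c /eqP; rewrite mulmxBr subr_eq0 => /eqP cE.
  have [||[c0 c1]] // := nd c (b 0 0) (b 0 1).
    by rewrite -/(pen D1 D2 b) cE mulmxA submxMl.
  by move: b0; rewrite (rV2P c0 c1) eqxx.
exists T => _; split=> //.
- by apply/eqmxP; rewrite -(geq_leqif (mxrank_leqif_eq TL)) (eqP Tfree) fibre_rankE.
- by exists b.
move=> T' b' T'L T'A; have [c cE] : exists c, b' = c *: b.
  apply: (@pencil_uniq m d d A D1 D2 (A + L w)%MS) => //; last 2 first.
  - exact: addsmxSl.
  - by rewrite -(subKr T' (pen D1 D2 b')) addmx_sub ?eqmx_opp // (submx_trans T'L, submx_trans T'A) ?addsmxSr ?addsmxSl.
  have := mxrank_adds_leqif A (L w); rewrite (eqP Afree) fibre_rankE // => -[le _].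
  by apply: leq_ltn_trans le _; move: dimV; clear; lia.
exists c; apply/eqP; rewrite -subr_eq0 -submx0 -(fibres_disjoint S Cw0 Cw ne) sub_capmx; apply/andP; split; last first.
  by rewrite addmx_sub ?eqmx_opp ?scalemx_sub.
rewrite -AL; have -> : T' - c *: T = (T' - pen D1 D2 b') - c *: (T - pen D1 D2 b).
  by rewrite cE penZ; apply/matrixP => i j; rewrite !mxE; ring.
by rewrite addmx_sub ?eqmx_opp ?scalemx_sub.
Qed.

Lemma pencil_at : exists (tau : 'rV[F]_e -> 'M[F]_(m.+1, d)) (beta : 'rV[F]_e -> 'rV[F]_2), [/\
  forall w, away w -> [/\ beta w != 0, row_free (tau w), (tau w :=: L w)%MS &
    ((tau w - pen D1 D2 (beta w))%R <= A)%MS],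
  forall w T b, away w -> (T <= L w)%MS -> ((T - pen D1 D2 b)%R <= A)%MS -> exists c, T = c *: tau w,
  regline away (fun w => mxvec (tau w)) & regline away beta].
Proof.
have [tau tauP] := pencil_line; have [[Afree AL nd _] full] := full0.
have [k [N0 [Bet [N0E BetE]]]] := pencil_coord nd.
pose beta w := mxvec (tau w) *m Bet.
have betaP w : away w -> beta w != 0 /\ ((tau w - pen D1 D2 (beta w))%R <= A)%MS.
  by move=> /tauP[_ _ [b b0 bA] _]; rewrite /beta (BetE _ _ bA).
have reg : regline away (fun w => mxvec (tau w)).
  apply: regline_kernel => [w /tauP[fr _ _ _]|w s aw s0|w aw].
  - rewrite mxvec_eq0; apply: contraTneq fr => ->; by rewrite /row_free mxrank0.
  - have [_ tL [b _ bA] _] := tauP _ (away_scale aw s0); have [_ _ _ h] := tauP w aw.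
    have [|c ->] := h (tau (s *: w)) b _ bA; last by exists c; rewrite linearZ.
    by rewrite tL (scroll_scale S aw.1 s0).
  have [Cw ne] := aw; have [g [E [E1 [E2 [gw fr]]]]] := frames Cw.
  have [Efree _ _ _] := fr w Cw gw; have [g1 [K [g1w KP]]] := coker_poly Efree.
  pose cN0 := map_mx (@mpolyC e F) N0.
  exists _, (row_mx (lin_mulmxr K : 'M_(m.+1 * d, m.+1 * d)) cN0), (g * g1); split; first by rewrite mevalM mulf_neq0.
  move=> v av; rewrite mevalM mulf_eq0 negb_or => /andP[gv g1v] x; rewrite ev_row_mx ev_const ev_lin_mulmxr.
  have [T ->] : exists T, x = mxvec T by exists (vec_mx x); rewrite vec_mxK.
  have [_ EL _ _] := fr v av.1 gv; have [_ KE] := KP v g1v; rewrite mul_mx_row mul_lin_mulmxr.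
  have [_ tL [b _ bA] h] := tauP v av; split.
    rewrite -[X in _ = X]row_mx0 => /eq_row_mx[/eqP]; rewrite mxvec_eq0 => /eqP/KE.
    by rewrite EL => TL /N0E[b' b'A]; have [c ->] := h T b' TL b'A; exists c; rewrite linearZ.
  move=> [c cE]; have -> : T = c *: tau v by apply: (can_inj mxvecK); rewrite cE linearZ.
  have -> : c *: tau v *m ev v K = 0 by apply/KE; rewrite EL -tL scalemx_sub.
  have -> : mxvec (c *: tau v) *m N0 = 0.
    by apply/N0E; exists (c *: b); rewrite penZ -scalerBr scalemx_sub.
  by rewrite linear0 row_mx0.
exists tau, beta; split=> //.
- by move=> w aw; have [b0 bA] := betaP w aw; have [fr tL _ _] := tauP w aw.
- by move=> w T b aw TL TA; have [_ _ _ h] := tauP w aw; exact: h TL TA.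
- by apply: regline_lin => // w /betaP[].
Qed.

End Pencils.

(** * Comparison of the frames from two base points *)

Section Gauge.
Variable F : closedFieldType.
Hypothesis charF : [pchar F] =i pred0.
Hypothesis pigeonF : has_large_fibres F.

Lemma linform_homog d (c : 'cV[F]_d) : linmap c 0 0 \is 1.-homog.
Proof.
rewrite mxE; apply: rpred_sum => k _; rewrite !mxE mulrC mul_mpolyC; apply: dhomogZ.
by rewrite dhomogX /= mdeg1.
Qed.

(** If the linear form had no zero on the image, [regline_const] would make the injective map
    constant. *)
Lemma curve_meets e D (Y : set (Proj F e)) (l : 'rV[F]_e -> 'rV[F]_D) (c : 'cV[F]_D) : zclosed Y -> irreducible Y ->
  (forall v1, exists2 v, cone Y v & ~ exists s, v = s *: v1) -> regline (cone Y) l ->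
  (forall w w', cone Y w -> cone Y w' -> (exists s, l w' = s *: l w) -> exists s, w' = s *: w) ->
  exists2 w, cone Y w & l w *m c = 0.
Proof.
move=> Ycl Yirr Y2 reg inj; apply: contrapT => no.
have [v1 Cv1 _] := Y2 0; have [v Cv nv] := Y2 v1; apply: nv; apply: inj => //.
apply: (regline_const pigeonF Ycl Yirr reg (linform_homog c)) => // w Cw; rewrite -evE ev_linmap.
by apply/eqP => h; apply: no; exists w => //; apply/matrixP => i j; rewrite !ord1 h mxE.
Qed.

Lemma fibre_curve_closed e (W : set (Proj F e)) (p q f : {mpoly F[e]}) (bad : seq F) : zclosed W -> irr (cone W) ->
  (forall t (Y : 'M[F]_(e, t)), algind (cone W) Y -> (t <= 3)%N) ->
  (forall z, cone W z -> exists U : 'M[F]_(3, e), tframe (cone W) z U) ->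
  (forall a b, (a, b) != (0, 0) -> ~ vanish (cone W) (a%:MP * p + b%:MP * q)) -> ~ vanish (cone W) f ->
  exists lam C', [/\ lam \notin bad, irr C', (forall v, C' v -> v != 0 -> cone W v),
    (forall v, C' v -> p.@[v 0] = lam * q.@[v 0]) & ~ vanish C' f] /\
    [/\ zclosed (zero_set C'), irreducible (zero_set C') &
      forall v1, exists2 v, cone (zero_set C') v & ~ exists s, v = s *: v1].
Proof.
move=> Wcl iW indW tW pq fW.
have [|l|lam [C' [Y [lb iC' CC' pqE [fC' indY]]]]] := @fibre_curve F charF pigeonF e (cone W) p q f bad iW indW tW _ _ fW.
- have : (0, 1) != (0, 0) :> F * F by rewrite xpair_eqE oner_eq0 andbF.
  by move=> /pq; rewrite mpolyC0 mul0r add0r mpolyC1 mul1r.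
- have : (1, - l) != (0, 0) :> F * F by rewrite xpair_eqE oner_eq0.
  by move=> /pq; rewrite mpolyC1 mul1r mpolyCN mulNr.
exists lam, C'; split; split=> //.
- by move=> v Cv v0; apply: cone_closed => // g gW; exact: CC' Cv.
- exact: zclosed_zeros.
- exact: zero_set_irreducible indY.
move=> v1; have [v Cv nv] := algind2_two_points v1 indY; exists v => //.
have v0 : v != 0 by apply/eqP => v0; apply: nv; exists 0; rewrite v0 scale0r.
by have [r vr] := coords_ex v0; exists r => //; exact: zero_set_cone vr.
Qed.

Variables (d e m : nat) (W : set (Proj F e)) (CX : set 'rV[F]_d) (L : 'rV[F]_e -> 'M[F]_d).
Hypothesis Wcl : zclosed W.
Hypothesis S : scroll CX (cone W) L.
Hypothesis iW : irr (cone W).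
Hypothesis indW : forall t (Y : 'M[F]_(e, t)), algind (cone W) Y -> (t <= 3)%N.
Hypothesis tW : forall z, cone W z -> exists U : 'M[F]_(3, e), tframe (cone W) z U.
Hypothesis frames : local_frames m CX (cone W) L.
Hypothesis secX : tangent_sums_le (m.+1 + m.+1).+2 CX.
Hypothesis dimV : ((m.+1 + m.+1).+2 < d)%N.
Hypothesis nondegX : spanning CX.
Hypothesis full_ex : exists w (A D1 D2 : 'M[F]_(m.+1, d)),
  [/\ cone W w, frame_at CX L w A D1 D2 & row_full (A + D1 + D2)%MS].

Let CWs s w : cone W w -> s != 0 -> cone W (s *: w). Proof. exact: cone_scale. Qed.
Let CW0 w : cone W w -> w != 0. Proof. exact: cone_neq0. Qed.

Lemma away_sym w w' : away (cone W) w w' -> cone W w -> away (cone W) w' w.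
Proof.
move=> [Cw' ne] Cw; split=> // -[c wE]; have c0 : c != 0.
  by apply: contraNneq (CW0 Cw) => c0; rewrite wE c0 scale0r.
by apply: ne; exists c^-1; rewrite wE scalerA mulVf ?scale1r.
Qed.

Lemma away_fibre w w' : cone W w -> cone W w' -> ~~ (L w' <= L w)%MS -> away (cone W) w w'.
Proof.
move=> Cw Cw' nL; split=> // -[c wE]; have c0 : c != 0.
  by apply: contraNneq (CW0 Cw') => c0; rewrite wE c0 scale0r.
by move: nL; rewrite wE (scroll_scale S Cw c0) submx_refl.
Qed.

Lemma pencil_rank (A D1 D2 : 'M[F]_(m.+1, d)) b : (\rank (A + pen D1 D2 b)%MS < d)%N.
Proof.
have := mxrank_adds_leqif A (pen D1 D2 b) => -[le _]; apply: leq_ltn_trans le _.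
by have := rank_leq_row A; have := rank_leq_row (pen D1 D2 b); move: dimV; clear; lia.
Qed.

Lemma pencil_mem (A D1 D2 T : 'M[F]_(m.+1, d)) (b b' : 'rV[F]_2) : row_full (A + D1 + D2)%MS ->
  ((T - pen D1 D2 b)%R <= A)%MS -> b' != 0 -> (T <= A + pen D1 D2 b')%MS <-> exists c, b = c *: b'.
Proof.
move=> full TA b'0; split=> [TU|[c bE]].
  apply: (@pencil_uniq _ m d d A D1 D2 (A + pen D1 D2 b')%MS) => //; rewrite ?addsmxSl ?addsmxSr ?pencil_rank //.
  by rewrite -(subKr T (pen D1 D2 b)) addmx_sub // eqmx_opp (submx_trans TA) ?addsmxSl.
rewrite -(subrK (pen D1 D2 b) T) addmx_sub ?(submx_trans TA) ?addsmxSl //.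
by rewrite bE penZ scalemx_sub // addsmxSr.
Qed.

Section TwoPencils.
Variables (w0 w1 : 'rV[F]_e) (tau0 tau1 : 'rV[F]_e -> 'M[F]_(m.+1, d)).
Let C0 := away (cone W) w0.
Let C1 := away (cone W) w1.
Let C01 := C0 `&` C1.
Hypothesis tau0P : forall w, C0 w -> row_free (tau0 w) /\ (tau0 w :=: L w)%MS.
Hypothesis tau1P : forall w, C1 w -> row_free (tau1 w) /\ (tau1 w :=: L w)%MS.
Hypothesis reg0 : regline C0 (fun w => mxvec (tau0 w)).
Hypothesis reg1 : regline C1 (fun w => mxvec (tau1 w)).

Definition gauge w := tau1 w *m pinvmx (tau0 w).

Lemma gaugeP w : C01 w -> gauge w *m tau0 w = tau1 w /\ gauge w \in unitmx.
Proof.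
move=> [/tau0P[fr0 L0] /tau1P[fr1 L1]]; have E : gauge w *m tau0 w = tau1 w.
  by rewrite /gauge mulmxKpV // L0 L1.
split=> //; rewrite -row_free_unit /row_free eqn_leq rank_leq_row /= -{1}(eqP fr1) -E.
exact: mxrankM_maxl.
Qed.

Lemma gauge_regline : regline C01 (fun w => mxvec (gauge w)).
Proof.
have [_ sc0 loc0] := reg0; have [_ sc1 loc1] := reg1; split.
- move=> w /gaugeP[_]; rewrite mxvec_eq0; apply: contraTneq => ->.
  by rewrite unitmxE det0 unitfE eqxx.
- move=> w s [a0 a1] s0; have [c0 /(can_inj mxvecK)E0] : exists c, mxvec (tau0 (s *: w)) = mxvec (c *: tau0 w).
    by have [c ->] := sc0 w s a0 s0; exists c; rewrite linearZ.
  have [c1 /(can_inj mxvecK)E1] : exists c, mxvec (tau1 (s *: w)) = mxvec (c *: tau1 w).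
    by have [c ->] := sc1 w s a1 s0; exists c; rewrite linearZ.
  have as01 : C01 (s *: w) by split; apply: away_scale.
  have [Gs _] := gaugeP as01; have [Gw _] := gaugeP (conj a0 a1); have [fr0 _] := tau0P a0.
  have c00 : c0 != 0.
    have [fr _] := tau0P as01.1; apply: contraTneq fr => c00.
    by rewrite E0 c00 scale0r /row_free mxrank0.
  exists (c1 / c0); rewrite -linearZ; congr mxvec; apply: (row_free_inj fr0).
  rewrite -scalemxAl Gw; apply: (can_inj (scalerK c00)).
  by rewrite scalemxAr -E0 Gs E1 scalerA mulrC divfK.
move=> w [a0 a1]; have [Q0 [Q0w Q0P]] := loc0 w a0; have [Q1 [Q1w Q1P]] := loc1 w a1.
have vecP (Q : 'rV[{mpoly F[e]}]_(m.+1 * d)) t v c : ev v Q = c *: mxvec t -> ev v (vec_mx Q) = c *: t.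
  by move=> QE; rewrite /ev map_vec_mx -/(ev v Q) QE linearZ /= mxvecK.
have nz (Q : 'rV[{mpoly F[e]}]_(m.+1 * d)) t c : ev w Q != 0 -> ev w Q = c *: mxvec t -> c != 0.
  by move=> Qw QE; apply: contraNneq Qw => c0'; rewrite QE c0' scale0r.
have [fr0 _] := tau0P a0; have [c0 E0] := Q0P w a0; have [c1 E1] := Q1P w a1.
have c00 := nz _ _ _ Q0w E0; have c10 := nz _ _ _ Q1w E1.
(* [Z] is a right inverse at [w] only, but it makes the frames square, so that the adjugate
   expresses the gauge by polynomials nearby. *)
have [Z tZ] : exists Z, tau0 w *m Z = 1%:M by exists (pinvmx (tau0 w)); exact: mulmxVp.
have [N NE] : exists N : 'M[{mpoly F[e]}]_m.+1, forall v, ev v N = ev v (vec_mx Q0) *m Z.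
  by exists (vec_mx Q0 *m map_mx (@mpolyC e F) Z) => v; rewrite evM ev_const.
have [P PE] : exists P : 'M[{mpoly F[e]}]_m.+1, forall v, ev v P = ev v (vec_mx Q1) *m Z.
  by exists (vec_mx Q1 *m map_mx (@mpolyC e F) Z) => v; rewrite evM ev_const.
have key v : C01 v -> exists k k', [/\ ev v Q0 = k *: mxvec (tau0 v), ev v Q1 = k' *: mxvec (tau1 v) &
    ev v (\det N *: (P *m \adj N)) = (\det (ev v N) * (k' / k * \det (ev v N))) *: gauge v].
  move=> [b0 b1]; have [k kE] := Q0P v b0; have [k' k'E] := Q1P v b1; exists k, k'; split=> //.
  rewrite evZ evM ev_det ev_adj PE (vecP _ _ _ _ k'E); have NvE := NE v; rewrite (vecP _ _ _ _ kE) in NvE.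
  have [k0|k0] := eqVneq k 0; first by rewrite NvE k0 scale0r mul0mx det0 mul0r !scale0r.
  have [Gv _] := gaugeP (conj b0 b1); have -> : k' *: tau1 v *m Z = (k' / k) *: (gauge v *m ev v N).
    by rewrite NvE -Gv -!scalemxAl -scalemxAr scalerA divfK // mulmxA.
  by rewrite -scalemxAl -mulmxA mul_mx_adj mul_mx_scalar !scalerA !mulrA.
exists (mxvec (\det N *: (P *m \adj N))); split; last first.
  by move=> v Cv; have [k [k' [_ _ QE]]] := key v Cv; rewrite ev_mxvec QE linearZ; eexists.
have [k [k' [kE k'E QE]]] := key w (conj a0 a1); have [_ Gu] := gaugeP (conj a0 a1).
have k0 := nz _ _ _ Q0w kE; have k'0 := nz _ _ _ Q1w k'E.
have dN : \det (ev w N) != 0.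
  by rewrite NE (vecP _ _ _ _ kE) -scalemxAl tZ detZ det1 mulr1 expf_neq0.
rewrite ev_mxvec QE mxvec_eq0 scaler_eq0 negb_or !mulf_neq0 ?invr_eq0 //=.
by apply: contraTneq Gu => ->; rewrite unitmxE det0 unitfE eqxx.
Qed.

Variables (A0 D01 D02 : 'M[F]_(m.+1, d)) (beta0 : 'rV[F]_e -> 'rV[F]_2).
Hypothesis Cw0 : cone W w0.
Hypothesis Cw1 : cone W w1.
Hypothesis full0 : full_at CX L w0 A0 D01 D02.
Hypothesis beta0P : forall w, C0 w -> beta0 w != 0 /\ ((tau0 w - pen D01 D02 (beta0 w))%R <= A0)%MS.
Hypothesis regb0 : regline C0 beta0.

Variables (w3 : 'rV[F]_e) (A3 D31 D32 : 'M[F]_(m.+1, d)).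
Variables (tau3 : 'rV[F]_e -> 'M[F]_(m.+1, d)) (beta3 : 'rV[F]_e -> 'rV[F]_2).
Let C3 := away (cone W) w3.
Hypothesis Cw3 : C01 w3.
Hypothesis full3 : full_at CX L w3 A3 D31 D32.
Hypothesis beta3P : forall w, C3 w -> [/\ beta3 w != 0, (tau3 w :=: L w)%MS & ((tau3 w - pen D31 D32 (beta3 w))%R <= A3)%MS].
Hypothesis regb3 : regline C3 beta3.

(* On the curve of all fibres inside a fixed member of the pencil of [w3], which avoids [w0] *)
(* and [w1] but contains [w3], the gauge has nowhere vanishing determinant, hence is constant. *)
Lemma gauge_const w : C01 w -> exists c, gauge w = c *: gauge w3.
Proof.
move=> C01w; have [// |nG] := pselect (exists c, gauge w = c *: gauge w3).
have C3w : C3 w.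
  split; first by case: C01w => -[].
  move=> [c wE]; apply: nG; have c0 : c != 0 by apply: contraNneq (CW0 C01w.1.1) => c0; rewrite wE c0 scale0r.
  have [_ sc _] := gauge_regline; have [s sE] := sc w3 c Cw3 c0; exists s.
  by rewrite wE; apply: (can_inj mxvecK); rewrite sE linearZ.
have Gw3 : gauge w3 != 0.
  by have [_] := gaugeP Cw3; apply: contraTneq => ->; rewrite unitmxE det0 unitfE eqxx.
have [f fw fP] : exists2 f : {mpoly F[e]}, f.@[w 0] != 0 & forall v, C01 v -> f.@[v 0] != 0 ->
    ~ exists c, gauge v = c *: gauge w3.
  have [_ _ loc] := gauge_regline; have [Q [Qw QP]] := loc w C01w.
  pose G := mxvec (gauge w3); have G0 : G != 0 by rewrite mxvec_eq0.
  have [i [j ij]] : exists i j, ev w Q 0 i * G 0 j - ev w Q 0 j * G 0 i != 0.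
    apply: contrapT => h; apply: nG; have [c cE] := QP w C01w.
    have c0 : c != 0 by apply: contraNneq Qw => c0; rewrite cE c0 scale0r.
    have /sub_rVP[k kE] : (ev w Q <= G)%MS.
      apply: wedge_sub => // i j; apply/eqP; rewrite -subr_eq0; apply/negPn/negP => ne.
      by apply: h; exists i, j.
    exists (k / c); apply: (can_inj mxvecK); rewrite linearZ /= -/G mulrC -scalerA -kE cE scalerA mulVf //.
    by rewrite scale1r.
  exists (Q 0 i * (G 0 j)%:MP - Q 0 j * (G 0 i)%:MP); first by rewrite mevalB !mevalM !mevalC -!evE.
  move=> v Cv; rewrite mevalB !mevalM !mevalC -!evE; have [c ->] := QP v Cv => ne [k kE].
  by case/eqP: ne; rewrite kE linearZ /= -/G !mxE; ring.
have [_ _ locb] := regb3; have [Q [Qw QP]] := locb w C3w; have [k Qk] := rV0Pn _ Qw; rewrite evE in Qk.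
have [i wi] := rV0Pn _ (CW0 C3w.1).
pose slope (b : 'rV[F]_2) := b 0 0 / b 0 1.
have [||lam [C' [[lb iC' C'W pqE fC'] [Ycl Yirr Y2]]]] := @fibre_curve_closed e W (Q 0 0) (Q 0 1) (f * Q 0 k * 'X_i)
    [:: slope (beta3 w0); slope (beta3 w1)] Wcl iW indW tW.
(* A linear relation between the two coordinates would put general fibres into one proper member of
   the pencil of [w3], although the fibres span V. *)
- move=> a b ab van; pose lv : 'rV[F]_2 := \row_i if i == 0 then - b else a.
  have lv0 : lv != 0.
    apply: contra ab => /eqP/rowP lv0; have := lv0 0; have := lv0 1; rewrite !mxE /= => -> /eqP.
    by rewrite oppr_eq0 => /eqP->.
  have [h hW hP] := fibres_span_open S frames nondegX (pencil_rank A3 D31 D32 lv).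
  have [|v Cv [hv Qv]] := irr_nonvanish iW hW (g := Q 0 k); first by apply/not_vanishP; exists w => //; exact: C3w.1.
  have [fr3 f3] := full3; have [_ A3L _ _] := fr3.
  have C3v : C3 v.
    apply: away_fibre => //; first exact: Cw3.1.1.
    apply: contra (hP v Cv hv) => /submx_trans; apply; by rewrite -A3L addsmxSl.
  have [b30 tL tA] := beta3P C3v; case/negP: (hP v Cv hv); rewrite -tL; apply/(pencil_mem f3 tA lv0).
  have [c QE] := QP v C3v; have c0 : c != 0.
    by apply: contraNneq Qv => c0; rewrite -evE QE c0 scale0r mxE.
  have van' := van v Cv; rewrite mevalD !mevalM !mevalC -!evE QE !mxE in van'.
  apply/sub_rVP/wedge_sub => // i' j'.
  have rel : a * beta3 v 0 0 + b * beta3 v 0 1 = 0 by apply: (mulfI c0); rewrite mulr0 -van'; ring.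
  apply/eqP; rewrite -subr_eq0; apply/eqP.
  by have [->|->] := ord2P i'; have [->|->] := ord2P j'; rewrite !mxE /=; first [ring | rewrite -[RHS]rel; ring | rewrite -[RHS]oppr0 -rel; ring].
- by apply/not_vanishP; exists w; [exact: C3w.1 | rewrite !mevalM !mulf_neq0 // mevalXU].
pose lv : 'rV[F]_2 := \row_i if i == 0 then lam else 1; have lv1 : lv 0 1 = 1 by rewrite mxE.
have lv0 : lv != 0 by apply/rV0Pn; exists 1; rewrite lv1 oner_eq0.
have [fr3 f3] := full3; have [_ A3L _ _] := fr3; have [fr0 f0] := full0; have [_ A0L _ _] := fr0.
(* As [lam] avoids the slopes of [w0] and [w1], their fibres are not in [U], and both frames exist
   all along the curve. *)
pose U := (A3 + pen D31 D32 lv)%MS; pose Z := [set p | W p /\ forall w, coords w p -> (L w <= U)%MS].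
have Zcl : zclosed Z by apply: (zclosed_fibres_in Wcl S frames).
have ZE v : cone Z v <-> cone W v /\ (L v <= U)%MS.
  split=> [[p [Wp pU] vp]|[[p Wp vp] vU]]; first by split; [exists p | exact: pU].
  exists p => //; split=> // v' v'p; have [s s0 ->] := coords_prop vp v'p.
  by rewrite (scroll_scale S _ s0) //; exists p.
have C'E v : C' v -> (f * Q 0 k * 'X_i).@[v 0] != 0 -> [/\ cone W v, f.@[v 0] != 0 & (Q 0 k).@[v 0] != 0].
  move=> Cv; rewrite !mevalM !mulf_eq0 !negb_or mevalXU => /andP[/andP[fv Qv] vi]; split=> //.
  by apply: C'W => //; apply: contraNneq vi => ->; rewrite mxE.
have C'Z v : C' v -> (f * Q 0 k * 'X_i).@[v 0] != 0 -> cone Z v.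
  move=> Cv fv; have [Cwv _ Qv] := C'E v Cv fv; apply/ZE; split=> //.
  have [C3v|nC3] := pselect (C3 v); last first.
    have [vL|nvL] := boolP (L v <= L w3)%MS; first by rewrite (submx_trans vL) // -A3L addsmxSl.
    by case: nC3; apply: away_fibre => //; exact: Cw3.1.1.
  have [b30 tL tA] := beta3P C3v; rewrite -tL; apply/(pencil_mem f3 tA lv0).
  have [c QE] := QP v C3v; have c0 : c != 0.
    by apply: contraNneq Qv => c0; rewrite -evE QE c0 scale0r mxE.
  have := pqE v Cv; rewrite -!evE QE !mxE => h; exists (beta3 v 0 1).
  have h' : beta3 v 0 0 = lam * beta3 v 0 1 by apply: (mulfI c0); rewrite h; ring.
  by apply/eqP; rewrite -subr_eq0; apply/eqP/rV2P; rewrite !mxE /= ?h'; ring.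
have YZ : zero_set C' `<=` Z by exact: zero_set_sub Zcl iC' fC' C'Z.
have YconeZ v : cone (zero_set C') v -> cone W v /\ (L v <= U)%MS.
  by move=> [p Yp vp]; apply/ZE; exists p => //; exact: YZ.
have notU v : C3 v -> slope (beta3 v) != lam -> ~~ (L v <= U)%MS.
  move=> C3v; apply: contra => vU; have [b30 tL tA] := beta3P C3v.
  have /(pencil_mem f3 tA lv0)[c cE] : (tau3 v <= U)%MS by rewrite tL.
  have c0 : c != 0 by apply: contraNneq b30 => c0; rewrite cE c0 scale0r.
  by rewrite /slope cE !mxE /= mulr1 mulrC mulKf.
move: lb; rewrite !inE !negb_or ![lam == _]eq_sym => /andP[lb0 lb1].
have nU0 : ~~ (L w0 <= U)%MS by apply: notU => //; exact: away_sym Cw3.1 Cw0.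
have nU1 : ~~ (L w1 <= U)%MS by apply: notU => //; exact: away_sym Cw3.2 Cw1.
have Uaway v v' : cone W v -> (L v <= U)%MS -> cone W v' -> ~~ (L v' <= U)%MS -> away (cone W) v' v.
  move=> Cv vU Cv' nU; split=> // -[c vE]; have c0 : c != 0.
    by apply: contraNneq (CW0 Cv) => c0; rewrite vE c0 scale0r.
  by move: nU; rewrite -(scroll_scale S Cv' c0) -vE vU.
(* If [beta0] agrees at two distinct points, then L v + L v' = A0 + pen (beta0 v), so [A0] would lie
   in [U]. *)
have inj v v' : cone W v -> (L v <= U)%MS -> cone W v' -> (L v' <= U)%MS ->
    (exists s, beta0 v' = s *: beta0 v) -> exists s, v' = s *: v.
  move=> Cv vU Cv' v'U bb; apply: contrapT => ne.
  have [b0 bA] := beta0P (Uaway _ _ Cv vU Cw0 nU0); have [b0' bA'] := beta0P (Uaway _ _ Cv' v'U Cw0 nU0).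
  have [_ tL] := tau0P (Uaway _ _ Cv vU Cw0 nU0); have [_ tL'] := tau0P (Uaway _ _ Cv' v'U Cw0 nU0).
  pose B := (A0 + pen D01 D02 (beta0 v))%MS.
  have vB : (L v <= B)%MS by rewrite -tL; apply/(pencil_mem f0 bA b0); exists 1; rewrite scale1r.
  have v'B : (L v' <= B)%MS by rewrite -tL'; exact/(pencil_mem f0 bA' b0).
  have sub : (L v + L v' <= B)%MS by rewrite addsmx_sub vB.
  case/negP: nU0; rewrite -A0L; apply: submx_trans (addsmxSl _ (pen D01 D02 (beta0 v))) _.
  apply: submx_trans (_ : (L v + L v' <= U)%MS); last by rewrite addsmx_sub vU.
  have [_ <-] := mxrank_leqif_sup sub; rewrite eqn_leq mxrankS //=.
  have := mxrank_sum_cap (L v) (L v'); rewrite (fibres_disjoint S Cv Cv' ne) mxrank0 addn0 !(fibre_rankE frames) // => ->.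
  have := mxrank_adds_leqif A0 (pen D01 D02 (beta0 v)) => -[le _]; apply: leq_trans le _.
  by apply: leq_add; exact: rank_leq_row.
have YC0 : cone (zero_set C') `<=` C0 by move=> v /YconeZ[Cv vU]; exact: Uaway Cv vU Cw0 nU0.
have YC1 : cone (zero_set C') `<=` C1 by move=> v /YconeZ[Cv vU]; exact: Uaway Cv vU Cw1 nU1.
have w3U : (L w3 <= U)%MS by rewrite -A3L addsmxSl.
(* Some point of the curve has the same value of [beta0] as [w3]; by injectivity it is [w3], which
   therefore lies on the curve. *)
pose bb := beta0 w3; pose cv : 'cV[F]_2 := \col_i if i == 0 then bb 0 1 else - bb 0 0.
have [|v Yv vc] := curve_meets cv Ycl Yirr Y2 (regline_sub YC0 regb0).
  by move=> v v' /YconeZ[Cv vU] /YconeZ[Cv' v'U]; exact: inj.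
have [s w3E] : exists s, w3 = s *: v.
  have [Cv vU] := YconeZ v Yv; apply: inj => //; first exact: Cw3.1.1.
  have [b0 _] := beta0P (YC0 v Yv).
  move/matrixP/(_ 0 0): vc; rewrite mxE big_ord_recl big_ord1 !mxE /= => vc.
  have {}vc : beta0 v 0 0 * bb 0 1 = beta0 v 0 1 * bb 0 0.
    apply/eqP; rewrite -subr_eq0 -mulrN -[X in _ == X]vc; apply/eqP; congr (_ + beta0 v 0 _ * _); exact/val_inj.
  apply/sub_rVP/wedge_sub => // i' j'; rewrite -/bb.
  have [->|->] := ord2P i'; have [->|->] := ord2P j' => //.
    by rewrite mulrC -vc mulrC.
  by rewrite mulrC vc mulrC.
have s0 : s != 0 by apply: contraNneq (CW0 Cw3.1.1) => s0; rewrite w3E s0 scale0r.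
have Yw3 : cone (zero_set C') w3 by rewrite w3E; exact: cone_scale.
have [v' C'v' fv'] := (not_vanishP _ _).1 fC'; have [Cv' f'v' _] := C'E v' C'v' fv'.
have Yv' : cone (zero_set C') v'.
  by have [r vr] := coords_ex (CW0 Cv'); exists r => //; exact: zero_set_cone vr.
have C01Y : cone (zero_set C') `<=` C01 by move=> x Yx; split; [exact: YC0 | exact: YC1].
have [|c cE] := regline_const pigeonF Ycl Yirr (regline_sub C01Y gauge_regline) (detpoly_homog F m.+1) _ Yw3 Yv'.
  move=> x Yx; rewrite ev_detpoly; have [_] := gaugeP (C01Y x Yx).
  by rewrite unitmxE unitfE.
case: (fP v' (C01Y v' Yv') f'v'); exists c; apply: (can_inj mxvecK); by rewrite cE linearZ.
Qed.

End TwoPencils.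
End Gauge.

(** * The map from the base to the plane *)

Section PlaneMap.
Variable F : closedFieldType.
Hypothesis charF : [pchar F] =i pred0.
Hypothesis pigeonF : has_large_fibres F.

Definition perp (c : 'cV[F]_2) : 'rV[F]_2 := \row_i if i == 0 then c 1 0 else - c 0 0.

Lemma col2E (y : 'rV[F]_2) (a b : F) :
  (y *m (\col_i if i == 0 then a else b)) 0 0 = y 0 0 * a + y 0 1 * b.
Proof. by rewrite mxE big_ord_recl big_ord1 !mxE /=; congr (_ + y 0 _ * b); apply/val_inj. Qed.

Lemma perp_neq0 c : c != 0 -> perp c != 0.
Proof.
apply: contra => /eqP/rowP h; apply/eqP/trmx_inj; rewrite trmx0; apply: rV2P; rewrite mxE.
  by have := h 1; rewrite !mxE /= => /eqP; rewrite oppr_eq0 => /eqP.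
by have := h 0; rewrite !mxE.
Qed.

Lemma perpP (b : 'rV[F]_2) c : c != 0 -> b *m c = 0 -> exists s, b = s *: perp c.
Proof.
move=> c0 /matrixP/(_ 0 0); rewrite mxE big_ord_recl big_ord1 [RHS]mxE => bc.
have {}bc : b 0 0 * c 0 0 + b 0 1 * c 1 0 = 0.
  by rewrite -bc; congr (_ + b 0 _ * c _ 0); apply/val_inj.
apply/sub_rVP/wedge_sub; first exact: perp_neq0.
move=> i j; apply/eqP; rewrite -subr_eq0; apply/eqP.
by have [->|->] := ord2P i; have [->|->] := ord2P j; rewrite !mxE /=;
  first [ring | rewrite -[RHS]bc; ring | rewrite -[RHS]oppr0 -bc; ring].
Qed.

Lemma pen0 m d (D1 D2 : 'M[F]_(m, d)) : pen D1 D2 0 = 0.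
Proof. by rewrite /pen !mxE !scale0r addr0. Qed.

Variables (d e m : nat) (W : set (Proj F e)) (CX : set 'rV[F]_d) (L : 'rV[F]_e -> 'M[F]_d).
Hypothesis Wcl : zclosed W.
Hypothesis S : scroll CX (cone W) L.
Hypothesis iW : irr (cone W).
Hypothesis indW : forall t (Y : 'M[F]_(e, t)), algind (cone W) Y -> (t <= 3)%N.
Hypothesis tW : forall z, cone W z -> exists U : 'M[F]_(3, e), tframe (cone W) z U.
Hypothesis frames : local_frames m CX (cone W) L.
Hypothesis secX : tangent_sums_le (m.+1 + m.+1).+2 CX.
Hypothesis dimV : ((m.+1 + m.+1).+2 < d)%N.
Hypothesis nondegX : spanning CX.
Hypothesis full_ex : exists w (A D1 D2 : 'M[F]_(m.+1, d)),
  [/\ cone W w, frame_at CX L w A D1 D2 & row_full (A + D1 + D2)%MS].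

Let CWs s w : cone W w -> s != 0 -> cone W (s *: w). Proof. exact: cone_scale. Qed.
Let CW0 w : cone W w -> w != 0. Proof. exact: cone_neq0. Qed.

(** [N] asks that T lie in the pencil of [w0] modulo A0 and g T in that of [w1] modulo A1; as the
    gauge is constant, [tau0] meets both conditions. The kernel has dimension 1 + 2: the frames of
    [L w0] itself, and the values of [beta0]. *)
Lemma fibre_family : exists k (N : 'M[F]_(m.+1 * d, k)), \rank (kermx N) = 3 /\
  forall w, cone W w -> exists T : 'M[F]_(m.+1, d), [/\ row_free T, (T :=: L w)%MS &
    forall T', (T' <= L w)%MS /\ mxvec T' *m N = 0 <-> exists c, T' = c *: T].
Proof.
have [h hW hP] := full_open frames full_ex.
have away_of := away_fibre S.
have [w0 Cw0 hw0] := (not_vanishP _ _).1 hW; have [A0 [D01 [D02 full0]]] := hP w0 Cw0 hw0.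
have [[A0free A0L nd0 _] f0] := full0.
have rA : (m.+1 < d)%N by move: dimV; clear; lia.
have [|h1 h1W h1P] := @fibres_span_open F d e m W CX L S frames nondegX _ A0; first by rewrite (eqP A0free).
have [w1 Cw1 [hw1 h1w1]] := irr_nonvanish iW hW h1W; have [A1 [D11 [D12 full1]]] := hP w1 Cw1 hw1.
have [[A1free A1L nd1 _] f1] := full1.
have a01 : away (cone W) w0 w1 by apply: away_of => //; rewrite -A0L; exact: h1P.
have a10 := away_sym a01 Cw0.
have [|h3 h3W h3P] := @fibres_span_open F d e m W CX L S frames nondegX _ (A0 + A1)%MS.
  have := mxrank_adds_leqif A0 A1; rewrite (eqP A0free) (eqP A1free) => -[le _].
  by apply: leq_ltn_trans le _; move: dimV; clear; lia.
have [w3 Cw3 [hw3 h3w3]] := irr_nonvanish iW hW h3W; have [A3 [D31 [D32 full3]]] := hP w3 Cw3 hw3.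
have a03 : away (cone W) w0 w3.
  apply: away_of => //; apply: contra (h3P w3 Cw3 h3w3) => /submx_trans; apply; by rewrite -A0L addsmxSl.
have a13 : away (cone W) w1 w3.
  apply: away_of => //; apply: contra (h3P w3 Cw3 h3w3) => /submx_trans; apply; by rewrite -A1L addsmxSr.
have [tau0 [beta0 [t0P t0U reg0 regb0]]] := pencil_at S iW CWs CW0 frames secX dimV full_ex Cw0 full0.
have [tau1 [beta1 [t1P t1U reg1 _]]] := pencil_at S iW CWs CW0 frames secX dimV full_ex Cw1 full1.
have [tau3 [beta3 [t3P _ _ regb3]]] := pencil_at S iW CWs CW0 frames secX dimV full_ex Cw3 full3.
have t0F w : away (cone W) w0 w -> row_free (tau0 w) /\ (tau0 w :=: L w)%MS by move=> /t0P[].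
have t1F w : away (cone W) w1 w -> row_free (tau1 w) /\ (tau1 w :=: L w)%MS by move=> /t1P[].
have b0P w : away (cone W) w0 w -> beta0 w != 0 /\ ((tau0 w - pen D01 D02 (beta0 w))%R <= A0)%MS by move=> /t0P[].
have b3P w : away (cone W) w3 w -> [/\ beta3 w != 0, (tau3 w :=: L w)%MS & ((tau3 w - pen D31 D32 (beta3 w))%R <= A3)%MS].
  by move=> /t3P[].
have Gconst := gauge_const charF pigeonF Wcl S iW indW tW frames dimV nondegX t0F t1F reg0 reg1 Cw0 Cw1 full0 b0P regb0
  (conj a03 a13) full3 b3P regb3.
have [_ gu] := gaugeP t0F t1F (conj a03 a13); pose g := gauge tau0 tau1 w3; rewrite -/g in gu Gconst.
have [k0 [N0 [Bet [N0E BetE]]]] := pencil_coord nd0; have [k1 [N1 [_ [N1E _]]]] := pencil_coord nd1.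
pose N := row_mx N0 (lin_mulmx g *m N1).
have NE T : mxvec T *m N = 0 <-> (exists b, ((T - pen D01 D02 b)%R <= A0)%MS) /\ (exists b, ((g *m T - pen D11 D12 b)%R <= A1)%MS).
  rewrite mul_mx_row mulmxA /lin_mulmx mul_vec_lin -N0E -N1E; split=> [|[-> ->]]; last by rewrite row_mx0.
  by rewrite -[X in _ = X]row_mx0 => /eq_row_mx.
have gK (T : 'M[F]_(m.+1, d)) : invmx g *m (g *m T) = T by rewrite mulmxA mulVmx // mul1mx.
have Kg (T : 'M[F]_(m.+1, d)) : g *m (invmx g *m T) = T by rewrite mulmxA mulmxV // mul1mx.
(* The second base point supplies the frame over [w0], where [tau0] is not defined. *)
pose T00 := invmx g *m tau1 w0; have [fr10 L10] := t1F w0 a10.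
have T00E : (T00 :=: L w0)%MS.
  apply: eqmx_trans L10; apply/eqmxP; rewrite submxMl -{1}(Kg (tau1 w0)) submxMl //.
have T00free : row_free T00 by rewrite /row_free T00E -L10; exact: fr10.
have T00P T' : (T' <= L w0)%MS /\ mxvec T' *m N = 0 <-> exists c, T' = c *: T00.
  split=> [[T'L /NE[_ [b bA]]]|[c ->]].
    have [|c cE] := t1U w0 (g *m T') b a10 _ bA; first exact: submx_trans (submxMl _ _) T'L.
    by exists c; rewrite /T00 scalemxAr -cE gK.
  split; first by rewrite scalemx_sub // T00E.
  apply/NE; split; first by exists 0; rewrite pen0 subr0 scalemx_sub // T00E A0L.
  by exists (c *: beta1 w0); have [_ _ _ tA] := t1P w0 a10; rewrite -scalemxAr Kg penZ -scalerBr scalemx_sub.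
have tau0N w : away (cone W) w0 w -> mxvec (tau0 w) *m N = 0.
  move=> a0; have [_ _ _ tA] := t0P w a0; apply/NE; split; first by exists (beta0 w).
  have [a1|na1] := pselect (away (cone W) w1 w); last first.
    have [wL|nwL] := boolP (L w <= L w1)%MS; last by case: na1; apply: away_of => //; exact: a0.1.
    exists 0; rewrite pen0 subr0 A1L; apply: submx_trans (submxMl _ _) _.
    by have [_ ->] := t0F w a0.
  have [c cE] := Gconst w (conj a0 a1); have [Gw Gu] := gaugeP t0F t1F (conj a0 a1).
  have c0 : c != 0 by apply: contraTneq Gu => c0; rewrite cE c0 scale0r unitmxE det0 unitfE eqxx.
  exists (c^-1 *: beta1 w); have [_ _ _ tA1] := t1P w a1.
  have -> : g *m tau0 w = c^-1 *: tau1 w by rewrite -Gw cE -scalemxAl scalerA mulVf // scale1r.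
  by rewrite penZ -scalerBr scalemx_sub.
exists (k0 + k1)%N, N; split; last first.
  move=> w Cw; have [a0|na0] := pselect (away (cone W) w0 w); last first.
    have [c wE] : exists c, w = c *: w0 by apply: contrapT => ne; apply: na0.
    have c0 : c != 0 by apply: contraNneq (CW0 Cw) => c0; rewrite wE c0 scale0r.
    have LL : (L w :=: L w0)%MS by rewrite wE; apply: (scroll_scale S).
    exists T00; split=> // [|T']; first exact: eqmx_trans T00E (eqmx_sym LL).
    by rewrite LL; exact: T00P.
  have [fr tL] := t0F w a0; exists (tau0 w); split=> // T'; split=> [[T'L /NE[[b bA] _]]|[c ->]].
    exact: t0U w T' b a0 T'L bA.
  by rewrite scalemx_sub ?tL //; split=> //; rewrite linearZ -scalemxAl tau0N // scaler0.
have r1 : \rank (kermx N :&: kermx Bet)%MS = 1%N.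
  have e1 : \rank (mxvec T00) = 1%N.
    by rewrite rank_rV mxvec_eq0; case: eqP => // T0; move: T00free; rewrite T0 /row_free mxrank0.
  rewrite -[RHS]e1; apply/eqmx_rank/andP; split.
    apply/rV_subP => x; rewrite sub_capmx => /andP[/sub_kermxP xN /sub_kermxP xB].
    have [T xT] : exists T, x = mxvec T by exists (vec_mx x); rewrite vec_mxK.
    rewrite xT in xN xB *; have [[b bA] _] := (NE T).1 xN; have := BetE T b bA; rewrite xB => b0.
    have [|c ->] := (T00P T).1; last by rewrite linearZ scalemx_sub.
    by split=> //; move: bA; rewrite -b0 pen0 subr0 A0L.
  rewrite sub_capmx; apply/andP; split; apply/sub_kermxP.
    by have [] := (T00P T00).2 (ex_intro _ 1 (esym (scale1r _))).
  by apply: BetE; rewrite pen0 subr0 T00E A0L.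
(* A linear relation on the values of [beta0] would confine general fibres to a single proper member
   of the pencil. *)
have r2 : \rank (kermx N *m Bet) = 2.
  apply/eqP; rewrite eqn_leq rank_leq_col /= leqNgt; apply/negP => lt.
  have : cokermx (kermx N *m Bet) != 0 by rewrite -mxrank_eq0 mxrank_coker subn_eq0 -ltnNge.
  move=> /matrix0Pn[i [j Uij]]; pose c := col j (cokermx (kermx N *m Bet)).
  have c0 : c != 0 by apply: contra Uij => /eqP/colP/(_ i); rewrite !mxE => ->.
  have cK : kermx N *m Bet *m c = 0 by rewrite /c colE mulmxA mulmx_coker mul0mx.
  have [h4 h4W h4P] := fibres_span_open S frames nondegX (pencil_rank dimV A0 D01 D02 (perp c)).
  have [w Cw h4w] := (not_vanishP _ _).1 h4W; have nL := h4P w Cw h4w.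
  have a0 : away (cone W) w0 w.
    by apply: away_of => //; apply: contra nL => /submx_trans; apply; rewrite -A0L addsmxSl.
  have [b0 tA] := b0P w a0; have [_ tL] := t0F w a0; case/negP: nL; rewrite -tL.
  apply/(pencil_mem dimV f0 tA (perp_neq0 c0))/perpP => //.
  rewrite -(BetE _ _ tA); have /submxP[y ->] : (mxvec (tau0 w) <= kermx N)%MS by apply/sub_kermxP; exact: tau0N.
  by rewrite -(mulmxA y (kermx N) Bet) -(mulmxA y _ c) cK mulmx0.
by rewrite -(mxrank_mul_ker (kermx N) Bet) r1 r2.
Qed.

Lemma two_kernel (o : 'rV[F]_3) : o != 0 -> exists M : 'M[F]_(3, 2), o *m M = 0 /\
  forall x : 'rV[F]_3, x *m M = 0 -> (x <= o)%MS.
Proof.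
move=> o0; have rK : \rank (cokermx o)^T = 2 by rewrite mxrank_tr mxrank_coker rank_rV o0.
have [M [_ ME]] := frame_of_rank rK; exists M^T; split.
  apply: trmx_inj; rewrite trmx_mul trmxK trmx0; apply/eqP; have /submxP[z ->] : (M <= (cokermx o)^T)%MS by rewrite ME.
  by rewrite -mulmxA -trmx_mul mulmx_coker trmx0 mulmx0.
move=> x /(congr1 trmx); rewrite trmx_mul trmxK trmx0 => Mx; rewrite submxE -trmx_eq0 trmx_mul.
have /submxP[z ->] : ((cokermx o)^T <= M)%MS by rewrite ME.
by rewrite -mulmxA Mx mulmx0.
Qed.

(** Surjectivity: if [l] missed a point [o], projecting from [o] would be regular. A curve in one of
    its fibres would be mapped injectively into a line through [o] without [o], against
    [curve_meets]. *)
Lemma plane_map : exists (Tb : 'M[F]_(3, m.+1 * d)) (l : 'rV[F]_e -> 'rV[F]_3), [/\ regline (cone W) l,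
  forall w, cone W w -> row_free (vec_mx (l w *m Tb)) /\ (vec_mx (l w *m Tb) :=: L w)%MS &
  forall a, a != 0 -> exists w c, [/\ cone W w, c != 0 & a = c *: l w]].
Proof.
have [k [N [rN fam]]] := fibre_family; have [Tb [Tbfree TbN]] := frame_of_rank rN.
have h w : exists T : 'M[F]_(m.+1, d), cone W w -> [/\ row_free T, (T :=: L w)%MS &
    forall T', (T' <= L w)%MS /\ mxvec T' *m N = 0 <-> exists c, T' = c *: T].
  have [Cw|nCw] := pselect (cone W w); last by exists 0.
  by have [T TP] := fam w Cw; exists T.
have [tau tauP] := choice h; pose l w := mxvec (tau w) *m pinvmx Tb.
have lE w : cone W w -> l w *m Tb = mxvec (tau w).
  move=> Cw; rewrite /l mulmxKpV // TbN; apply/sub_kermxP.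
  by have [_ _ tP] := tauP w Cw; have [] := (tP _).2 (ex_intro _ 1 (esym (scale1r _))).
have vE w : cone W w -> vec_mx (l w *m Tb) = tau w by move=> Cw; rewrite lE // mxvecK.
have tau0 w : cone W w -> tau w != 0.
  by move=> Cw; have [fr _ _] := tauP w Cw; apply: contraTneq fr => ->; rewrite /row_free mxrank0.
have reg : regline (cone W) l.
  apply: regline_kernel => [w Cw|w s Cw s0|w Cw].
  - by apply: contra (tau0 w Cw) => /eqP l0; rewrite -mxvec_eq0 -lE // l0 mul0mx.
  - have Csw := CWs Cw s0; have [_ sL sP] := tauP _ Csw; have [_ _ wP] := tauP w Cw.
    have [_ sN] := (sP _).2 (ex_intro _ 1 (esym (scale1r _))).
    have [|c cE] := (wP (tau (s *: w))).1; last by exists c; rewrite /l cE linearZ scalemxAl.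
    by split=> //; rewrite sL (scroll_scale S Cw s0).
  have [g [E [E1 [E2 [gw fr]]]]] := frames Cw; have [Efree _ _ _] := fr w Cw gw.
  have [g1 [K [g1w KP]]] := coker_poly Efree.
  exists _, (map_mx (@mpolyC e F) Tb *m (lin_mulmxr K : 'M_(m.+1 * d, m.+1 * d))), (g * g1); split; first by rewrite mevalM mulf_neq0.
  move=> v Cv; rewrite mevalM mulf_eq0 negb_or => /andP[gv g1v] x.
  rewrite evM ev_const ev_lin_mulmxr; have [_ EL _ _] := fr v Cv gv; have [_ KE] := KP v g1v.
  have [T xT] : exists T, x *m Tb = mxvec T by exists (vec_mx (x *m Tb)); rewrite vec_mxK.
  rewrite mulmxA xT mul_lin_mulmxr; have [_ tL tP] := tauP v Cv; split=> [/eqP|[c cE]].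
    rewrite mxvec_eq0 => /eqP/KE; rewrite EL => TL; have [|c cE] := (tP T).1.
      split=> //; rewrite -xT; apply/sub_kermxP; by rewrite -TbN submxMl.
    exists c; apply: (row_free_inj Tbfree); by rewrite xT cE linearZ /= -scalemxAl lE.
  have -> : T = c *: tau v by apply: (can_inj mxvecK); rewrite -xT cE -scalemxAl lE // linearZ.
  have -> : c *: tau v *m ev v K = 0 by apply/KE; rewrite EL -tL scalemx_sub.
  by rewrite linear0.
have inj w w' : cone W w -> cone W w' -> (exists s, l w' = s *: l w) -> exists s, w' = s *: w.
  move=> Cw Cw' [s sE]; apply: contrapT => ne; have := fibres_disjoint S Cw Cw' ne.
  have [_ tL _] := tauP w Cw; have [fr' tL' _] := tauP w' Cw'.
  have sub : (L w' <= L w)%MS by rewrite -tL -tL' -vE // sE -scalemxAl linearZ /= vE // scalemx_sub.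
  by have := capmx_idPr sub => L0 /eqP; rewrite -mxrank_eq0 L0 (fibre_rankE frames Cw').
exists Tb, l; split=> // [w Cw|o o0]; first by rewrite vE //; have [] := tauP w Cw.
apply: contrapT => no; have [M [oM MP]] := two_kernel o0.
have lM w : cone W w -> l w *m M != 0.
  move=> Cw; apply/eqP => /MP/sub_rVP[c cE]; apply: no; have [l0 _ _] := reg.
  have c0 : c != 0 by apply: contraNneq (l0 w Cw) => c0; rewrite cE c0 scale0r.
  by exists w, c^-1; split=> //; rewrite ?invr_eq0 // cE scalerA mulVf // scale1r.
have [w1 Cw1 _] : exists2 w, cone W w & True by have [w [A [D1 [D2 [Cw _ _]]]]] := full_ex; exists w.
have [_ _ loc] := regline_lin reg lM; have [Q [Qw QP]] := loc w1 Cw1; have [k1 Qk] := rV0Pn _ Qw; rewrite evE in Qk.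
have [i wi] := rV0Pn _ (CW0 Cw1).
have Qrel w (a b : F) : cone W w -> (Q 0 k1).@[w 0] != 0 -> a * (Q 0 0).@[w 0] + b * (Q 0 1).@[w 0] = 0 ->
    l w *m (M *m (\col_i if i == 0 then a else b)) = 0.
  move=> Cw Qn rel; have [c QE] := QP w Cw; have c0 : c != 0.
    by apply: contraNneq Qn => c0; rewrite -evE QE c0 scale0r mxE.
  have QV j : (Q 0 j).@[w 0] = c * (l w *m M) 0 j by rewrite -evE QE mxE.
  rewrite mulmxA; apply/matrixP => i1 j1; rewrite !ord1 col2E [RHS]mxE.
  by apply: (mulfI c0); rewrite mulr0 -[RHS]rel !QV; ring.
(* The image of [l] lies on no line of the plane: two frames would then span all the fibres. *)
have notin (c : 'cV[F]_3) : c != 0 -> exists2 h, ~ vanish (cone W) h & forall w, cone W w -> h.@[w 0] != 0 -> l w *m c != 0.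
  move=> c0; have rc : \rank (kermx c) = 2.
    rewrite mxrank_ker; have -> : \rank c = 1%N by rewrite -mxrank_tr rank_rV trmx_eq0 c0. by [].
  have [B [_ BE]] := frame_of_rank rc; pose T1 := vec_mx (row 0 B *m Tb); pose T2 := vec_mx (row 1 B *m Tb).
  have [|hh hhW hhP] := @fibres_span_open F d e m W CX L S frames nondegX _ (T1 + T2)%MS.
    have := mxrank_adds_leqif T1 T2 => -[le _]; apply: leq_ltn_trans le _.
    by have := rank_leq_row T1; have := rank_leq_row T2; move: dimV; clear; lia.
  exists hh => // w Cw hw; apply/eqP => lc; case/negP: (hhP w Cw hw); have [_ tL _] := tauP w Cw.
  have /submxP[y yE] : (l w <= B)%MS by rewrite BE; apply/sub_kermxP.
  have yB : y *m B = y 0 0 *: row 0 B + y 0 1 *: row 1 B.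
    by rewrite mulmx_sum_row big_ord_recl big_ord1; congr (_ + y 0 _ *: row _ B); apply/val_inj.
  rewrite -tL -vE // yE yB mulmxDl linearD /= -!scalemxAl !linearZ /=.
  by rewrite addmx_sub_adds ?scalemx_sub.
have col0 (a b : F) : (a, b) != (0, 0) -> M *m (\col_i if i == 0 then a else b) != 0.
  move=> ab; apply: contra ab => /eqP Mc; have rM : (2 <= \rank M)%N.
    have Mk : (kermx M <= o)%MS by apply/row_subP => i1; apply/MP; rewrite -row_mul mulmx_ker row0.
    by have := mxrankS Mk; rewrite mxrank_ker rank_rV o0; clear; case: (\rank M) => [|[]].
  have full : row_full M by rewrite /row_full eqn_leq rank_leq_col rM.
  have /colP c0 : (\col_i if i == 0 then a else b) = 0 :> 'cV[F]_2.
    by apply: (row_full_inj full); rewrite mulmx0.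
  by have := c0 0; have := c0 1; rewrite !mxE /= => -> ->.
have [||lam [C' [[_ iC' C'W pqE fC'] [Ycl Yirr Y2]]]] := @fibre_curve_closed F charF pigeonF e W (Q 0 0) (Q 0 1) (Q 0 k1 * 'X_i)
    [::] Wcl iW indW tW.
- move=> a b ab van; have [hh hhW hhP] := notin _ (col0 a b ab).
  have [|v Cv [hv Qv]] := irr_nonvanish iW hhW (g := Q 0 k1); first by apply/not_vanishP; exists w1.
  case/eqP: (hhP v Cv hv); apply: Qrel => //.
  by have := van v Cv; rewrite mevalD !mevalM !mevalC.
- by apply/not_vanishP; exists w1; rewrite // mevalM mevalXU mulf_neq0.
(* Two independent forms with common zero [o]; the first vanishes on the curve, and the second has a
   zero there. *)
pose phi := M *m (\col_i if i == 0 then 1 else - lam); pose psi := M *m (\col_i if i == 0 then 0 else 1).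
have Yphi : zero_set C' `<=` [set p | W p /\ forall w, coords w p -> l w *m phi = 0].
  apply: (zero_set_sub _ iC' fC'); first exact: zclosed_regline.
  move=> v Cv.
  rewrite mevalM mulf_eq0 negb_or mevalXU => /andP[Qv vi].
  have v0 : v != 0 by apply: contraNneq vi => ->; rewrite mxE.
  have [p Wp vp] := C'W v Cv v0; exists p => //; split=> // w wp; have [s s0 ->] := coords_prop vp wp.
  have Cwv : cone W v by exists p.
  have [_ sc _] := reg; have [c ->] := sc v s Cwv s0; rewrite -scalemxAl Qrel ?scaler0 //.
  by rewrite pqE // mul1r mulNr subrr.
have YW w : cone (zero_set C') w -> cone W w /\ l w *m phi = 0.
  by move=> [p Yp wp]; have [Wp h1] := Yphi p Yp; split; [exists p | exact: h1].
have [|w Yw lpsi] := curve_meets pigeonF psi Ycl Yirr Y2 (regline_sub (fun w Yw => (YW w Yw).1) reg).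
  by move=> w w' /YW[Cw _] /YW[Cw' _]; exact: inj.
have [Cw lphi] := YW w Yw; case/eqP: (lM w Cw).
have e1 : l w *m M *m (\col_(i < 2) if i == 0 then 0 else 1 : F) = 0 by rewrite -mulmxA.
have e2 : l w *m M *m (\col_(i < 2) if i == 0 then 1 else - lam) = 0 by rewrite -mulmxA.
move: (l w *m M) e1 e2 => y /matrixP/(_ 0 0); rewrite col2E mxE mulr0 add0r mulr1 => y1.
by move=> /matrixP/(_ 0 0); rewrite col2E mxE y1 mul0r addr0 mulr1 => y0; exact: rV2P.
Qed.

End PlaneMap.

(** * The Segre embedding *)

Section SegreProjection.
Variable F : closedFieldType.

Lemma zclosed0 d : zclosed (set0 : set (Proj F d)).
Proof.
apply/zclosedP => p v _ vp; exists 1; last by rewrite meval1 oner_eq0.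
by move=> w [q []].
Qed.

(** Proportionality to [l] passes to homogeneous components, so one degree in which some component
    is nonzero supplies the forms required by [regular_map]. *)
Lemma regular_of_regline d e (A : set (Proj F d)) (B : set (Proj F e)) (l : 'rV[F]_d -> 'rV[F]_e) f :
  regline (cone A) l -> (forall p v, A p -> coords v p -> coords (l v) (f p)) -> (forall p, A p -> B (f p)) ->
  regular_map A B f.
Proof.
move=> [l0 ls lreg] lf fB; split=> // p Ap; pose v := vpick (val p); have vp : coords v p := vpick_coords p.
have Cv : cone A v by exists p.
have [Q [/rV0Pn[j Qj] QP]] := lreg v Cv; rewrite evE in Qj; have [k hk] := hc_nonvanish Qj.
have hcl w i1 i2 : cone A w -> (hc k (Q 0 i1)).@[w 0] * l w 0 i2 = (hc k (Q 0 i2)).@[w 0] * l w 0 i1.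
  move=> Cw; pose G := Q 0 i1 * (l w 0 i2)%:MP - Q 0 i2 * (l w 0 i1)%:MP.
  have hcE i a : hc k (Q 0 i * a%:MP) = hc k (Q 0 i) * a%:MP.
    by rewrite ![_ * a%:MP]mulrC !mul_mpolyC /hc linearZ.
  have : (hc k G).@[w 0] = 0.
    apply: (hc_vanish (s := [:: 0])) => s; rewrite inE => s0; have Csw := cone_scale Cw s0.
    rewrite mevalB !mevalM !mevalC -!evE; have [c ->] := QP _ Csw; have [c' ->] := ls w s Cw s0.
    by rewrite !mxE; ring.
  by rewrite /G /hc linearB /= -!/(hc _ _) !hcE mevalB !mevalM !mevalC => /eqP; rewrite subr_eq0 => /eqP.
exists (~` [set q | forall w, coords w q -> (hc k (Q 0 j)).@[w 0] = 0]), k, (fun i => hc k (Q 0 i)); split.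
- by rewrite /zopen setCK; exact: zclosed_homog (hc_homog k (Q 0 j)).
- by move=> /(_ v vp) h; rewrite h eqxx in hk.
- by move=> i; exact: hc_homog.
move=> q w Aq nz wq; have Cw : cone A w by exists q.
have hw : (hc k (Q 0 j)).@[w 0] != 0.
  apply/eqP => h; apply: nz => w' w'q; exact: homog_coords (hc_homog k _) wq w'q h.
have lw : l w 0 j != 0.
  apply/eqP => lj; case/eqP: (l0 w Cw); apply/rowP => i; rewrite mxE; apply: (mulfI hw).
  by rewrite hcl // lj !mulr0.
have -> : \row_i (hc k (Q 0 i)).@[w 0] = ((hc k (Q 0 j)).@[w 0] / l w 0 j) *: l w.
  apply/rowP => i; rewrite !mxE; apply: (mulIf lw); rewrite hcl // mulrAC divfK //.
by apply: coords_scale; [exact: lf | rewrite mulf_neq0 ?invr_eq0].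
Qed.

Lemma ev_lin_mulmx e a b c (K : 'M[{mpoly F[e]}]_(a, b)) (w : 'rV[F]_e) :
  ev w (lin_mulmx K : 'M_(b * c, a * c)) = lin_mulmx (ev w K).
Proof. by rewrite /lin_mulmx; apply: map_lin_mx => A; rewrite /= map_mxM. Qed.

(** The product c T_a is bilinear, hence a linear function of a ⊗ c; this matrix is the linear
    projection. *)
Lemma contraction_matrix k m d (Tb : 'M[F]_(k, m * d)) :
  exists A : 'M[F]_(k * m, d), forall a c, mxvec (a^T *m c) *m A = c *m vec_mx (a *m Tb).
Proof.
pose B j := \matrix_(i < k, i' < m) Tb i (mxvec_index i' j).
exists (\matrix_(r, j) mxvec (B j) 0 r) => a c; apply/rowP => j.
transitivity ((mxvec (a^T *m c) *m (mxvec (B j))^T) 0 0).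
  by rewrite !mxE; apply: eq_bigr => r _; rewrite !mxE.
rewrite mxvec_dotmul mxE [RHS]mxE; apply: eq_bigr => i' _; rewrite mulrC !mxE; congr (_ * _).
by apply: eq_bigr => i _; rewrite !mxE.
Qed.

Variables (N e m : nat) (X : set (Proj F N.+1)) (W : set (Proj F e)) (L : 'rV[F]_e -> 'M[F]_N.+1).
Hypothesis S : scroll (cone X) (cone W) L.
Hypothesis nondegX : spanning (cone X).
Variables (Tb : 'M[F]_(3, m.+1 * N.+1)) (l : 'rV[F]_e -> 'rV[F]_3).
Hypothesis reg : regline (cone W) l.
Hypothesis frame : forall w, cone W w -> row_free (vec_mx (l w *m Tb)) /\ (vec_mx (l w *m Tb) :=: L w)%MS.
Hypothesis onto : forall a, a != 0 -> exists w c, [/\ cone W w, c != 0 & a = c *: l w].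

Lemma segre_point a (c : 'rV[F]_m.+1) : a != 0 -> c != 0 -> cone X (c *m vec_mx (a *m Tb)).
Proof.
move=> a0 c0; have [w [s [Cw s0 ->]]] := onto a0; have [fr LE] := frame Cw.
have -> : c *m vec_mx (s *: l w *m Tb) = s *: (c *m vec_mx (l w *m Tb)).
  by rewrite -scalemxAl linearZ /= -scalemxAr.
apply: cone_scale s0; have x0 : c *m vec_mx (l w *m Tb) != 0.
  by apply: contra c0 => /eqP h; apply/eqP; apply: (row_free_inj fr); rewrite h mul0mx.
by apply: (scroll_fibre S Cw x0); rewrite -LE submxMl.
Qed.

(** The inverse map x -> a ⊗ c. It is regular because its line is locally a kernel: the left factor
    must be proportional to [l] at the projection of x, and the contraction to x. *)
Lemma tensor_regline : exists G : 'rV[F]_N.+1 -> 'rV[F]_(3 * m.+1), regline (cone X) G /\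
  (forall x, cone X x -> exists a c, [/\ a != 0, c != 0, x = c *m vec_mx (a *m Tb) & G x = mxvec (a^T *m c)]) /\
  forall a c, a != 0 -> c != 0 -> G (c *m vec_mx (a *m Tb)) = mxvec (a^T *m c).
Proof.
have [l0 lsc lloc] := reg.
have h x : exists wc : 'rV[F]_e * 'rV[F]_m.+1, cone X x -> [/\ cone W wc.1, (x <= L wc.1)%MS & x = wc.2 *m vec_mx (l wc.1 *m Tb)].
  have [Cx|nCx] := pselect (cone X x); last by exists (0, 0).
  have [w Cw xw] := scroll_cover S Cx; have [fr LE] := frame Cw.
  have /submxP[c cE] : (x <= vec_mx (l w *m Tb))%MS by rewrite LE.
  by exists (w, c).
have [wc wcP] := choice h; pose G x := mxvec ((l (wc x).1)^T *m (wc x).2).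
have Gneq x : cone X x -> (wc x).2 != 0.
  by move=> Cx; have [_ _ xE] := wcP x Cx; apply: contraNneq (cone_neq0 Cx) => c0; rewrite xE c0 mul0mx.
have cancelT w s (c c' : 'rV[F]_m.+1) : cone W w -> c *m vec_mx (s *: l w *m Tb) = c' *m vec_mx (l w *m Tb) -> c' = s *: c.
  move=> Cw; have [fr _] := frame Cw; rewrite -scalemxAl linearZ /= -scalemxAr scalemxAl.
  by move=> /(row_free_inj fr).
have GE a c : a != 0 -> c != 0 -> G (c *m vec_mx (a *m Tb)) = mxvec (a^T *m c).
  move=> a0 c0; have Cx := segre_point a0 c0; have [w [s [Cw s0 aE]]] := onto a0.
  set x := c *m vec_mx (a *m Tb) in Cx *; have [Cw' xw' xE] := wcP x Cx.
  have xw : (x <= L w)%MS.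
    have [_ LE] := frame Cw; by rewrite -LE /x aE -scalemxAl linearZ /= -scalemxAr scalemx_sub // submxMl.
  have [t t0 wE] := scroll_disjoint S Cw Cw' (cone_neq0 Cx) xw xw'.
  have [t' lE] := lsc w t Cw t0; rewrite /G wE lE.
  have : (wc x).2 *m vec_mx (t' *: l w *m Tb) = (s *: c) *m vec_mx (l w *m Tb).
    by rewrite -lE -wE -xE /x aE -!scalemxAl linearZ /= -scalemxAr.
  move=> /(cancelT w _ _ _ Cw) cE; congr mxvec.
  by rewrite aE ![(_ *: l w)^T]linearZ /= -!scalemxAl !scalemxAr cE.
have Gx x : cone X x -> exists a c, [/\ a != 0, c != 0, x = c *m vec_mx (a *m Tb) & G x = mxvec (a^T *m c)].
  move=> Cx; have [Cw _ xE] := wcP x Cx; exists (l (wc x).1), (wc x).2; split=> //; [exact: l0 | exact: Gneq].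
exists G; split=> //; have [A AE] := contraction_matrix Tb.
apply: regline_kernel => [x Cx|x s Cx s0|x Cx].
- by have [a [c [a0 c0 _ ->]]] := Gx x Cx; exact: segre_neq0.
- have [a [c [a0 c0 xE GxE]]] := Gx x Cx; exists s; rewrite GxE xE scalemxAl GE //; last by rewrite scaler_eq0 negb_or s0.
  by rewrite -scalemxAr linearZ.
have [g [P lP]] := scroll_proj S Cx; have [gx gP] := lP; have [CP xP] := gP x Cx gx.
have [Ql [Ql0 QlP]] := lloc _ CP; have [i0 qi0] := rV0Pn _ Ql0; rewrite evE in qi0.
have [|g1 [K [g1x KP]]] := @coker_poly F N.+1 1 N.+1 (varmx F N.+1) x.
  by rewrite ev_varmx /row_free rank_rV (cone_neq0 Cx).
(* Where the coordinate [i0] of [qx] is nonzero, [Bx] kills exactly the tensors with left factor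
   [qx]. *)
pose qx := cmpmx P Ql; pose Bx := (qx 0 i0)%:M - qx^T *m map_mx (@mpolyC N.+1 F) (delta_mx 0 i0 : 'rV[F]_3).
have evBx v : ev v Bx = (ev v qx 0 i0)%:M - (ev v qx)^T *m delta_mx 0 i0.
  by rewrite /Bx evB evM ev_trmx ev_const evE /ev map_scalar_mx.
exists _, (row_mx (lin_mulmx Bx : 'M_(3 * m.+1, 3 * m.+1)) (map_mx (@mpolyC N.+1 F) A *m K)), (g * g1 * qx 0 i0); split.
  by rewrite !mevalM !mulf_neq0 // /qx mxE ev_cmp.
move=> y Cy; rewrite !mevalM !mulf_eq0 !negb_or => /andP[/andP[gy g1y] qy] z.
have [CPy yP] := gP y Cy gy; have [_ KE] := KP y g1y; rewrite ev_varmx in KE.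
have qE : exists c, ev y qx = c *: l (ev y P) by rewrite ev_cmpmx; exact: QlP.
rewrite -evE in qy; have [c qcE] := qE; have c0 : c != 0 by apply: contraNneq qy => c0; rewrite qcE c0 scale0r mxE.
have [fr LE] := frame CPy; have [a [b [a0 b0 yE GyE]]] := Gx y Cy.
have [b' b'E] : exists b', y = b' *m vec_mx (l (ev y P) *m Tb) by apply/submxP; rewrite LE.
have b'0 : b' != 0 by apply: contraNneq (cone_neq0 Cy) => b'0; rewrite b'E b'0 mul0mx.
have {a b a0 b0 yE GyE} GyE : G y = mxvec ((l (ev y P))^T *m b') by rewrite {1}b'E GE // l0.
have [Z ->] : exists Z, z = mxvec Z by exists (vec_mx z); rewrite vec_mxK.
rewrite ev_row_mx ev_lin_mulmx evM ev_const mul_mx_row mulmxA mul_vec_lin /= evBx; split.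
  rewrite -[X in _ = X]row_mx0 => /eq_row_mx[/eqP]; rewrite mxvec_eq0 mulmxBl subr_eq0 mul_scalar_mx -(mulmxA _ _ Z) -rowE.
  move=> /eqP ZE /KE/sub_rVP[t tE]; set q := ev y qx in qy qcE ZE; set r := (q 0 i0)^-1 *: row i0 Z.
  have {}ZE : Z = q^T *m r by rewrite /r -scalemxAr -ZE scalerA mulVf // scale1r.
  rewrite ZE AE qcE in tE; have := tE; rewrite {2}b'E scalemxAl => /(cancelT _ _ _ _ CPy) tb.
  by exists t; rewrite ZE qcE GyE [(c *: _)^T]linearZ /= -scalemxAl scalemxAr -tb -scalemxAr linearZ.
move=> [t tE]; have {tE} -> : Z = t *: ((l (ev y P))^T *m b').
  by apply: (can_inj mxvecK); rewrite tE GyE linearZ.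
have -> : mxvec (t *: ((l (ev y P))^T *m b')) *m A *m ev y K = 0.
  by rewrite linearZ /= -scalemxAl AE -b'E; apply/KE; exact: scalemx_sub.
rewrite -scalemxAr mulmxBl mul_scalar_mx -(mulmxA _ (delta_mx 0 i0)) (mulmxA (delta_mx 0 i0)) -rowE.
have -> : row i0 (l (ev y P))^T = (l (ev y P) 0 i0)%:M.
  by apply/matrixP => i j; rewrite !ord1 !mxE mulr1n.
rewrite mul_scalar_mx qcE -scalemxAr [(c *: _)^T]linearZ /= -scalemxAl scalerA mxE mulrC subrr.
by rewrite scaler0 linear0 row_mx0.
Qed.

Lemma segre_projection : isomorphic_projection (segre_variety F 2 m) X.
Proof.
have [G [Greg [Gx GE]]] := tensor_regline; have [A AE] := contraction_matrix Tb.
have h (z : Proj F (3 * m.+1)) : exists q : Proj F N.+1, vpick (val z) *m A != 0 -> coords (vpick (val z) *m A) q.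
  have [E|nz] := eqVneq (vpick (val z) *m A) 0; last by have [q qE] := coords_ex nz; exists q.
  have [|q _] := @coords_ex F N.+1 (delta_mx 0 0); last by exists q.
  by apply/rV0Pn; exists 0; rewrite mxE !eqxx oner_eq0.
have [f fP] := choice h.
have h' (p : Proj F N.+1) : exists q : Proj F (3 * m.+1), X p -> coords (G (vpick (val p))) q.
  have [Xp|nXp] := pselect (X p); last first.
    have [|q _] := @coords_ex F (3 * m.+1) (mxvec ((delta_mx 0 0 : 'rV_3)^T *m (delta_mx 0 0 : 'rV_m.+1))); last by exists q.
    by apply: segre_neq0; apply/rV0Pn; exists 0; rewrite mxE !eqxx oner_eq0.
  have [|a [c [a0 c0 _ GpE]]] := Gx (vpick (val p)); first by exists p => //; exact: vpick_coords.
  by have [q qE] := coords_ex (segre_neq0 a0 c0); exists q => _; rewrite GpE.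
have [g gP] := choice h'.
have fE p q (a : 'rV[F]_3) (c : 'rV[F]_m.+1) : coords a p -> coords c q -> coords (c *m vec_mx (a *m Tb)) (f (segre p q)).
  move=> pa qc; have [s s0 sE] := coords_prop (segreP pa qc) (vpick_coords (segre p q)).
  have x0 := cone_neq0 (segre_point (coords_neq0 pa) (coords_neq0 qc)).
  have := fP (segre p q); rewrite sE -scalemxAl AE scaler_eq0 negb_or s0 x0 => /(_ isT)/coords_scale.
  by move=> /(_ s^-1); rewrite scalerA mulVf // scale1r invr_eq0; apply.
have gE p v : X p -> coords v p -> coords (G v) (g p).
  move=> Xp vp; have [s s0 ->] := coords_prop (vpick_coords p) vp.
  have [_ sc _] := Greg; have Cp : cone X (vpick (val p)) by exists p => //; exact: vpick_coords.
  have [c cE] := sc _ s Cp s0; have [G0 _ _] := Greg; rewrite cE; apply: coords_scale; first exact: gP.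
  by apply: contraNneq (G0 _ (cone_scale Cp s0)) => c0; rewrite cE c0 scale0r.
have segre_ex (p : Proj F 3) (q : Proj F m.+1) : exists a c, (coords a p /\ coords c q) /\ coords (mxvec (a^T *m c)) (segre p q).
  exists (vpick (val p)), (vpick (val q)); split; first by split; exact: vpick_coords.
  by apply: segreP; exact: vpick_coords.
have fX p q : X (f (segre p q)).
  have [a [c [[pa qc] _]]] := segre_ex p q; apply/(cone_coords X (fE p q a c pa qc)).
  exact: segre_point (coords_neq0 pa) (coords_neq0 qc).
have lin z : segre_variety F 2 m z -> linear_map_at A z (f z).
  move=> [p [q [_ _ ->]]] v vz; have [a [c [[pa qc] pqE]]] := segre_ex p q.
  have [s s0 ->] := coords_prop pqE vz; rewrite -scalemxAl AE; apply: coords_scale s0; exact: fE.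
exists A, f; split=> //.
  rewrite /row_full eqn_leq rank_leq_col /= leqNgt; apply/negP => rA.
  have : cokermx A != 0 by rewrite -mxrank_eq0 mxrank_coker subn_eq0 -ltnNge.
  move=> /matrix0Pn[i [j Uij]]; pose c := col j (cokermx A).
  have /nondegX[x Cx xc] : c != 0 by apply: contra Uij => /eqP/colP/(_ i); rewrite !mxE => ->.
  have [a [b [_ _ xE _]]] := Gx x Cx; case/eqP: xc.
  by rewrite xE -AE /c colE mulmxA -(mulmxA _ A) mulmx_coker mulmx0 mul0mx.
split.
  split=> [z [p [q [_ _ ->]]]|z zS]; first exact: fX.
  exists setT, 1%N, (fun j => linmap A 0 j); split=> //.
  - by rewrite /zopen setCT; exact: zclosed0.
  - move=> j; rewrite mxE; apply: rpred_sum => k _; rewrite !mxE mulrC mul_mpolyC; apply: dhomogZ.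
    by rewrite dhomogX /= mdeg1.
  move=> q v Sq _ vq; have := lin q Sq v vq; congr coords; apply/rowP => j.
  by rewrite [RHS]mxE -evE ev_linmap.
exists g; split.
- apply: (regular_of_regline Greg) => [p v Xp|p Xp]; first exact: gE.
  have [|a [c [a0 c0 _ GpE]]] := Gx (vpick (val p)); first by exists p => //; exact: vpick_coords.
  have [[p1 pa] [q1 qc]] := (coords_ex a0, coords_ex c0); exists p1, q1; split=> //.
  by apply: coords_inj (segreP pa qc); rewrite -GpE; apply: gP.
- move=> z [p [q [_ _ ->]]]; have [a [c [[pa qc] pqE]]] := segre_ex p q.
  apply: coords_inj pqE; rewrite -GE; [|exact: coords_neq0 pa|exact: coords_neq0 qc].
  by apply: gE => //; exact: fE.
move=> p Xp; have [|a [c [a0 c0 xE GpE]]] := Gx (vpick (val p)); first by exists p => //; exact: vpick_coords.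
have [[p1 pa] [q1 qc]] := (coords_ex a0, coords_ex c0).
have -> : g p = segre p1 q1 by apply: coords_inj (segreP pa qc); rewrite -GpE; apply: gP.
by apply: coords_inj (vpick_coords p); rewrite xE; exact: fE.
Qed.

End SegreProjection.

(** * Assembling the theorem *)

Section Main.
Variable F : closedFieldType.
Hypothesis charF : [pchar F] =i pred0.
Hypothesis pigeonF : has_large_fibres F.

Lemma algind_krull d t (A : set (Proj F d)) (C : set 'rV[F]_d) (Y : 'M[F]_(d, t)) : irr C -> algind C Y ->
  zero_set C `<=` A -> (t <= (krull_dim A).+1)%N.
Proof.
case: t Y => // t Y iC indY CA; rewrite ltnS.
have ch := has_chainS (chain_of_algind charF pigeonF iC indY) CA.
by have [_] := krull_dim_max ch; apply.
Qed.

Lemma zero_set_cone_sub d (A : set (Proj F d)) : zclosed A -> irreducible A -> zero_set (cone A) `<=` A.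
Proof.
move=> Acl Airr; have iA := irr_cone Acl Airr; apply: (zero_set_sub (g := 1) Acl iA) => //.
by case: iA.
Qed.

Theorem scroll_over_surface_segre (N n : nat) (X : set (Proj F N.+1)) :
  manifold X -> krull_dim X = n -> non_degenerate X -> scroll_over_surface X ->
  secant_defect X = 2 -> secant_variety X <> setT ->
  isomorphic_projection (segre_variety F 2 (n - 2)%N) X.
Proof.
move=> [Xcl Xirr Xns] kX Xnd [e [W [[Wcl Wirr Wns] kW [r [E [pi [bundle lin]]]]]]] defect SXT.
have [L S] := scroll_of_bundle bundle lin Xirr.1.
have iX := irr_cone Xcl Xirr; have iW := irr_cone Wcl Wirr.
have nondegX : spanning (cone X).
  move=> l l0; apply: contrapT => h; apply: Xnd; exists l; split=> // p v Xp vp.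
  by apply/eqP; apply: contrapT => /negP vl; apply: h; exists v => //; exists p.
have [KX KXP] : exists K : 'rV[F]_N.+1 -> 'M[F]_(n.+1, N.+1), forall x, cone X x ->
    row_free (K x) /\ forall u, tang (cone X) x u <-> (u <= K x)%MS.
  have tb := tang_basis Xcl Xns; rewrite kX in tb.
  have h x : exists K : 'M[F]_(n.+1, N.+1), cone X x -> row_free K /\ forall u, tang (cone X) x u <-> (u <= K)%MS.
    by have [Cx|nCx] := pselect (cone X x); [have [K KP] := tb x Cx; exists K | exists 0].
  by have [K KP] := choice h; exists K.
have [KW KWP] : exists K : 'rV[F]_e.+1 -> 'M[F]_(3, e.+1), forall x, cone W x ->
    row_free (K x) /\ forall u, tang (cone W) x u <-> (u <= K x)%MS.
  have tb := tang_basis Wcl Wns; rewrite kW in tb.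
  have h x : exists K : 'M[F]_(3, e.+1), cone W x -> row_free K /\ forall u, tang (cone W) x u <-> (u <= K)%MS.
    by have [Cx|nCx] := pselect (cone W x); [have [K KP] := tb x Cx; exists K | exists 0].
  by have [K KP] := choice h; exists K.
have CWs s w : cone W w -> s != 0 -> cone W (s *: w) by exact: cone_scale.
have CXs s x : cone X x -> s != 0 -> cone X (s *: x) by exact: cone_scale.
have CW0 w : cone W w -> w != 0 by exact: cone_neq0.
have CX0 x : cone X x -> x != 0 by exact: cone_neq0.
have [w0 Cw0] : exists w, cone W w.
  by have [p Wp] := Wirr.1; exists (vpick (val p)), p => //; exact: vpick_coords.
have [m nE] : exists m, n = m.+2.
  have := fibre_rank S CW0 CWs KWP KXP Cw0; have : \rank (L w0) != 0%N by rewrite mxrank_eq0; refine (scroll_fibre0 S Cw0).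
  by case: (\rank (L w0)) => // k _ [kE]; exists k; rewrite kE.
have frames : local_frames m (cone X) (cone W) L.
  by move=> w Cw; apply: (local_frame S CW0 CWs KWP KXP) => //; rewrite nE.
have indX t (Y : 'M[F]_(N.+1, t)) : algind (cone X) Y -> (t <= m.+3)%N.
  by move=> indY; have := algind_krull iX indY (zero_set_cone_sub Xcl Xirr); rewrite kX nE.
have indW t (Y : 'M[F]_(e.+1, t)) : algind (cone W) Y -> (t <= 3)%N.
  by move=> indY; have := algind_krull iW indY (zero_set_cone_sub Wcl Wirr); rewrite kW.
have tW z : cone W z -> exists U : 'M[F]_(3, e.+1), tframe (cone W) z U.
  by move=> Cz; have [fr KE] := KWP z Cz; exists (KW z); split=> // a; apply/KE; exact: submxMl.
have [p1 Xp1] := Xirr.1; pose v1 := vpick (val p1); have v1p : coords v1 p1 := vpick_coords p1.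
have [p2 [Xp2 p12]] : exists p2, X p2 /\ p1 <> p2.
  have rv : (\rank v1 < N.+1)%N.
    have [fr _] := KXP v1 (ex_intro2 _ _ p1 Xp1 v1p); have := rank_leq_col (KX v1); rewrite (eqP fr) nE.
    by have := rank_leq_row v1; clear; lia.
  have [w Cw /row_subPn[i Li]] := fibres_span S nondegX rv.
  have x0 : row i (L w) != 0 by apply: contra Li => /eqP->; exact: sub0mx.
  have [p2 Xp2 xp2] : cone X (row i (L w)) by apply: (scroll_fibre S Cw x0); exact: row_sub.
  exists p2; split=> // p12; case/negP: Li; rewrite -p12 in xp2.
  by have [s _ ->] := coords_prop v1p xp2; exact: scalemx_sub.
(* Defect 2 gives dim SX = 2n - 1 with n = m + 2. *)
have kSX : krull_dim (secant_variety X) = (m.+1 + m.+1).+1.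
  by move: defect; rewrite /secant_defect kX nE; move: (krull_dim (secant_variety X)) => k; clear; lia.
have indSX t (Y : 'M[F]_(N.+1, t)) : algind (sums (cone X)) Y -> (t <= (m.+1 + m.+1).+2)%N.
  move=> indY; have := algind_krull (irr_sums iX) indY (zero_set_sums_secant charF Xcl Xirr Xp1 Xp2 p12).
  by rewrite kSX.
have secX : tangent_sums_le (m.+1 + m.+1).+2 (cone X).
  move=> x x' k k' U U' Cx Cx' tU tU'; apply: leq_trans (sum_tangent_bound charF iX KXP indSX Cx Cx').
  apply: mxrankS; apply: addsmxS; apply/rV_subP => u; first by move=> /tU/(KXP x Cx).2.
  by move=> /tU'/(KXP x' Cx').2.
have dimV : ((m.+1 + m.+1).+2 < N.+1)%N.
  have chX : has_chain (secant_variety X) 0.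
    exists (fun=> X); split=> // i _; split=> //; exact: sub_secant Xp1 Xp2 p12.
  by have [ch _] := krull_dim_max chX; have := secant_chain_bound charF SXT ch; rewrite kSX.
have full := full_osculation charF S iX iW CWs CW0 CXs CX0 frames indX secX dimV nondegX.
have [Tb [l [reg frame onto]]] := plane_map charF pigeonF Wcl S iW indW tW frames secX dimV nondegX full.
have -> : (n - 2)%N = m by rewrite nE; clear; lia.
refine (segre_projection S nondegX reg frame onto).
Qed.

End Main.

Theorem theorem6 (R : realType) (N n : nat) (X : set (Proj R[i] N.+1)) :
  manifold X -> krull_dim X = n -> non_degenerate X -> scroll_over_surface X ->
  secant_defect X = 2 -> secant_variety X <> setT ->
  projectively_equivalent (segre_variety R[i] 2 (n - 2)%N) X \/
  isomorphic_projection (segre_variety R[i] 2 (n - 2)%N) X.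
Proof.
(* An invertible matrix also counts as a linear projection, so the second alternative always
   holds. *)
move=> *; right; apply: scroll_over_surface_segre => //; first exact: pchar_num.
exact: pigeonhole.
Qed.
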